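(* There is a constant $C$ depending only on $(m,m_v)$ such that for all $p,q\in X_\infty$ there is a measured family of curves $(\Gamma,I_\Gamma,\Omega_\Gamma,\nu_\Gamma)$ joining $p$ to $q$ such that each curve $t\mapsto\Gamma(t,\omega)$ is $C$-Lipschitz, $\mathcal L^1(I_\Gamma)\le C\hat d_\infty(p,q)$, and $$\mu_\Gamma\le C\big(\mu_{\infty,p}\llcorner B(p,C\hat d_\infty(p,q))+\mu_{\infty,q}\llcorner B(q,C\hat d_\infty(p,q))\big).$$
   Context: Standing construction ($n=2$). Fix an integer $L\ge100$, $m=4$, $m_v=3L$. For $j\in\mathbb Z$, $Y_j$ is the cell complex on $\mathbb R^2$ given by the tiling by rectangles $[am^{-j},(a+1)m^{-j}]\times[bm_v^{-j},(b+1)m_v^{-j}]$, $a,b\in\mathbb Z$. Let $\Phi(x,y)=(m^{-1}x,m_v^{-1}y)$. For $k,\ell\in\mathbb Z$, $i\in\{1,2,3\}$, $a_{k,\ell,i}=\{k+\tfrac i4\}\times[(3\ell+i-1)m_v^{-1},(3\ell+i)m_v^{-1}]$. $\mathcal R$ is the equivalence relation on $\mathbb R^2$ generated by $p\sim p+(0,m_v^{-1})$ for $p\in a_{k,\ell,i}$. $\Phi^j_*\mathcal R=\{(\Phi^jp,\Phi^jq):(p,q)\in\mathcal R\}$; $\mathcal R_\infty$ is generated by all $\Phi^j_*\mathcal R$. $X_\infty=\mathbb R^2/\mathcal R_\infty$, $\hat\pi^\infty$ the quotient map, $\hat d_\infty$ the largest pseudodistance on $X_\infty$ such that for every $i\in\mathbb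 Z$ and every $2$-cell $\hat\sigma$ of $Y_i$, $\hat\pi^\infty(\hat\sigma)$ has diameter $\le m^{-i}$; $\mu_\infty=\hat\pi^\infty_\#\mathcal L^2$. A measured family of curves $(\Gamma,I_\Gamma,\Omega_\Gamma,\nu_\Gamma)$ is a measurable map $\Gamma:I_\Gamma\times\Omega_\Gamma\to X_\infty$ with $I_\Gamma\subset\mathbb R$ an interval and $\nu_\Gamma$ a probability measure on $\Omega_\Gamma$, such that for some $L'$ every $t\mapsto\Gamma(t,\omega)$ is $L'$-Lipschitz; it joins $p$ to $q$ if $\Gamma(\min I_\Gamma,\omega)=p$ and $\Gamma(\max I_\Gamma,\omega)=q$ for $\nu_\Gamma$-a.e. $\omega$. Its associated measure is $\mu_\Gamma=\Gamma_\#(\mathcal L^1\times\nu_\Gamma)$. The Riesz potential centered at $p$ is the measure $\mu_{\infty,p}=\frac{\hat d_\infty(p,\cdot)}{\mu_\infty(B(p,\hat d_\infty(p,\cdot)))}\mu_\infty$. *)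

(* Defs.v *)
From HB Require Import structures.
From mathcomp Require Import all_boot all_order all_algebra.
From mathcomp Require Import all_classical all_reals all_analysis.
Set Implicit Arguments. Unset Strict Implicit. Unset Printing Implicit Defensive.
Import Order.TTheory GRing.Theory Num.Theory.
Local Open Scope classical_set_scope.
Local Open Scope ring_scope.

Section Construction.
Variables (R : realType) (L : nat).

Definition pt := (R * R)%type.
Definition mh : R := 4.
Definition mv : R := (3 * L)%:R.

Definition Phi_pow (j : int) (p : pt) : pt := (mh ^ (- j) * p.1, mv ^ (- j) * p.2).

Definition seg_a (k l : int) (i : nat) : set pt :=
  [set p | p.1 = k%:~R + i%:R / 4 /\
           ((3 * l + i%:Z - 1)%:~R / mv <= p.2 <= (3 * l + i%:Z)%:~R / mv)].

Definition gen_R (p q : pt) : Prop :=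
  exists k l : int, exists i : nat, [/\ (1 <= i <= 3)%N, seg_a k l i p &
     q = (p.1, p.2 + mv^-1)].

Definition gen_Rinf (p q : pt) : Prop :=
  exists (j : int) (p0 q0 : pt), [/\ gen_R p0 q0, p = Phi_pow j p0 & q = Phi_pow j q0].

Inductive Rinf : pt -> pt -> Prop :=
| Rinf_base p q : gen_Rinf p q -> Rinf p q
| Rinf_refl p : Rinf p p
| Rinf_sym p q : Rinf p q -> Rinf q p
| Rinf_trans p q r : Rinf p q -> Rinf q r -> Rinf p r.

Definition Rinf_class (p : pt) : set pt := [set q | Rinf p q].

Definition Xinf : Type := {A : set pt | exists p, A = Rinf_class p}.

Definition pihat (p : pt) : Xinf := exist _ (Rinf_class p) (ex_intro _ p erefl).

Definition cell (i a b : int) : set pt :=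
  [set p | a%:~R * mh ^ (- i) <= p.1 <= (a + 1)%:~R * mh ^ (- i) /\
           b%:~R * mv ^ (- i) <= p.2 <= (b + 1)%:~R * mv ^ (- i)].

Definition is_pseudodist (delta : Xinf -> Xinf -> R) : Prop :=
  [/\ forall x y, 0 <= delta x y, forall x, delta x x = 0,
      forall x y, delta x y = delta y x &
      forall x y z, delta x z <= delta x y + delta y z].

Definition admissible (delta : Xinf -> Xinf -> R) : Prop :=
  is_pseudodist delta /\
  forall (i a b : int) (u v : pt), cell i a b u -> cell i a b v ->
    delta (pihat u) (pihat v) <= mh ^ (- i).

Definition dinf (x y : Xinf) : \bar R :=
  ereal_sup [set (delta x y)%:E | delta in admissible].

Definition Xmeasurable (A : set Xinf) : Prop := measurable (pihat @^-1` A).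

Definition leb2 := (@lebesgue_measure R \x @lebesgue_measure R)%E.

Definition muinf (A : set Xinf) : \bar R := leb2 (pihat @^-1` A).

Definition ball_inf (p : Xinf) (r : \bar R) : set Xinf := [set x | (dinf p x < r)%E].

Definition riesz_dens (p x : Xinf) : \bar R :=
  (dinf p x * inve (muinf (ball_inf p (dinf p x))))%E.

Definition riesz_restr (p : Xinf) (r : \bar R) (A : set Xinf) : \bar R :=
  (\int[leb2]_(z in pihat @^-1` (A `&` ball_inf p r)) riesz_dens p (pihat z))%E.

End Construction.

Section Curves.
Variables (R : realType) (L : nat) (d : measure_display) (Omega : measurableType d).

Definition curves_measurable (a b : R) (Gamma : R -> Omega -> Xinf R L) : Prop :=
  forall A, Xmeasurable A ->
    measurable (`[a, b] `*` setT `&` (fun z : R * Omega => Gamma z.1 z.2) @^-1` A).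

Definition mu_Gamma (nu : probability Omega R) (a b : R)
  (Gamma : R -> Omega -> Xinf R L) (A : set (Xinf R L)) : \bar R :=
  ((@lebesgue_measure R \x nu)
     (`[a, b] `*` setT `&` (fun z : R * Omega => Gamma z.1 z.2) @^-1` A))%E.

End Curves.

(* Main.v *)
Require Import Defs.
From HB Require Import structures.
From mathcomp Require Import all_boot all_order all_algebra.
From mathcomp Require Import all_classical all_reals all_analysis.
From mathcomp Require Import measurable_realfun.
From mathcomp Require Import zify ring lra.
Import Order.TTheory GRing.Theory Num.Theory.
Import numFieldNormedType.Exports.
Local Open Scope classical_set_scope.
Local Open Scope ring_scope.

(** Horizontal segments have their Euclidean length, and a point may jump for
    free across a gluing line, so a curve is described by a zigzag in [x] and,
    at each grid line, a translation of the height.  The curves of a pencil all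
    follow the same zigzag; what is random is the height, uniform on a row of
    scale [n] with [4^-n] comparable to [d(p, q)].  At stage [s] the zigzag
    sweeps a column of scale [n + s - 1] containing the end point, and every
    particle greedily jumps towards the row of that end point: this replaces the
    [s]-th digit of the height in base [m_v] by the digit of the end point.
    Since the height is at each time a translation on rows of the current scale,
    its law has density at most the inverse of the row height, and summing over
    the stages gives the Riesz potential.

    The comparison needs lower bounds for the distance, that is, Lipschitz
    functions on the quotient.  The vertical coordinate is corrected by
    collapsing, near each gluing line, the two glued rows, successively at all
    scales finer than [n].  The result is invariant under the fine gluings and
    equal to [y] on the grid of scale [n]; the coarse gluings meeting a window of
    width [4^-n] all lie on one vertical line, hence are of a single scale, and
    are handled by a distance to [h Z] together with one more collapse. *)

Set Implicit Arguments.
Unset Strict Implicit.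
Unset Printing Implicit Defensive.

(** * Scales and gluings *)

(** At distance comparable to 4^-n a ball has measure at most a constant times [wid n * hgt n], so
    the Riesz density is at least a constant over [hgt n]; this lower bound is all that is needed.
    Inverse row heights grow by the factor 3L per scale, so at a given point the finest box
    containing it dominates the sum over the stages. The obstacle is that close points of the
    quotient may be far apart in the plane: a gluing of scale coarser than n may jump by much more
    than [hgt n]. Both halves of the pencil must still start from one row, so closeness is first
    made combinatorial: from a common row on a common line, the row of either point is reached by
    boundedly many fine moves and at most one coarse jump. Fine moves are always available, because
    for each residue of a row mod 3 and each direction, one of the three gluing lines of a column
    offers the jump. Balls are never shown to be measurable, so their measures and the integrals
    over them are bounded by monotonicity on arbitrary sets. *)

Section Scales.
Context {R : realType} (L : nat).
Implicit Types (m n : int) (p q : pt R).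

Definition wid n : R := mh R ^ (- n).
Definition hgt n : R := mv R L ^ (- n).

Lemma intr4 (k : int) (i : nat) : (4 * k + i%:Z)%:~R = 4 * k%:~R + i%:R :> R.
Proof. by rewrite intrD intrM. Qed.

Lemma intr3 (k : int) (i : nat) : (3 * k + i%:Z)%:~R = 3 * k%:~R + i%:R :> R.
Proof. by rewrite intrD intrM. Qed.

Lemma intr3B (k : int) (i : nat) :
  (3 * k + i%:Z - 1)%:~R = 3 * k%:~R + i%:R - 1 :> R.
Proof. by rewrite intrB intr3. Qed.

Lemma wid_gt0 n : 0 < wid n.
Proof. by rewrite /wid exprz_gt0// /mh; lra. Qed.

Lemma widD m n : wid (m + n) = wid m * wid n.
Proof. by rewrite /wid opprD expfzDr// /mh pnatr_eq0. Qed.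

Lemma wid0 : wid 0 = 1.
Proof. by rewrite /wid oppr0 expr0z. Qed.

Lemma widN n : wid (- n) = (wid n)^-1.
Proof. by rewrite /wid opprK -invr_expz invrK. Qed.

Lemma wid1 : wid 1 = 4^-1.
Proof. by rewrite /wid -invr_expz expr1z. Qed.

Lemma widS n : wid n = 4 * wid (n + 1).
Proof. by rewrite widD wid1 mulrCA divff ?mulr1// pnatr_eq0. Qed.

Lemma wid_nat (k : nat) : wid k%:Z = 4^-1 ^+ k.
Proof. by rewrite /wid -invr_expz -exprnP exprVn. Qed.

Lemma le_wid m n : m <= n -> wid n <= wid m.
Proof.
move=> mn; have -> : n = m + `|n - m|%N%:Z by lia.
rewrite widD wid_nat -[leRHS]mulr1 ler_pM2l ?wid_gt0//.
by rewrite exprn_ile1//; lra.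
Qed.

Lemma wid_int m n : m <= n -> exists N : int, wid m = wid n * N%:~R.
Proof.
move=> mn; exists (4 ^+ `|n - m|%N).
have -> : m = n - `|n - m|%N%:Z by lia.
rewrite widD widN wid_nat rmorphXn/= exprVn invrK.
by have -> : (n - (n - `|n - m|%N%:Z) = `|n - m|%N%:Z) by lia.
Qed.

Hypothesis L100 : (100 <= L)%N.

Lemma mv_ge300 : 300 <= mv R L.
Proof. by rewrite /mv ler_nat; lia. Qed.

Lemma mv_gt0 : 0 < mv R L.
Proof. by have := mv_ge300; lra. Qed.

Lemma hgt_gt0 n : 0 < hgt n.
Proof. by rewrite /hgt exprz_gt0// mv_gt0. Qed.

Lemma hgtD m n : hgt (m + n) = hgt m * hgt n.
Proof. by rewrite /hgt opprD expfzDr// gt_eqF// mv_gt0. Qed.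

Lemma hgt0 : hgt 0 = 1.
Proof. by rewrite /hgt oppr0 expr0z. Qed.

Lemma hgtN n : hgt (- n) = (hgt n)^-1.
Proof. by rewrite /hgt opprK -invr_expz invrK. Qed.

Lemma hgt1 : hgt 1 = (mv R L)^-1.
Proof. by rewrite /hgt -invr_expz expr1z. Qed.

Lemma hgtS n : hgt n = mv R L * hgt (n + 1).
Proof. by rewrite hgtD hgt1 mulrCA divff ?mulr1// gt_eqF// mv_gt0. Qed.

Lemma hgt_nat (k : nat) : hgt k%:Z = (mv R L)^-1 ^+ k.
Proof. by rewrite /hgt -invr_expz -exprnP exprVn. Qed.

Lemma le_hgt m n : m <= n -> hgt n <= hgt m.
Proof.
move=> mn; have -> : n = m + `|n - m|%N%:Z by lia.
rewrite hgtD hgt_nat -[leRHS]mulr1 ler_pM2l ?hgt_gt0//.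
have := mv_ge300; have mp := mv_gt0 => mv300.
by apply: exprn_ile1; [rewrite invr_ge0 ltW | rewrite invf_le1//; lra].
Qed.

Lemma hgt_int m n : m <= n -> exists2 N : nat, (0 < N)%N & hgt m = hgt n * N%:R.
Proof.
move=> mn; exists ((3 * L) ^ `|n - m|)%N; first by rewrite expn_gt0; lia.
have -> : m = n - `|n - m|%N%:Z by lia.
rewrite hgtD hgtN hgt_nat natrX exprVn invrK.
by have -> : (n - (n - `|n - m|%N%:Z) = `|n - m|%N%:Z) by lia.
Qed.

(** Normal form of the generators. The scale is one more than the exponent of [Phi_pow], because the
    abscissas k + i/4 lie on the grid of width 1/4. Since 4 does not divide 4k + i, the abscissa
    alone determines m and i. *)
Definition glue m (k l : int) (i : nat) p q :=
  [/\ (1 <= i <= 3)%N, p.1 = wid m * (4 * k + i%:Z)%:~R,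
     (3 * l + i%:Z - 1)%:~R * hgt m <= p.2 <= (3 * l + i%:Z)%:~R * hgt m &
     q = (p.1, p.2 + hgt m)].

Lemma gen_Rinf_glue p q : gen_Rinf L p q <-> exists m k l i, glue m k l i p q.
Proof.
have hp := hgt_gt0; have mp := mv_gt0; have wp := wid_gt0.
split.
- move=> [j [p0 [q0 [[k [l [i [i13 [px py] ->]]]] -> ->]]]].
  exists (j + 1), k, l, i.
  have hE : mv R L ^ (- j) = mv R L * hgt (j + 1) by rewrite -hgtS.
  have wE : mh R ^ (- j) = 4 * wid (j + 1) by rewrite -widS.
  rewrite /glue /Phi_pow/= hE wE; split => //.
  + by rewrite px intr4; field.
  + have -> : mv R L * hgt (j + 1) * p0.2 = p0.2 * mv R L * hgt (j + 1) by ring.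
    rewrite !ler_pM2r ?hp//; move: py => /andP[py1 py2]; apply/andP.
    by split; [rewrite -ler_pdivrMr|rewrite -ler_pdivlMr].
  + have -> : mv R L * hgt (j + 1) * (p0.2 + (mv R L)^-1) =
      mv R L * hgt (j + 1) * p0.2 + hgt (j + 1).
      by rewrite mulrDr; congr (_ + _); rewrite mulrAC divff ?gt_eqF// mul1r.
    by [].
- case: p => px py [m [k [l [i [/= i13 pxE /andP[py1 py2] ->]]]]].
  exists (m - 1), (k%:~R + i%:R / 4, py / (mv R L * hgt m)),
    (k%:~R + i%:R / 4, py / (mv R L * hgt m) + (mv R L)^-1).
  have hE : mv R L ^ (- (m - 1)) = mv R L * hgt m by rewrite [LHS]hgtS subrK.
  have wE : mh R ^ (- (m - 1)) = 4 * wid m by rewrite [LHS]widS subrK.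
  have e0 := hp m.
  have s0 : mv R L * hgt m != 0 by rewrite gt_eqF// mulr_gt0.
  have sE : mv R L * hgt m * (py / (mv R L * hgt m)) = py by rewrite mulrC divfK.
  have xE : 4 * wid m * (k%:~R + i%:R / 4) = px by rewrite pxE intr4; field.
  split; [|by rewrite /Phi_pow/= hE wE sE xE|]; last first.
  + rewrite /Phi_pow/= hE wE xE [mv R L * hgt m * _]mulrDr sE mulrAC divff ?mul1r//.
    by rewrite gt_eqF.
  + exists k, l, i; split => //; split => //=.
    rewrite invfM mulrA [py / _ / _]mulrAC !ler_pM2r ?invr_gt0//.
    by rewrite ler_pdivlMr// ler_pdivrMr// py1.
Qed.

Lemma glue_Rinf m k l i p q : glue m k l i p q -> Rinf L p q.
Proof. by move=> g; apply/Rinf_base/gen_Rinf_glue; exists m, k, l, i. Qed.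

End Scales.
Arguments wid {R}.
Arguments hgt {R}.

(** * Rows of a given height and chains of cells *)

Section Rows.
Context {R : realType}.
Implicit Types (h x y : R).

(** Rows are half-open, so that every height lies in exactly one row. *)
Definition row h y : int := Num.floor (y / h).

Lemma row_itv h y : 0 < h -> (row h y)%:~R * h <= y < (row h y + 1)%:~R * h.
Proof. by move=> h0; rewrite -ler_pdivlMr// -ltr_pdivrMr// floor_itv. Qed.

Lemma row_def h y r : 0 < h -> r%:~R * h <= y < (r + 1)%:~R * h -> row h y = r.
Proof. by move=> h0; rewrite -ler_pdivlMr// -ltr_pdivrMr// => /floor_def. Qed.

Lemma rowDz h y r : 0 < h -> row h (y + r%:~R * h) = row h y + r.
Proof.
move=> h0; have /andP[a b] := row_itv y h0.
apply: row_def => //; rewrite !intrD in b *.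
by rewrite mulrDl lerD2r a/= [X in _ < X * h]addrAC mulrDl ltrD2r.
Qed.

Lemma rowB_lt h y y' : 0 < h -> y <= y' ->
  0 <= row h y' - row h y /\ (row h y' - row h y)%:~R * h < y' - y + h.
Proof.
move=> h0 yy'; have /andP[a b] := row_itv y h0; have /andP[a' b'] := row_itv y' h0.
split.
  have : (row h y)%:~R * h < (row h y' + 1)%:~R * h by lra.
  by rewrite ltr_pM2r// ltr_int; lia.
by rewrite intrB mulrBl; rewrite intrD mulrDl mul1r in b; lra.
Qed.

(** Step through the division points: two partial intervals at the ends and at most |y - y'|/h + 1
    whole ones between them, hence the 3. *)
Lemma chain_le (f : R -> R -> R) h w : 0 < h -> 0 <= w ->
  (forall u, f u u = 0) -> (forall u v, f u v = f v u) ->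
  (forall u v z, f u z <= f u v + f v z) ->
  (forall (b : int) u v, b%:~R * h <= u <= (b + 1)%:~R * h ->
     b%:~R * h <= v <= (b + 1)%:~R * h -> f u v <= w) ->
  forall y y', f y y' <= (`|y - y'| / h + 3) * w.
Proof.
move=> h0 w0 f0 fC fT fw y y'.
wlog yy' : y y' / y <= y'.
  move=> H; case: (leP y y') => [/H//|/ltW/H].
  by rewrite fC distrC.
have [d0 dlt] := rowB_lt h0 yy'.
have E (k : nat) b : f (b%:~R * h) ((b + k%:Z)%:~R * h) <= k%:R * w.
  elim: k => [|k IH]; first by rewrite addr0 f0 mul0r.
  apply: le_trans (fT _ _ _) _; rewrite -natr1 mulrDl mul1r; apply: lerD IH _.
  apply: (fw (b + k%:Z)).
    by rewrite lexx/= ler_pM2r// ler_int; lia.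
  by rewrite ler_pM2r// ler_int ler_pM2r// ler_int; apply/andP; split; lia.
have /andP[a b] := row_itv y h0; have /andP[a' b'] := row_itv y' h0.
have H1 : f y ((row h y)%:~R * h) <= w.
  apply: (fw (row h y)); first by rewrite a ltW.
  by rewrite lexx/= ler_pM2r// ler_int; lia.
have H3 : f ((row h y')%:~R * h) y' <= w.
  apply: (fw (row h y')); last by rewrite a' ltW.
  by rewrite lexx/= ler_pM2r// ler_int; lia.
have H2 := E `|row h y' - row h y|%N (row h y).
have E2 : row h y + `|row h y' - row h y|%N%:Z = row h y'.
  by rewrite gez0_abs// addrCA subrr addr0.
rewrite E2 in H2.
have T1 := fT y ((row h y)%:~R * h) y'.
have T2 := fT ((row h y)%:~R * h) ((row h y')%:~R * h) y'.
have E3 : `|row h y' - row h y|%N%:R = (row h y' - row h y)%:~R :> R.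
  by rewrite natr_absz ger0_norm.
rewrite E3 in H2.
have H4 : (row h y' - row h y)%:~R * w <= ((y' - y) / h + 1) * w.
  apply: ler_wpM2r => //; rewrite -(ler_pM2r h0) mulrDl mul1r divfK ?gt_eqF//.
  exact: ltW.
rewrite distrC ger0_norm ?subr_ge0//; lra.
Qed.

Lemma wid_small (e : R) : 0 < e -> exists k : nat, wid k%:Z < e.
Proof.
move=> e0; exists (Num.bound e^-1); rewrite wid_nat exprVn.
have := archi_boundP (ltW (_ : 0 < e^-1)); rewrite invr_gt0 => /(_ e0).
set k := Num.bound _ => ke.
have : k%:R < (4 ^ k)%:R :> R by rewrite ltr_nat ltn_expl.
rewrite natrX => k4.
rewrite -[ltRHS]invrK ltf_pV2 ?posrE ?invr_gt0//; exact: lt_trans k4.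
Qed.

End Rows.

(** * The quotient distance and its test functions *)

Section Dinf.
Context {R : realType} {L : nat}.
Hypothesis L100 : (100 <= L)%N.
Implicit Types (m n : int) (p q : pt R) (A B : Xinf R L).
Local Notation pihat := (@pihat R L).
Local Notation hgt := (@hgt R L).
Let hp := @hgt_gt0 R L L100.
Let wp := @wid_gt0 R.

(** The width of a cell equals the diameter allowed for it, so a chain of cells of scale k along a
    row costs at most |x - x'| + 3 * 4^-k; then k tends to infinity. *)
Lemma adm_horizontal (delta : Xinf R L -> Xinf R L -> R) x x' y :
  admissible delta -> delta (pihat (x, y)) (pihat (x', y)) <= `|x - x'|.
Proof.
move=> [[d0 drefl dsym dtri] dcell].
apply/ler_addgt0Pr => e e0.
have [k ke] : exists k : nat, wid k%:Z < e / 3 :> R by apply: wid_small; lra.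
have := @chain_le R (fun u v => delta (pihat (u, y)) (pihat (v, y)))
  (wid k) (wid k) (wp _) (ltW (wp _)) (fun _ => drefl _) (fun _ _ => dsym _ _)
  (fun _ _ _ => dtri _ _ _).
have /andP[a b] := row_itv y (hp k).
move=> /(_ _ x x') H; apply: le_trans (H _) _.
  move=> c u v uc vc; apply: (dcell k c (row (hgt k) y)) => /=; split => //=;
    by rewrite a/= ltW.
rewrite mulrDl divfK ?gt_eqF//; lra.
Qed.

Lemma adm_vertical (delta : Xinf R L -> Xinf R L -> R) x y y' n :
  admissible delta ->
  delta (pihat (x, y)) (pihat (x, y')) <= (`|y - y'| / hgt n + 3) * wid n.
Proof.
move=> [[d0 drefl dsym dtri] dcell].
have /andP[a b] := row_itv x (wp n).
apply: (@chain_le R (fun u v => delta (pihat (x, u)) (pihat (x, v)))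
  (hgt n) (wid n) (hp _) (ltW (wp _)) (fun _ => drefl _) (fun _ _ => dsym _ _)
  (fun _ _ _ => dtri _ _ _)).
move=> c u v uc vc; apply: (dcell n (row (wid n) x) c) => /=; split => //=;
    by rewrite a/= ltW.
Qed.

Lemma pihat_surj A : exists p, A = pihat p.
Proof.
case: A => A [p pA]; exists p; rewrite /Defs.pihat; move: (ex_intro _ _ _) => {}pA'.
subst A; congr exist; exact: Prop_irrelevance.
Qed.

Lemma pihat_eq p q : Rinf L p q -> pihat p = pihat q.
Proof.
move=> pq; rewrite /Defs.pihat.
have E : Rinf_class L p = Rinf_class L q.
  apply/seteqP; split => r /=; rewrite /Rinf_class /=.
    exact: Rinf_trans (Rinf_sym pq).
  exact: Rinf_trans pq.
move: (ex_intro _ _ _) (ex_intro _ _ _) => e1 e2.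
move: e1 e2; rewrite E => e1 e2; congr exist; exact: Prop_irrelevance.
Qed.

Lemma pihat_inj p q : pihat p = pihat q -> Rinf L p q.
Proof.
move=> /(congr1 sval)/= E; have qq : Rinf_class L q q by exact: Rinf_refl.
by rewrite -E in qq.
Qed.

Lemma admissible0 : admissible (fun _ _ : Xinf R L => 0).
Proof.
split; first by split => // *; rewrite addr0.
by move=> i a b u v _ _; exact: ltW (wp i).
Qed.

Lemma adm_le_dinf delta A B : admissible delta -> ((delta A B)%:E <= dinf A B)%E.
Proof. by move=> d; apply: ereal_sup_ubound; exists delta. Qed.

Lemma dinf_le A B (c : R) :
  (forall delta, admissible delta -> delta A B <= c) -> (dinf A B <= c%:E)%E.
Proof. by move=> H; apply: ge_ereal_sup => _ [d dA <-]; rewrite lee_fin H. Qed.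

Lemma dinf_ge0 A B : (0 <= dinf A B)%E.
Proof. exact: (adm_le_dinf A B admissible0). Qed.

Lemma dinf_fin A B : dinf A B \is a fin_num.
Proof.
have [[x y] ->] := pihat_surj A; have [[x' y'] ->] := pihat_surj B.
rewrite ge0_fin_numE ?dinf_ge0//.
apply: (@le_lt_trans _ _ (`|x - x'| + (`|y - y'| / hgt 0 + 3) * wid 0)%:E);
  last exact: ltry.
apply: dinf_le => d ad; case: (ad) => -[_ _ _ dT _].
apply: le_trans (dT _ (pihat (x', y)) _) _.
by apply: lerD; [exact: adm_horizontal|exact: adm_vertical].
Qed.

Definition dist A B : R := fine (dinf A B).

Lemma dinfE A B : dinf A B = (dist A B)%:E.
Proof. by rewrite fineK// dinf_fin. Qed.

Lemma adm_le_dist delta A B : admissible delta -> delta A B <= dist A B.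
Proof. by move=> /adm_le_dinf; rewrite -lee_fin -dinfE; apply. Qed.

Lemma dist_le A B (c : R) :
  (forall delta, admissible delta -> delta A B <= c) -> dist A B <= c.
Proof. by move=> /dinf_le; rewrite dinfE lee_fin. Qed.

Lemma dist_ge0 A B : 0 <= dist A B.
Proof. by rewrite -lee_fin -dinfE dinf_ge0. Qed.

Lemma distxx A : dist A A = 0.
Proof.
apply/eqP; rewrite eq_le dist_ge0 andbT; apply: dist_le.
by move=> d [[_ -> _ _] _].
Qed.

Lemma distC A B : dist A B = dist B A.
Proof.
apply/eqP; rewrite eq_le; apply/andP; split; apply: dist_le => d ad;
  by case: (ad) => -[_ _ -> _ _]; exact: adm_le_dist.
Qed.

Lemma dist_triangle B A A' : dist A A' <= dist A B + dist B A'.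
Proof.
apply: dist_le => d ad; case: (ad) => -[_ _ _ dT _].
by apply: le_trans (dT _ B _) _; apply: lerD; exact: adm_le_dist.
Qed.

Lemma dist_horizontal x x' y : dist (pihat (x, y)) (pihat (x', y)) <= `|x - x'|.
Proof. by apply: dist_le => d ad; exact: adm_horizontal. Qed.

Lemma dist_vertical x y y' n :
  dist (pihat (x, y)) (pihat (x, y')) <= (`|y - y'| / hgt n + 3) * wid n.
Proof. by apply: dist_le => d ad; exact: adm_vertical. Qed.

Lemma dist_box n (a b : R) x x' y y' :
  `|x - x'| <= a * wid n -> `|y - y'| <= b * hgt n ->
  dist (pihat (x, y)) (pihat (x', y')) <= (a + b + 3) * wid n.
Proof.
move=> xx' yy'; apply: le_trans (dist_triangle (pihat (x', y)) _ _) _.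
have := dist_horizontal x x' y; have := dist_vertical x' y y' n.
have : (`|y - y'| / hgt n + 3) * wid n <= (b + 3) * wid n.
  by rewrite ler_pM2r// lerD2r ler_pdivrMr.
lra.
Qed.

(** The source of all lower bounds: a function constant on gluings, with oscillation controlled on
    the cells of every scale, induces an admissible pseudodistance on the quotient, hence a
    competitor in the supremum. *)
Lemma dist_ge (f : pt R -> R) (C : R) p q : 0 < C ->
  (forall u v, gen_Rinf L u v -> f u = f v) ->
  (forall k a b u v, cell L k a b u -> cell L k a b v -> `|f u - f v| <= C * wid k) ->
  `|f p - f q| <= C * dist (pihat p) (pihat q).
Proof.
move=> C0 finv fcell.
have finv' u v : Rinf L u v -> f u = f v.
  by elim=> {u v} [u v /finv//|//|//|u v w _ -> _ ->].
pose rep A := xget (0, 0) [set p | A = pihat p].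
have repE u : f (rep (pihat u)) = f u.
  rewrite /rep; case: xgetP => [v _ /=/pihat_inj/finv' ->//|].
  by move=> /(_ u) [].
rewrite -ler_pdivrMl// mulrC.
have := @adm_le_dist (fun A B => `|f (rep A) - f (rep B)| / C) (pihat p) (pihat q).
rewrite !repE; apply; split; first split.
- by move=> A B; rewrite divr_ge0// ltW.
- by move=> A; rewrite subrr normr0 mul0r.
- by move=> A B; rewrite distrC.
- by move=> A B A'; rewrite -mulrDl ler_pM2r ?invr_gt0// ler_distD.
- by move=> k a b u v cu cv; rewrite !repE ler_pdivrMr// mulrC; exact: fcell cu cv.
Qed.

Lemma dist_ge_fst p q : `|p.1 - q.1| <= dist (pihat p) (pihat q).
Proof.
have := @dist_ge fst 1 p q ltr01; rewrite mul1r; apply.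
  by move=> u v [j [p0 [q0 [[k [l [i [_ _ ->]]]] -> ->]]]].
move=> k a b u v [+ _] [+ _]; rewrite mul1r -/(wid k) intrD => /andP[u1 u2] /andP[v1 v2].
by rewrite ler_norml; apply/andP; split; lra.
Qed.

End Dinf.
Arguments dist {R L}.

(** * A height function invariant under the fine gluings *)

Section Profiles.
Context {R : realType}.
Implicit Types (h s t u v x y : R).

Lemma eq0_wid (C a : R) : (forall k : nat, `|a| <= C * wid k%:Z) -> a = 0.
Proof.
move=> H; apply/eqP; rewrite -normr_le0; apply/ler_addgt0Pr => e e0; rewrite add0r.
have C0 : 0 <= C.
  have := H 0%N; rewrite wid0 mulr1; exact: le_trans.
have [k ke] : exists k : nat, wid k%:Z < e / (C + 1) :> R.
  by apply: wid_small; rewrite divr_gt0//; lra.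
apply: le_trans (H k) _; have w0 := @wid_gt0 R k.
by rewrite ltr_pdivlMr in ke; nra.
Qed.

(** The intervals of centre [a k] and radius [r k] are nested; the supremum of their left ends lies
    in all of them. *)
Lemma nested_limit (a r : nat -> R) :
  (forall k, `|a k.+1 - a k| <= r k - r k.+1) -> (forall k, 0 <= r k) ->
  exists l, forall k, `|l - a k| <= r k.
Proof.
move=> H r0.
have mono j k : (j <= k)%N -> `|a k - a j| <= r j - r k.
  elim: k => [|k IH]; first by rewrite leqn0 => /eqP->; rewrite !subrr normr0.
  rewrite leq_eqVlt => /predU1P[->|]; first by rewrite !subrr normr0.
  rewrite ltnS => /IH; have := H k; have := ler_distD (a k) (a k.+1) (a j); lra.
have ub j k : a j - r j <= a k + r k.
  have := r0 j; have := r0 k.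
  case: (leqP j k) => [jk|/ltnW jk]; have := mono _ _ jk; rewrite ler_norml => /andP[]; lra.
pose A := [set a k - r k | k in setT].
have supA : has_sup A.
  split; first by exists (a 0%N - r 0%N), 0%N.
  by exists (a 0%N + r 0%N) => _ [j _ <-]; exact: ub.
exists (sup A) => k; rewrite ler_norml; apply/andP; split.
  have : a k - r k <= sup A by apply: ub_le_sup; [exact: supA.2|exists k].
  lra.
have : sup A <= a k + r k.
  by apply: ge_sup; [exact: supA.1|move=> _ [j _ <-]; exact: ub].
lra.
Qed.

(** The distance from s to h Z, by rounding s / h to a nearest integer. *)
Definition distz h s := `|s - h * (Num.floor (s / h + 2^-1))%:~R|.

Lemma distz_half h s : 0 < h -> distz h s <= h / 2.
Proof.
move=> h0; rewrite /distz; have /andP[a b] := floor_itv (s / h + 2^-1).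
have -> : s - h * (Num.floor (s / h + 2^-1))%:~R =
    h * (s / h - (Num.floor (s / h + 2^-1))%:~R) by rewrite mulrBr mulrCA divff ?mulr1// gt_eqF.
rewrite normrM gtr0_norm// ler_pM2l// ler_norml intrD in b *; apply/andP; split; lra.
Qed.

Lemma distz_le h s (z : int) : 0 < h -> distz h s <= `|s - h * z%:~R|.
Proof.
move=> h0; have := distz_half s h0; rewrite /distz; set N := Num.floor _ => H.
have [->//|zN] := eqVneq z N.
apply: le_trans H _; have {zN} : 1 <= `|N%:~R - z%:~R : R|.
  by rewrite -intrB -intr_norm ler1z -gtz0_ge1 normr_gt0 subr_eq0 eq_sym.
have := distz_half s h0; rewrite /distz -/N => H H1.
have : h <= `|h * N%:~R - h * z%:~R|.
  by rewrite -mulrBr normrM gtr0_norm// ler_peMr// ltW.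
have := ler_distD s (h * N%:~R) (h * z%:~R).
rewrite [`|_ - s|]distrC; lra.
Qed.

Lemma distz_ex h s : exists z : int, distz h s = `|s - h * z%:~R|.
Proof. by exists (Num.floor (s / h + 2^-1)). Qed.

Lemma distz_lip h s t : 0 < h -> `|distz h s - distz h t| <= `|s - t|.
Proof.
move=> h0; wlog le : s t / distz h t <= distz h s.
  move=> H; case: (leP (distz h t) (distz h s)) => [/H//|/ltW/H].
  by rewrite distrC [`|t - s|]distrC.
rewrite ger0_norm ?subr_ge0//; have [z zE] := distz_ex h t.
have := distz_le s z h0; rewrite zE.
have := ler_distD t s (h * z%:~R); lra.
Qed.

Lemma distzDz h s (z : int) : 0 < h -> distz h (s + h * z%:~R) = distz h s.
Proof.
move=> h0; apply/eqP; rewrite eq_le; apply/andP; split.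
  have [y yE] := distz_ex h s; rewrite yE.
  have := distz_le (s + h * z%:~R) (y + z) h0; rewrite intrD mulrDr.
  by rewrite opprD addrACA subrr addr0.
have [y yE] := distz_ex h (s + h * z%:~R); rewrite yE.
have := distz_le s (y - z) h0; rewrite intrB mulrBr.
by rewrite opprB addrA.
Qed.

Lemma distz0 h : 0 < h -> distz h 0 = 0.
Proof.
move=> h0; apply/eqP; rewrite eq_le normr_ge0 andbT.
by have := distz_le 0 0 h0; rewrite mulr0 subr0 normr0.
Qed.

(** A cut-off of period 4. Its half-width 1/2 makes it, on the integers, the indicator of the class
    of i mod 4, that is, of the gluing lines of type i. *)
Definition tent (i : nat) t : R := Num.max 0 (1 - 2 * distz 4 (t - i%:R)).

Lemma tent_ge0 i t : 0 <= tent i t. Proof. by rewrite le_max lexx. Qed.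

Lemma tent_le1 i t : tent i t <= 1.
Proof.
rewrite ge_max ler01/=; have : 0 <= distz 4 (t - i%:R) by exact: normr_ge0.
lra.
Qed.

Lemma max0_lip (a b : R) : `|Num.max 0 a - Num.max 0 b| <= `|a - b|.
Proof.
rewrite ler_norml; have := ler_norm (a - b); have := ler_norm (b - a).
rewrite [`|b - a|]distrC; have := normr_ge0 (a - b).
by rewrite /Num.max; case: ltP => ?; case: ltP => ?; lra.
Qed.

Lemma tent_lip i t u : `|tent i t - tent i u| <= 2 * `|t - u|.
Proof.
apply: le_trans (max0_lip _ _) _.
have -> : 1 - 2 * distz 4 (t - i%:R) - (1 - 2 * distz 4 (u - i%:R)) =
  2 * (distz 4 (u - i%:R) - distz 4 (t - i%:R)) by ring.
rewrite normrM gtr0_norm// ler_pM2l//.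
have := @distz_lip 4 (u - i%:R) (t - i%:R) ltac:(lra).
have -> : u - i%:R - (t - i%:R) = u - t by ring.
by rewrite [`|u - t|]distrC.
Qed.

Lemma tent_int (i : nat) (N : int) : (1 <= i <= 3)%N ->
  tent i N%:~R = ((N %% 4)%Z == i%:Z)%:R.
Proof.
move=> i13; rewrite /tent; have h4 : 0 < 4 :> R by lra.
have [E|E] := eqVneq (N %% 4)%Z i%:Z.
  have -> : N%:~R - i%:R = 0 + 4 * (N %/ 4)%Z%:~R :> R.
    by rewrite {1}(divz_eq N 4) E intrD intrM/=; ring.
  by rewrite distzDz// distz0// mulr0 subr0 /Num.max ltr01.
have [z ->] := distz_ex 4 (N%:~R - i%:R : R).
have : 1 <= `|N%:~R - i%:R - 4 * z%:~R : R|.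
  have -> : N%:~R - i%:R - 4 * z%:~R = (N - i%:Z - 4 * z)%:~R :> R by rewrite !intrB intrM.
  rewrite -intr_norm ler1z -gtz0_ge1 normr_gt0; apply: contraNneq E => E0.
  have -> : N = i%:Z + z * 4 by lia.
  by rewrite addrC modzMDl modz_small//; lia.
by move=> H; rewrite /Num.max; case: ltP => //; lra.
Qed.

(** Flat on the first two thirds of each unit interval and of slope 3 on the last. With three rows
    as the unit, the two glued rows are flattened and the third makes up for them. *)
Definition stair v := (Num.floor v)%:~R + Num.max 0 (3 * (v - (Num.floor v)%:~R) - 2).

Lemma stair_bound v : (Num.floor v)%:~R <= stair v <= v.
Proof.
have /andP[a b] := floor_itv v; rewrite intrD in b.
by rewrite /stair /Num.max; case: ltP => ?; apply/andP; split; lra.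
Qed.

Lemma stair_lip_le u v : u <= v -> 0 <= stair v - stair u <= 3 * (v - u).
Proof.
move=> uv; have /andP[a b] := floor_itv u; have /andP[a' b'] := floor_itv v.
have : Num.floor u <= Num.floor v by apply: le_floor.
rewrite le_eqVlt => /predU1P[E|lt].
  rewrite /stair E in a b *; rewrite !intrD in b b'.
  rewrite /Num.max; case: ltP => ?; case: ltP => ?; apply/andP; split; lra.
have H : (Num.floor u)%:~R + 1 <= (Num.floor v)%:~R :> R.
  by rewrite -[1]/(1%:~R) -intrD ler_int -ltzD1 ltrD2r.
rewrite !intrD in b b'.
rewrite /stair /Num.max; case: ltP => ?; case: ltP => ?; apply/andP; split; lra.
Qed.

Lemma stair_lip u v : `|stair u - stair v| <= 3 * `|u - v|.
Proof.
wlog uv : u v / u <= v.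
  by move=> H; case: (leP u v) => [/H//|/ltW/H]; rewrite distrC [`|v - u|]distrC.
have /andP[a b] := stair_lip_le uv.
by rewrite distrC ger0_norm// distrC [`|v - u|]ger0_norm// subr_ge0.
Qed.

Lemma stair_flat (l : int) v : l%:~R <= v <= l%:~R + 2 / 3 -> stair v = l%:~R.
Proof.
move=> /andP[a b]; have E : Num.floor v = l by apply: floor_def; rewrite intrD; lra.
by rewrite /stair E /Num.max; case: ltP => // ?; lra.
Qed.

(* Collapses the rows [3l + i - 1] and [3l + i] of height [h] to a point. *)
Definition collapse (i : nat) h y :=
  h * (3 * stair ((y / h - (i%:R - 1)) / 3) + (i%:R - 1)).

Lemma collapse_lip i h y y' : 0 < h ->
  `|collapse i h y - collapse i h y'| <= 3 * `|y - y'|.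
Proof.
move=> h0; rewrite /collapse.
set u := (y / h - _) / 3; set v := (y' / h - _) / 3.
have -> : h * (3 * stair u + (i%:R - 1)) - h * (3 * stair v + (i%:R - 1)) =
  (h * 3) * (stair u - stair v) by ring.
have h3 : 0 < h * 3 by lra.
rewrite normrM gtr0_norm//.
have E : u - v = (y - y') / (h * 3) by rewrite /u /v; field; rewrite gt_eqF.
apply: le_trans (_ : h * 3 * (3 * `|u - v|) <= _).
  by rewrite ler_pM2l// stair_lip.
rewrite E normrM [`|_^-1|]gtr0_norm ?invr_gt0//.
have -> // : h * 3 * (3 * (`|y - y'| / (h * 3))) = 3 * `|y - y'|.
by field; rewrite gt_eqF.
Qed.

Lemma collapse_near i h y : 0 < h -> `|collapse i h y - y| <= 3 * h.
Proof.
move=> h0; rewrite /collapse; set u := (y / h - _) / 3.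
have -> : h * (3 * stair u + (i%:R - 1)) - y = (h * 3) * (stair u - u).
  by rewrite /u; field; rewrite gt_eqF.
rewrite normrM gtr0_norm ?mulr_gt0// [3 * h]mulrC ger_pMr ?mulr_gt0//.
have := stair_bound u; have := floor_itv u; rewrite intrD ler_norml => /andP[a b] /andP[c d].
by apply/andP; split; lra.
Qed.

Lemma collapse_flat (i : nat) h y (l : int) : 0 < h ->
  (3 * l + i%:Z - 1)%:~R * h <= y <= (3 * l + i%:Z + 1)%:~R * h ->
  collapse i h y = h * (3 * l + i%:Z - 1)%:~R.
Proof.
move=> h0 /andP[]; rewrite -ler_pdivlMr// -[y <= _]ler_pdivrMr// => H1 H2.
rewrite intr3B in H1; rewrite intrD intr3 in H2.
rewrite /collapse (@stair_flat l); first by rewrite intr3B; congr (_ * _); ring.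
by apply/andP; split; lra.
Qed.

End Profiles.

Section Height.
Context {R : realType} {L : nat}.
Hypothesis L100 : (100 <= L)%N.
Implicit Types (m n : int) (x y : R) (p q : pt R).
Local Notation hgt := (@hgt R L).
Let hp := @hgt_gt0 R L L100.
Let wp := @wid_gt0 R.

Definition shift (i : nat) m x y :=
  tent i (x / wid m) * (collapse i (hgt m) y - y).

(** On a gluing line of scale m this is the full collapse, on the lines of any coarser grid it is
    the identity, and the tents interpolate between them. *)
Definition fold m x y := y + (shift 1 m x y + shift 2 m x y + shift 3 m x y).

Lemma shift_bound i m x y : `|shift i m x y| <= 3 * hgt m.
Proof.
rewrite /shift normrM ger0_norm ?tent_ge0//.
have := tent_le1 i (x / wid m); have := tent_ge0 i (x / wid m).
have := collapse_near i y (hp m); have := hp m; nra.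
Qed.

Lemma shift_lip_y i m x y y' : `|shift i m x y - shift i m x y'| <= 4 * `|y - y'|.
Proof.
rewrite /shift -mulrBr normrM ger0_norm ?tent_ge0//.
have t1 := tent_le1 i (x / wid m); have t0 := tent_ge0 i (x / wid m).
apply: le_trans (_ : 1 * `|collapse i (hgt m) y - y - (collapse i (hgt m) y' - y')| <= _).
  by rewrite ler_wpM2r.
rewrite mul1r; have := collapse_lip i y y' (hp m).
have := ler_normB (collapse i (hgt m) y - collapse i (hgt m) y') (y - y').
have -> : collapse i (hgt m) y - y - (collapse i (hgt m) y' - y') =
  collapse i (hgt m) y - collapse i (hgt m) y' - (y - y') by ring.
lra.
Qed.

Lemma shift_lip_x i m x x' y :
  `|shift i m x y - shift i m x' y| <= 6 * (hgt m / wid m) * `|x - x'|.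
Proof.
rewrite /shift -mulrBl normrM.
have := tent_lip i (x / wid m) (x' / wid m).
rewrite -mulrBl normrM [`|_^-1|]gtr0_norm ?invr_gt0// => H1.
have H2 := collapse_near i y (hp m).
apply: le_trans (ler_pM _ _ H1 H2) _ => //.
have -> // : 2 * (`|x - x'| / wid m) * (3 * hgt m) = 6 * (hgt m / wid m) * `|x - x'|.
by field; rewrite gt_eqF.
Qed.

Lemma fold_near m x y : `|fold m x y - y| <= 9 * hgt m.
Proof.
rewrite /fold addrC addKr.
have := shift_bound 1 m x y; have := shift_bound 2 m x y; have := shift_bound 3 m x y.
have := ler_normD (shift 1 m x y + shift 2 m x y) (shift 3 m x y).
have := ler_normD (shift 1 m x y) (shift 2 m x y); lra.
Qed.

Lemma fold_lip_y m x y y' : `|fold m x y - fold m x y'| <= 13 * `|y - y'|.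
Proof.
have := shift_lip_y 1 m x y y'; have := shift_lip_y 2 m x y y'.
have := shift_lip_y 3 m x y y'; rewrite /fold.
set a := shift 1 m x y; set b := shift 2 m x y; set c := shift 3 m x y.
set a' := shift 1 m x y'; set b' := shift 2 m x y'; set c' := shift 3 m x y'.
have -> : y + (a + b + c) - (y' + (a' + b' + c')) =
  (y - y') + ((a - a') + (b - b') + (c - c')) by ring.
have := ler_normD (y - y') ((a - a') + (b - b') + (c - c')).
have := ler_normD ((a - a') + (b - b')) (c - c').
have := ler_normD (a - a') (b - b'); lra.
Qed.

Lemma fold_lip_x m x x' y :
  `|fold m x y - fold m x' y| <= 18 * (hgt m / wid m) * `|x - x'|.
Proof.
have := shift_lip_x 1 m x x' y; have := shift_lip_x 2 m x x' y.
have := shift_lip_x 3 m x x' y; rewrite /fold.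
set a := shift 1 m x y; set b := shift 2 m x y; set c := shift 3 m x y.
set a' := shift 1 m x' y; set b' := shift 2 m x' y; set c' := shift 3 m x' y.
have -> : y + (a + b + c) - (y + (a' + b' + c')) =
  ((a - a') + (b - b') + (c - c')) by ring.
have := ler_normD ((a - a') + (b - b')) (c - c').
have := ler_normD (a - a') (b - b').
set t := (hgt m / wid m); set d := `|x - x'|; lra.
Qed.

Lemma shift_grid i m (N : int) y : (1 <= i <= 3)%N ->
  shift i m (wid m * N%:~R) y =
  if (N %% 4)%Z == i%:Z then collapse i (hgt m) y - y else 0.
Proof.
move=> i13; rewrite /shift [wid m * _]mulrC mulfK ?lt0r_neq0// tent_int//.
by case: eqP => _; rewrite ?mul1r ?mul0r.
Qed.

Lemma fold_grid (i : nat) m (k : int) y : (1 <= i <= 3)%N ->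
  fold m (wid m * (4 * k + i%:Z)%:~R) y = collapse i (hgt m) y.
Proof.
move=> i13.
have E : ((4 * k + i%:Z) %% 4)%Z = i%:Z by rewrite mulrC modzMDl modz_small//; lia.
rewrite /fold !shift_grid// E.
by move: i i13 {E} => [|[|[|[|i]]]]//= _; rewrite ?addr0 ?add0r addrC subrK.
Qed.

Lemma fold_id m n (N : int) y : n < m -> fold m (wid n * N%:~R) y = y.
Proof.
move=> nm; have [z zE] := @wid_int R (n + 1) m ltac:(lia).
have -> : wid n * N%:~R = wid m * (z * N * 4)%:~R :> R.
  by rewrite widS zE !intrM; ring.
by rewrite /fold !shift_grid// modzMl/= !addr0.
Qed.

(** The finest fold acts first. On a gluing line of scale m the finer folds are the identity, so
    [fold m] receives the original heights and merges the glued points before any coarser fold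
    acts. *)
Fixpoint preheight n (k : nat) x y : R :=
  if k is k'.+1 then preheight n k' x (fold (n + 1 + k'%:Z) x y) else y.

Lemma preheight_lip_y n k x y y' :
  `|preheight n k x y - preheight n k x y'| <= 13 ^+ k * `|y - y'|.
Proof.
elim: k y y' => [|k IH] y y' /=; first by rewrite expr0 mul1r.
apply: le_trans (IH _ _) _; rewrite exprSr -mulrA ler_pM2l ?exprn_gt0//.
exact: fold_lip_y.
Qed.

(* The growth of the Lipschitz constants is beaten by the decay of the row
   heights, since [m_v >= 300]. *)
Lemma hgt_decay n k : 13 ^+ k * hgt (n + k%:Z) <= 16^-1 ^+ k * hgt n.
Proof.
elim: k => [|k IH]; first by rewrite !expr0 addr0.
have E : hgt (n + k%:Z) = mv R L * hgt (n + k.+1%:Z).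
  by rewrite hgtS//; congr (_ * hgt _); lia.
rewrite E in IH; rewrite !exprS.
have := hp (n + k.+1%:Z); have := mv_ge300 L100 (R := R).
have : 0 < 13 ^+ k :> R by rewrite exprn_gt0.
set a := 13 ^+ k in IH *; set b := 16^-1 ^+ k in IH *; set h := hgt _ in IH *.
move=> a0 M h0; have ah : 0 < a * h by rewrite mulr_gt0.
have : a * h * 300 <= a * h * mv R L by rewrite ler_pM2l.
lra.
Qed.

Lemma inv16_le_inv4 k : 16^-1 ^+ k <= wid k%:Z :> R.
Proof. by rewrite wid_nat lerXn2r// ?nnegrE; lra. Qed.

(** Radius of a geometric tail: the next fold changes the value by at most 9 * 13^k * hgt (n + 1 +
    k) <= (9/300) 16^-k hgt n, which is below [tol n k - tol n k.+1], equal to (15/160) 16^-k hgt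
    n. *)
Definition tol n k : R := 10^-1 * hgt n * 16^-1 ^+ k.

Lemma tol_ge0 n k : 0 <= tol n k.
Proof. by rewrite /tol !mulr_ge0 ?exprn_ge0// ltW. Qed.

Lemma hgt_decayS n k : 13 ^+ k * hgt (n + 1 + k%:Z) <= 300^-1 * (16^-1 ^+ k * hgt n).
Proof.
apply: le_trans (hgt_decay _ _) _.
rewrite mulrCA ler_pM2l ?exprn_gt0 ?invr_gt0//.
have := mv_ge300 L100 (R := R); have := hp (n + 1); rewrite (hgtS L100 n).
set h := hgt _ => h0 M; have : 300 * h <= mv R L * h by rewrite ler_pM2r.
by move=> H; lra.
Qed.

Lemma preheight_step n k x y :
  `|preheight n k.+1 x y - preheight n k x y| <= tol n k - tol n k.+1.
Proof.
rewrite /=; apply: le_trans (preheight_lip_y _ _ _ _ _) _.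
apply: le_trans (_ : 13 ^+ k * (9 * hgt (n + 1 + k%:Z)) <= _).
  by rewrite ler_pM2l ?exprn_gt0// fold_near.
have := hgt_decayS n k; have : 0 < 16^-1 ^+ k * hgt n.
  by rewrite mulr_gt0// exprn_gt0// invr_gt0.
rewrite /tol exprS; set a := 16^-1 ^+ k; set b := 13 ^+ k; lra.
Qed.

(** A further fold adds at most (72/300) 4^-k to the slope, in units of [hgt n / wid n], while the
    stated bound grows by (3/8) 4^-k. The decay 16^-k is 4^-k twice: one factor pays for the
    narrowing of the tents, the other makes the sum converge. *)
Lemma preheight_lip_x n k x x' y :
  `|preheight n k x y - preheight n k x' y| <=
  (hgt n / wid n) * ((1 - wid k%:Z) / 2) * `|x - x'|.
Proof.
elim: k y => [|k IH] y /=.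
  by rewrite wid0 !subrr normr0 mul0r mulr0 mul0r.
set z := fold _ x y; set z' := fold _ x' y.
have H1 := IH z'; have H2 := preheight_lip_y n k x z z'.
have H3 : `|z - z'| <= 18 * (hgt (n + 1 + k%:Z) / wid (n + 1 + k%:Z)) * `|x - x'|.
  exact: fold_lip_x.
have := ler_distD (preheight n k x z') (preheight n k x z) (preheight n k x' z').
have H4 := hgt_decayS n k; have H5 := inv16_le_inv4 k.
have E : wid (n + 1 + k%:Z) = wid n / 4 * wid k%:Z :> R by rewrite !widD wid1.
have Ek : wid k.+1%:Z = wid k%:Z / 4 :> R.
  by rewrite (_ : k.+1%:Z = k%:Z + 1) ?widD ?wid1//; lia.
rewrite Ek; move: H3; rewrite E => H3 H6.
have H7 : 13 ^+ k * `|z - z'| <=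
    (13 ^+ k * hgt (n + 1 + k%:Z)) * (72 / wid n / wid k%:Z) * `|x - x'|.
  apply: le_trans (_ : 13 ^+ k * (18 * (hgt (n + 1 + k%:Z) / (wid n / 4 * wid k%:Z)) * `|x - x'|) <= _).
    by rewrite ler_pM2l ?exprn_gt0.
  rewrite le_eqVlt; apply/orP; left; apply/eqP; field.
  by rewrite !gt_eqF.
have H8 : (13 ^+ k * hgt (n + 1 + k%:Z)) * (72 / wid n / wid k%:Z) <=
    72 / 300 * (hgt n / wid n) * wid k%:Z.
  apply: le_trans (_ : (300^-1 * (16^-1 ^+ k * hgt n)) * (72 / wid n / wid k%:Z) <= _).
    have D0 : 0 <= 72 / wid n / wid k%:Z :> R.
      by apply/ltW/divr_gt0 => //; exact: divr_gt0.
    exact: ler_wpM2r D0 _ _ H4.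
  have -> : 16^-1 ^+ k = wid k%:Z * wid k%:Z :> R.
    by rewrite wid_nat -exprMn; congr (_ ^+ _); field.
  rewrite le_eqVlt; apply/orP; left; apply/eqP; field.
  by rewrite !gt_eqF.
have H9 := ler_wpM2r (normr_ge0 (x - x')) H8.
have H10 : 0 <= hgt n / wid n * wid k%:Z * `|x - x'|.
  by apply: mulr_ge0 => //; apply/ltW/mulr_gt0 => //; exact: divr_gt0.
have H11 := le_trans H7 H9.
move: H1 H2 H6 H10 H11; clear.
set c := hgt n / wid n; set w := wid k%:Z; set d := `|x - x'|; nra.
Qed.

Definition height n p :=
  xget 0 [set l | forall k, `|l - preheight n k p.1 p.2| <= tol n k].

Lemma height_near n k x y : `|height n (x, y) - preheight n k x y| <= tol n k.
Proof.
rewrite /height; case: xgetP => [l _ /(_ k)//|].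
have [l lP] := nested_limit (fun k => preheight_step n k x y) (tol_ge0 n).
by move=> /(_ l) [].
Qed.

Lemma tol_wid n k : tol n k <= 10^-1 * hgt n * wid k%:Z.
Proof. by rewrite /tol ler_pM2l ?inv16_le_inv4// mulr_gt0// invr_gt0. Qed.

Lemma height_near0 n p : `|height n p - p.2| <= hgt n.
Proof.
case: p => x y; apply: le_trans (height_near n 0 x y) _.
by have := tol_wid n 0; rewrite wid0; have := hp n; lra.
Qed.

(** Compare with the first k folds. In units of [hgt n * wid k], the two tails cost 1/10 each, the
    vertical slope 13^k over one row costs 1, and the horizontal slope costs 1/2. *)
Lemma height_cell n (k : nat) a b u v :
  cell L (n + k%:Z) a b u -> cell L (n + k%:Z) a b v ->
  `|height n u - height n v| <= 2 * hgt n * wid k%:Z.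
Proof.
move: u v => [x y] [x' y'] [/= + +] [/= + +].
rewrite -/(wid _) -/(hgt _) !intrD !mulrDl !mul1r.
move=> /andP[x1 x2] /andP[y1 y2] /andP[x1' x2'] /andP[y1' y2'].
have dx : `|x - x'| <= wid n * wid k%:Z by rewrite -widD ler_norml; lra.
have dy : `|y - y'| <= hgt (n + k%:Z) by rewrite ler_norml; lra.
have H1 := height_near n k x y; have H2 := height_near n k x' y'.
have H3 := preheight_lip_x n k x x' y; have H4 := preheight_lip_y n k x' y y'.
have H5 := tol_wid n k; have H6 := hgt_decay n k; have H7 := inv16_le_inv4 k.
have H8 : 13 ^+ k * `|y - y'| <= wid k%:Z * hgt n.
  apply: le_trans (_ : 13 ^+ k * hgt (n + k%:Z) <= _).
    by rewrite ler_pM2l// exprn_gt0.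
  by apply: le_trans H6 _; rewrite ler_pM2r.
have H9 : hgt n / wid n * ((1 - wid k%:Z) / 2) * `|x - x'| <=
    2^-1 * hgt n * wid k%:Z.
  apply: le_trans (_ : hgt n / wid n * 2^-1 * (wid n * wid k%:Z) <= _).
    have A0 : 0 <= hgt n / wid n by apply/ltW/divr_gt0.
    have W1 : wid k%:Z <= 1 :> R by rewrite -wid0 le_wid.
    apply: ler_pM => //; first by apply: mulr_ge0 => //; lra.
    by apply: ler_wpM2l => //; have := wp k; lra.
  rewrite le_eqVlt; apply/orP; left; apply/eqP; field.
  by rewrite gt_eqF.
have := ler_distD (preheight n k x y) (height n (x, y)) (height n (x', y')).
have := ler_distD (preheight n k x' y) (preheight n k x y) (height n (x', y')).
have := ler_distD (preheight n k x' y') (preheight n k x' y) (height n (x', y')).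
have := ler_distD (preheight n k x' y') (preheight n k x' y) (preheight n k x' y').
rewrite [`|preheight n k x' y' - height _ _|]distrC.
have : 0 < hgt n * wid k%:Z by rewrite mulr_gt0.
lra.
Qed.

Lemma height_grid n (N : int) y : height n (wid n * N%:~R, y) = y.
Proof.
have E k : preheight n k (wid n * N%:~R) y = y.
  by elim: k y => //= k IH y; rewrite fold_id ?IH//; lia.
apply/eqP; rewrite -subr_eq0; apply/eqP.
apply: (@eq0_wid R (10^-1 * hgt n)) => k; apply: le_trans (tol_wid n k).
by rewrite -{2}(E k) height_near.
Qed.

Lemma height_glue n m k l i p q : n < m -> glue L m k l i p q ->
  height n p = height n q.
Proof.
move: p q => [x y] _ nm [/= i13 xE /andP[y1 y2] ->].
have [K mE] : exists K : nat, m = n + 1 + K%:Z by exists (absz (m - n - 1)%R); lia.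
have hm := hp m.
have C1 : collapse i (hgt m) y = hgt m * (3 * l + i%:Z - 1)%:~R.
  apply: collapse_flat => //; rewrite y1/=; apply: le_trans y2 _.
  by rewrite ler_pM2r// ler_int; lia.
have C2 : collapse i (hgt m) (y + hgt m) = hgt m * (3 * l + i%:Z - 1)%:~R.
  apply: collapse_flat => //; move: y1 y2; rewrite intrB [X in _ -> _ -> _ && (_ <= X * _)]intrD.
  by rewrite mulrBl mulrDl mul1r => y1 y2; apply/andP; split; lra.
(* The j folds finer than [fold m] are the identity on this line, so the value at any greater depth
   factors through [fold m], which merges the two heights. *)
have E1 j : preheight n (K + j).+1 x y = preheight n (K + j).+1 x (y + hgt m).
  suff H z : preheight n (K + j).+1 x z = preheight n K x (fold m x z).
    by rewrite !H xE !fold_grid// C1 C2.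
  elim: j z => [|j IH] z; first by rewrite addn0 /= mE.
  by rewrite addnS -IH/= xE [fold (n + 1 + (K + j).+1%:Z) _ _]fold_id//; lia.
apply/eqP; rewrite -subr_eq0; apply/eqP.
apply: (@eq0_wid R (10^-1 * hgt n * 2)) => j.
have H1 := height_near n (K + j).+1 x y.
have H2 := height_near n (K + j).+1 x (y + hgt m).
have H3 := tol_wid n (K + j).+1.
rewrite -E1 in H2; set P := preheight n (K + j).+1 x y in H1 H2.
have := ler_distD P (height n (x, y)) (height n (x, y + hgt m)).
rewrite [`|P - _|]distrC.
have H4 : wid (K + j).+1%:Z <= wid j%:Z :> R by apply: le_wid; lia.
have : 10^-1 * hgt n * wid (K + j).+1%:Z <= 10^-1 * hgt n * wid j%:Z.
  by rewrite ler_pM2l// mulr_gt0// invr_gt0.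
lra.
Qed.

End Height.

(** * Lower bounds for the distance *)

Section Adic.
Context {R : realType}.
Implicit Types (m n : int).
Let wp := @wid_gt0 R.

(** Factor the largest power of 4 out of N. With [adic_uniq], all gluings on one vertical line have
    the same scale and type; the line x = 0 has no such form and carries no gluing. *)
Lemma adic_form (N : int) n : N != 0 ->
  exists m k (i : nat), [/\ m <= n, (1 <= i <= 3)%N &
    wid n * N%:~R = wid m * (4 * k + i%:Z)%:~R :> R].
Proof.
have [c cN] := ubnP (absz N); elim: c N n cN => // c IH N n cN N0.
have E := divz_eq N 4; have M0 : 0 <= (N %% 4)%Z by apply: modz_ge0.
have M4 : (N %% 4)%Z < 4 by apply: ltz_pmod.
move: E M0 M4; set Q := (N %/ 4)%Z; set M := (N %% 4)%Z => E M0 M4.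
have [M00|M00] := eqVneq M 0.
  have [||m [k [i [mn i13 e]]]] := IH Q (n - 1); [lia|lia|].
  exists m, k, i; split => //; first by lia.
  by rewrite -e [wid (n - 1)]widS subrK E M00 addr0 intrM; ring.
exists n, Q, (absz M); split; [lia|lia|].
by congr (_ * _%:~R); lia.
Qed.

Lemma adic_uniq m m' k k' (i i' : nat) : (1 <= i <= 3)%N -> (1 <= i' <= 3)%N ->
  wid m * (4 * k + i%:Z)%:~R = wid m' * (4 * k' + i'%:Z)%:~R :> R ->
  [/\ m = m', k = k' & i = i'].
Proof.
have H (m1 m2 k1 k2 : int) (i1 i2 : nat) : (1 <= i2 <= 3)%N -> m1 < m2 ->
    wid m1 * (4 * k1 + i1%:Z)%:~R <> wid m2 * (4 * k2 + i2%:Z)%:~R :> R.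
  move=> i13 lt; have [N NE] := @wid_int R (m1 + 1) m2 ltac:(lia).
  rewrite [wid m1]widS NE => E.
  have : wid m2 * (4 * (N * (4 * k1 + i1%:Z)))%:~R = wid m2 * (4 * k2 + i2%:Z)%:~R :> R.
    by rewrite -E !intrM; ring.
  by move/(mulfI (lt0r_neq0 (wp m2)))/eqP; rewrite eqr_int => /eqP; lia.
move=> i13 i13' E; have [lt|lt|mm] := ltgtP m m'.
- by case: (H _ _ _ _ _ _ i13' lt E).
- by case: (H _ _ _ _ _ _ i13 lt (esym E)).
rewrite mm in E *; move/(mulfI (lt0r_neq0 (wp m')))/eqP: E.
by rewrite eqr_int => /eqP E; split; lia.
Qed.

Lemma adic_neq0 m k (i : nat) : (1 <= i <= 3)%N ->
  wid m <= `|wid m * (4 * k + i%:Z)%:~R| :> R.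
Proof.
move=> i13; rewrite normrM gtr0_norm//; apply: ler_peMr; first exact: ltW.
by rewrite -intr_norm ler1z -gtz0_ge1 normr_gt0; lia.
Qed.

End Adic.

Section Bump.
Context {R : realType} {L : nat}.
Hypothesis L100 : (100 <= L)%N.
Implicit Types (m n : int) (x y : R) (p q : pt R).
Local Notation hgt := (@hgt R L).
Local Notation height := (@height R L).
Local Notation glue := (@glue R L).
Local Notation pihat := (@pihat R L).
Let hp := @hgt_gt0 R L L100.
Let wp := @wid_gt0 R.

Lemma hgt_wid n k : hgt (n + k%:Z) <= hgt n * wid k%:Z.
Proof.
have H := hgt_decay L100 n k (R := R); have W := @inv16_le_inv4 R k.
have : 1 <= 13 ^+ k :> R by apply: exprn_ege1; lra.
have := hp n; have := hp (n + k%:Z).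
move: H W; set a := 16^-1 ^+ k; set b := 13 ^+ k; nra.
Qed.

Lemma hgt_wid0 k : hgt k%:Z <= wid k%:Z.
Proof. by have := hgt_wid 0 k; rewrite add0r hgt0 mul1r. Qed.

(** A test function for [dist_ge] localized around the line [xc]. Gluings finer than n are absorbed
    by [height n]; the others lie on lines where [height n] is y, so [Th] has to respect only those
    that meet the window. *)
Definition bumpf n xc lam (Th : R -> R) (u : pt R) : R :=
  Num.max 0 (1 - lam * `|u.1 - xc|) * Th (height n u).

(** On cells of scale at least n this is the product rule with [height_cell]; on coarser cells the
    oscillation is at most 1, which is already below wid j / wid n. *)
Lemma bump (n : int) (xc lam : R) (Th : R -> R) p q : 0 < lam ->
  (forall y, 0 <= Th y <= 1) ->
  (forall y y', `|Th y - Th y'| <= `|y - y'| / hgt n) ->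
  (forall m k l i u v, m <= n -> glue m k l i u v -> lam * `|u.1 - xc| < 1 ->
     Th u.2 = Th v.2) ->
  `|bumpf n xc lam Th p - bumpf n xc lam Th q| <= (lam + 2 / wid n) * dist (pihat p) (pihat q).
Proof.
move=> lam0 Th01 Thlip Thglue; set phi := bumpf n xc lam Th.
have w0 := wp n; have h0 := hp n.
have X01 u : 0 <= Num.max 0 (1 - lam * `|u - xc|) <= 1.
  rewrite le_max lexx/= ge_max ler01/=.
  by have := mulr_ge0 (ltW lam0) (normr_ge0 (u - xc)); lra.
have C0 : 0 < lam + 2 / wid n by rewrite addr_gt0// divr_gt0.
apply: (@dist_ge R L L100 phi _ p q C0).
- move=> u v /(gen_Rinf_glue L100)[m [k [l [i g]]]].
  have uv : u.1 = v.1 by case: g => _ _ _ ->.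
  have [nm|mn] := ltP n m; first by rewrite /phi /bumpf uv (height_glue L100 nm g).
  have [lt1|le1] := ltP (lam * `|u.1 - xc|) 1; last first.
    have M0 : Num.max 0 (1 - lam * `|u.1 - xc|) = 0.
      by apply/max_idPl; lra.
    by rewrite /phi /bumpf -uv M0 !mul0r.
  rewrite /phi /bumpf -uv; congr (_ * _).
  have [N NE] := @wid_int R m n mn.
  have uE : u.1 = wid n * (N * (4 * k + i%:Z))%:~R.
    by case: g => _ -> _ _; rewrite intrM mulrA NE.
  have Hu : height n u = u.2.
    by rewrite [in LHS](surjective_pairing u) uE height_grid.
  have Hv : height n v = v.2.
    by rewrite [in LHS](surjective_pairing v) -uv uE height_grid.
  by rewrite Hu Hv; exact: Thglue g _.
- move=> j a b u v cu cv.
  have [nj|jn] := leP n j; last first.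
    have wjn : 1 <= wid j / wid n :> R by rewrite ler_pdivlMr// mul1r le_wid// ltW.
    have P01 z : 0 <= phi z <= 1.
      rewrite /phi /bumpf; have := X01 z.1; have := Th01 (height n z); nra.
    have : `|phi u - phi v| <= 1.
      by rewrite ler_norml; have := P01 u; have := P01 v; lra.
    have := mulr_gt0 lam0 (wp j); lra.
  have [K jE] : exists K : nat, j = n + K%:Z by exists (absz (j - n)%R); lia.
  have dx : `|u.1 - v.1| <= wid j.
    case: cu cv => [+ _] [+ _]; rewrite -/(wid j) intrD mulrDl mul1r.
    by rewrite ler_norml; lra.
  rewrite jE in cu cv.
  have dh := height_cell L100 cu cv.
  have dT : `|Th (height n u) - Th (height n v)| <= 2 * wid K%:Z.
    by apply: le_trans (Thlip _ _) _; rewrite ler_pdivrMr// mulrAC.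
  have dX : `|Num.max 0 (1 - lam * `|u.1 - xc|) - Num.max 0 (1 - lam * `|v.1 - xc|)| <=
      lam * wid j.
    apply: le_trans (max0_lip _ _) _.
    have -> : 1 - lam * `|u.1 - xc| - (1 - lam * `|v.1 - xc|) =
      lam * (`|v.1 - xc| - `|u.1 - xc|) by ring.
    rewrite normrM gtr0_norm// ler_pM2l//.
    have := ler_dist_dist (v.1 - xc) (u.1 - xc).
    have -> : v.1 - xc - (u.1 - xc) = v.1 - u.1 by ring.
    by rewrite [`|v.1 - u.1|]distrC; lra.
  have E : wid K%:Z = wid j / wid n :> R by rewrite jE widD mulrAC divff ?mul1r ?lt0r_neq0.
  rewrite E in dT; rewrite mulrDl.
  move: dX dT; rewrite /phi /bumpf.
  have := X01 u.1; have := X01 v.1; have := Th01 (height n u); have := Th01 (height n v).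
  set X := Num.max 0 (1 - lam * `|u.1 - xc|); set X' := Num.max 0 (1 - lam * `|v.1 - xc|).
  set T := Th (height n u); set T' := Th (height n v).
  move=> T1' T1 X1' X1 dX dT.
  have -> : X * T - X' * T' = (X - X') * T + X' * (T - T') by ring.
  apply: le_trans (ler_normD _ _) _; rewrite !normrM.
  have -> : 2 / wid n * wid j = 2 * (wid j / wid n) :> R by ring.
  apply: lerD.
    apply: le_trans (_ : `|X - X'| * 1 <= _); last by rewrite mulr1.
    by apply: ler_wpM2l => //; rewrite ger0_norm; lra.
  apply: le_trans (_ : 1 * `|T - T'| <= _); last by rewrite mul1r.
  by apply: ler_wpM2r => //; rewrite ger0_norm; lra.
Qed.

(** For lam = 1 / wid n the bump has Lipschitz constant 3 / wid n, so it varies by less than 3/8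
    over a distance wid n / 8. As it is at least 1/2 at p, the point q must lie in its support. *)
Lemma bump_near (n : int) (xc : R) (psi : R -> R) p q :
  `|p.1 - xc| <= wid n / 2 ->
  (forall y, 0 <= psi y) -> psi (height n p) = 0 ->
  (forall y y', `|psi y - psi y'| <= 4 * `|y - y'|) ->
  (forall m k l i u v, m <= n -> glue m k l i u v -> `|u.1 - xc| < wid n ->
     psi u.2 = psi v.2) ->
  dist (pihat p) (pihat q) < wid n / 8 ->
  `|q.1 - xc| <= wid n /\ psi (height n q) <= 4 * hgt n.
Proof.
move=> px psi0 psip psilip psiglue d8.
have w0 := wp n; have h0 := hp n.
pose Th y := Num.max 0 (1 - psi y / (4 * hgt n)).
have wV0 : 0 < (wid n)^-1 :> R by rewrite invr_gt0.
have h40 : 0 < 4 * hgt n by rewrite mulr_gt0.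
have Th01 y : 0 <= Th y <= 1.
  rewrite le_max lexx/= ge_max ler01/=.
  by have := divr_ge0 (psi0 y) (ltW h40); lra.
have Thl y y' : `|Th y - Th y'| <= `|y - y'| / hgt n.
  apply: le_trans (max0_lip _ _) _.
  have -> : 1 - psi y / (4 * hgt n) - (1 - psi y' / (4 * hgt n)) =
    (psi y' - psi y) / (4 * hgt n) by ring.
  rewrite normrM [`|_^-1|]gtr0_norm ?invr_gt0// ler_pdivrMr// distrC.
  apply: le_trans (psilip _ _) _; rewrite le_eqVlt; apply/orP; left; apply/eqP.
  by field; rewrite lt0r_neq0.
have Thg m k l i u v : m <= n -> glue m k l i u v -> (wid n)^-1 * `|u.1 - xc| < 1 ->
    Th u.2 = Th v.2.
  move=> mn g; rewrite -ltr_pdivlMl ?invr_gt0// invrK mulr1 => ux.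
  by rewrite /Th (psiglue _ _ _ _ _ _ mn g ux).
have := @bump n xc (wid n)^-1 Th p q wV0 Th01 Thl Thg.
set phi := bumpf _ _ _ _ => H.
have H1 : `|phi p - phi q| < 1 / 2.
  apply: le_lt_trans H _.
  apply: lt_le_trans (_ : ((wid n)^-1 + 2 / wid n) * (wid n / 8) <= _).
    by rewrite ltr_pM2l// addr_gt0 ?divr_gt0// invr_gt0.
  have -> : ((wid n)^-1 + 2 / wid n) * (wid n / 8) = 3 / 8 :> R by field; rewrite lt0r_neq0.
  lra.
have H2 : 1 / 2 <= phi p.
  rewrite /phi /bumpf /Th psip mul0r subr0 [Num.max 0 1]max_r// mulr1 le_max.
  apply/orP; right; have : (wid n)^-1 * `|p.1 - xc| <= 1 / 2.
    by rewrite ler_pdivrMl//; lra.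
  lra.
have H3 : 0 < phi q.
  by move: H1; rewrite ltr_norml; lra.
have := Th01 (height n q); move: H3; rewrite /phi /bumpf => H3 T01.
split.
  rewrite leNgt; apply/negP => lt; move: H3.
  rewrite max_l ?mul0r ?ltxx//.
  have : 1 < (wid n)^-1 * `|q.1 - xc| by rewrite ltr_pdivlMl// mulr1.
  lra.
rewrite leNgt; apply/negP => lt; move: H3.
rewrite /Th [Num.max 0 (1 - psi _ / _)]max_l ?mulr0 ?ltxx//.
have : 1 < psi (height n q) / (4 * hgt n) by rewrite ltr_pdivlMr// mul1r.
lra.
Qed.

Definition near_plain n p q := `|q.2 - p.2| <= 6 * hgt n.

(** What a small distance says across a line with gluings of scale m. The first condition alone
    would allow any number of jumps, the second alone forgets the position inside a collapsed pair
    of rows. Replacing [height n] by y costs [hgt n] at each point, tripled by the collapse: 6 = 4 +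
    1 + 1 and 10 = 4 + 3 + 3. *)
Definition near_glued n m (i : nat) p q :=
  (exists z : int, `|q.2 - p.2 - hgt m * z%:~R| <= 6 * hgt n) /\
  `|collapse i (hgt m) q.2 - collapse i (hgt m) p.2| <= 10 * hgt n.

(** Around the grid line nearest to p, the open window of half-width [wid n] contains no other grid
    line, so the gluings of scale at most n in it are all on that line, and of one scale m. The test
    function is the distance to [hgt m] Z plus the collapse distance: both are unchanged by a jump,
    and their Lipschitz constants add up to 1 + 3. *)
Lemma near_dist n p : exists N : int, `|p.1 - wid n * N%:~R| <= wid n / 2 /\
  ((N = 0 /\ forall q, dist (pihat p) (pihat q) < wid n / 8 ->
      `|q.1 - wid n * N%:~R| <= wid n /\ near_plain n p q) \/
   exists m k (i : nat), [/\ m <= n, (1 <= i <= 3)%N,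
      wid n * N%:~R = wid m * (4 * k + i%:Z)%:~R :> R &
      forall q, dist (pihat p) (pihat q) < wid n / 8 ->
        `|q.1 - wid n * N%:~R| <= wid n /\ near_glued n m i p q]).
Proof.
have w0 := wp n; have h0 := hp n.
pose N := Num.floor (p.1 / wid n + 2^-1).
have pN : `|p.1 - wid n * N%:~R| <= wid n / 2 := distz_half p.1 w0.
exists N; split => //.
have gluex m k l i u v : m <= n -> glue m k l i u v ->
    `|u.1 - wid n * N%:~R| < wid n -> u.1 = wid n * N%:~R.
  move=> mn [i13 -> _ _]; have [z ->] := @wid_int R m n mn.
  rewrite -mulrA -intrM -mulrBr -intrB normrM gtr0_norm// gtr_pMr//.
  by rewrite -intr_norm ltrz1 => lt; congr (_ * _%:~R); lia.
have [N0|N0] := eqVneq N 0.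
  left; split => // q d8.
  have := @bump_near n (wid n * N%:~R) (fun y => `|y - height n p|) p q pN.
  case=> //; first by rewrite subrr normr0.
  - move=> y y'; apply: le_trans (ler_dist_dist _ _) _.
    have -> : y - height n p - (y' - height n p) = y - y' by ring.
    by have := normr_ge0 (y - y'); lra.
  - move=> m k l i u v mn g lt; have := gluex _ _ _ _ _ _ mn g lt.
    rewrite N0 mulr0 => u0; case: g => i13 uE _ _.
    have := @adic_neq0 R m k i i13; rewrite -uE u0 normr0.
    by have := wp m; lra.
  move=> qx H; split => //; rewrite /near_plain.
  have := height_near0 L100 n p; have := height_near0 L100 n q.
  have := ler_distD (height n q) q.2 p.2.
  have := ler_distD (height n p) (height n q) p.2.
  rewrite [`|q.2 - height n q|]distrC; lra.
right; have [m [k [i [mn i13 NE]]]] := @adic_form R N n N0.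
exists m, k, i; split => // q d8.
have hm := hp m.
have := @bump_near n (wid n * N%:~R)
  (fun y => distz (hgt m) (y - height n p) +
    `|collapse i (hgt m) y - collapse i (hgt m) (height n p)|) p q pN.
case=> //.
- by move=> y; rewrite addr_ge0// normr_ge0.
- by rewrite !subrr normr0 distz0// addr0.
- move=> y y'.
  have := distz_lip (y - height n p) (y' - height n p) hm.
  have -> : y - height n p - (y' - height n p) = y - y' by ring.
  have := collapse_lip i y y' hm.
  have := ler_dist_dist (collapse i (hgt m) y - collapse i (hgt m) (height n p))
    (collapse i (hgt m) y' - collapse i (hgt m) (height n p)).
  have -> : collapse i (hgt m) y - collapse i (hgt m) (height n p) -
    (collapse i (hgt m) y' - collapse i (hgt m) (height n p)) =
    collapse i (hgt m) y - collapse i (hgt m) y' by ring.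
  set a := distz (hgt m) (y - height n p); set a' := distz (hgt m) (y' - height n p).
  set b := `|collapse i (hgt m) y - collapse i (hgt m) (height n p)|.
  set b' := `|collapse i (hgt m) y' - collapse i (hgt m) (height n p)|.
  have := ler_normD (a - a') (b - b').
  have -> : a + b - (a' + b') = a - a' + (b - b') by ring.
  lra.
- move=> m' k' l i' u v mn' g lt; have ux := gluex _ _ _ _ _ _ mn' g lt.
  case: g => i13' uE /andP[u1 u2] ->/=.
  have [mm kk ii] : [/\ m' = m, k' = k & i' = i].
    by apply: (@adic_uniq R) => //; rewrite -uE ux NE.
  subst m' k' i'.
  have -> : u.2 + hgt m - height n p = u.2 - height n p + hgt m * 1%:~R by ring.
  rewrite distzDz// [collapse i (hgt m) u.2](@collapse_flat R i (hgt m) _ l)//; last first.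
    apply/andP; split; first by lra.
    by rewrite [(_ + 1)%:~R]intrD mulrDl mul1r; lra.
  rewrite [collapse i (hgt m) (u.2 + _)](@collapse_flat R i (hgt m) _ l)//.
  apply/andP; split; first by lra.
  by rewrite [(_ + 1)%:~R]intrD mulrDl mul1r; lra.
move=> qx H; split => //.
have Hq := height_near0 L100 n q; have Hp := height_near0 L100 n p.
have C0 := normr_ge0 (collapse i (hgt m) (height n q) - collapse i (hgt m) (height n p)).
split.
  have [z zE] := distz_ex (hgt m) (height n q - height n p); exists z.
  have D : `|height n q - height n p - hgt m * z%:~R| <= 4 * hgt n.
    by rewrite -zE; lra.
  move: Hq Hp D; rewrite !ler_norml => /andP[? ?] /andP[? ?] /andP[? ?].
  by apply/andP; split; lra.
have D0 : 0 <= distz (hgt m) (height n q - height n p) by exact: normr_ge0.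
have := collapse_lip i (height n q) q.2 hm; have := collapse_lip i (height n p) p.2 hm.
move: H; set A := collapse i _ (height n q); set B := collapse i _ q.2.
set A' := collapse i _ (height n p); set B' := collapse i _ p.2.
have := ler_distD A B B'; have := ler_distD A' A B'.
rewrite [`|B - A|]distrC; move: D0 Hp Hq (hp n); clear.
set d := distz _ _; set e := `|_ - p.2|; set e' := `|_ - q.2|; lra.
Qed.

End Bump.

Variant jump_route (B H e e' : int) : Prop :=
| JumpNone of e' = e
| JumpUp of 0 <= e - B < H & e' = e + H
| JumpDown of 0 <= e' - B < H & e = e' + H.

(* An opaque constant, so that it is never computed with in unary. *)
Fact radius_sig : {M : nat | (200 <= M)%N}. Proof. by exists 200%N. Qed.

Definition radius : nat := sval radius_sig.

Lemma radius_ge : 200 <= radius%:Z. Proof. exact: (svalP radius_sig). Qed.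

(** The unit is [hgt n] and H is the ratio of the coarse to the fine row height, so [B, B + H) is
    glued to [B + H, B + 2H). The number z of coarse jumps between the two rows is 0, 1 or 2, yet
    each route from b may use only one. *)
Lemma row_route (B H r r' z : int) :
  20 < H -> B - 5 <= r -> r <= r' -> r' <= B + 2 * H + 4 ->
  `|r' - r - z * H| <= 7 ->
  exists b e1 e1' e2 e2' : int,
    [/\ `|b - e1| <= radius%:Z, jump_route B H e1 e1' & `|e1' - r| <= radius%:Z] /\
    [/\ `|b - e2| <= radius%:Z, jump_route B H e2 e2' & `|e2' - r'| <= radius%:Z].
Proof.
move=> H20 rB rr' rB' zH; have M200 := radius_ge; move: M200.
move: (radius%:Z) => M M200.
have triv t : `|t - t| <= M by rewrite subrr normr0; lia.
have [z0|z1|z2] : [\/ z = 0, z = 1 | z = 2].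
- have z_gt : -1 < z.
    rewrite ltNge; apply/negP => zn.
    have : z * H <= - H by nia.
    by move: H20 rr' zH; clear; move: (z * H) => t; lia.
  have z_lt : z < 3.
    rewrite ltNge; apply/negP => zn.
    have : 3 * H <= z * H by nia.
    by move: H20 rB rB' zH; clear; move: (z * H) => t; lia.
  move: z_gt z_lt; clear; case: z => [[|[|[|z]]]|[|z]] //= _ _;
    [exact: Or31|exact: Or32|exact: Or33].
- subst z; rewrite mul0r subr0 in zH.
  exists r, r, r, r', r'; split.
    by split; [exact: triv|exact: JumpNone|exact: triv].
  by split; [lia|exact: JumpNone|exact: triv].
- subst z; rewrite mul1r in zH.
  (* The row r may miss [B, B + H) by a few rows; it is moved to the nearest row of that interval,
     from which the jump is allowed. *)
  have [e [e1 e2]] : exists e, 0 <= e - B < H /\ `|r - e| <= 20.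
    have [rlt|rge] := ltP r B; first by exists B; lia.
    have [rlt|rge'] := ltP r (B + H); first by exists r; lia.
    by exists (B + H - 1); lia.
  exists r, r, r, e, (e + H); split.
    by split; [exact: triv|exact: JumpNone|exact: triv].
  by split; [lia|exact: JumpUp|lia].
(* Here r is near B and r' near B + 2H: start in the middle, jump down once for r and up once for
   r'. *)
- subst z; exists (B + H), (B + H), B, (B + H - 1), (B + H - 1 + H); split.
    by split; [exact: triv|apply: JumpDown => //; lia|lia].
  by split; [lia|apply: JumpUp => //; lia|lia].
Qed.

(** * From small distance to rows reachable from a common row *)

Section Near.
Context {R : realType} {L : nat}.
Hypothesis L100 : (100 <= L)%N.
Implicit Types (m n : int) (x y : R) (p q : pt R).
Local Notation hgt := (@hgt R L).
Local Notation height := (@height R L).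
Local Notation glue := (@glue R L).
Local Notation pihat := (@pihat R L).
Let hp := @hgt_gt0 R L L100.
Let wp := @wid_gt0 R.

(** A rise of e on the slope 3 takes a length of only e / 3, so u and v are that close unless a flat
    step lies between them; then both are within e / 3 of that step. *)
Lemma stair_close (u v e : R) : u <= v -> stair v - stair u <= e -> e < 1 ->
  v - u <= e / 3 \/ exists l : int, l%:~R - e / 3 <= u /\ v <= l%:~R + 2 / 3 + e / 3.
Proof.
move=> uv; have /andP[a b] := floor_itv u; have /andP[a' b'] := floor_itv v.
have : Num.floor u <= Num.floor v by apply: le_floor.
have [E _|lt _] := eqVneq (Num.floor u) (Num.floor v).
  rewrite /stair E in a b *; rewrite !intrD in b b'.
  rewrite /Num.max; case: ltP => ?; case: ltP => ? H e1.
  - by left; lra.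
  - by right; exists (Num.floor v); lra.
  - by right; exists (Num.floor v); lra.
  - by right; exists (Num.floor v); lra.
have {}lt : Num.floor u < Num.floor v by rewrite lt_neqAle lt; apply: le_floor.
have [E|E] : Num.floor v = Num.floor u + 1 \/ Num.floor u + 2 <= Num.floor v.
  move: lt; clear; move: (Num.floor _) (Num.floor _) => A B; lia.
  rewrite /stair; rewrite E !intrD in a' b' *.
  rewrite intrD in b; move=> H e1; right; exists (Num.floor u + 1); rewrite intrD.
  move: H; rewrite /Num.max; case: ltP => ?; case: ltP => ? ?; lra.
have : (Num.floor u)%:~R + 2 <= (Num.floor v)%:~R :> R.
  by rewrite -[2]/(2%:~R) -intrD ler_int.
rewrite intrD in b; rewrite intrD in b'.
rewrite /stair /Num.max; case: ltP => ?; case: ltP => ? ? ?; lra.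
Qed.

Lemma collapse_close i (h y y' E : R) : 0 < h -> y <= y' ->
  collapse i h y' - collapse i h y <= E -> E < 3 * h ->
  y' - y <= E / 3 \/ exists l : int,
    (3 * l + i%:Z - 1)%:~R * h - E / 3 <= y /\ y' <= (3 * l + i%:Z + 1)%:~R * h + E / 3.
Proof.
move=> h0 yy'; rewrite /collapse.
set u := (y / h - _) / 3; set v := (y' / h - _) / 3 => H E3.
have yE : y = h * (3 * u + i%:R - 1) by rewrite /u; field; rewrite lt0r_neq0.
have yE' : y' = h * (3 * v + i%:R - 1) by rewrite /v; field; rewrite lt0r_neq0.
have uv : u <= v.
  by rewrite /u /v ler_pM2r ?invr_gt0// lerD2r ler_pM2r ?invr_gt0.
have h3 : 0 < 3 * h by rewrite mulr_gt0.
have EE : E = 3 * h * (E / (3 * h)) by field; rewrite lt0r_neq0.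
have H1 : stair v - stair u <= E / (3 * h).
  by rewrite ler_pdivlMr//; move: H; set a := stair v; set b := stair u; lra.
have H2 : E / (3 * h) < 1 by rewrite ltr_pdivrMr// mul1r.
move: EE H1 H2; set e := E / (3 * h) => EE H1 H2.
have [D|[l [D1 D2]]] := stair_close uv H1 H2.
  by left; rewrite yE yE' EE; move: (ler_wpM2l (ltW h3) D); lra.
right; exists l; rewrite intr3B intrD intr3 yE yE' EE.
by move: (ler_wpM2l (ltW h3) D1) (ler_wpM2l (ltW h3) D2); split; lra.
Qed.

Lemma eq_of_dist_hgt (C a : R) (n0 : nat) : 0 <= C ->
  (forall k : nat, `|a| <= C * hgt (n0 + k)%N%:Z) -> a = 0.
Proof.
move=> C0 H; apply: (@eq0_wid R C) => k; apply: le_trans (H k) _.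
apply: ler_wpM2l => //; apply: le_trans (le_hgt L100 (_ : k%:Z <= (n0 + k)%N%:Z)) _.
  by lia.
exact: hgt_wid0.
Qed.

(** Inside one collapsed pair of rows z is at most 2 in absolute value. The value 2 joins the bottom
    edge to the top edge, by two gluings through the middle. *)
Lemma collapse_eq_Rinf m k (i : nat) x y y' (z : int) : (1 <= i <= 3)%N ->
  x = wid m * (4 * k + i%:Z)%:~R ->
  collapse i (hgt m) y = collapse i (hgt m) y' -> y' - y = hgt m * z%:~R ->
  Rinf L (x, y) (x, y').
Proof.
move=> i13 xE; have hm := hp m.
wlog yy' : y y' z / y <= y'.
  move=> H C zE; case: (leP y y') => [yy'|/ltW yy']; first exact: H zE.
  apply/Rinf_sym/(H _ _ (- z)) => //.
  by rewrite -opprB zE intrN mulrN.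
move=> C zE; have := @collapse_close i (hgt m) y y' 0 hm yy'.
rewrite C subrr mul0r => /(_ (lexx _)); case; [by lra| |].
  by move=> H; have -> : y = y' by [lra]; exact: Rinf_refl.
move=> [l [l1 l2]].
have z0 : 0 <= z.
  have : 0 <= hgt m * z%:~R by rewrite -zE; lra.
  by rewrite pmulr_rge0// ler0z.
have E2 : (3 * l + i%:Z + 1)%:~R * hgt m = (3 * l + i%:Z - 1)%:~R * hgt m + 2 * hgt m.
  by rewrite intrB intrD; ring.
have E1 : (3 * l + i%:Z)%:~R * hgt m = (3 * l + i%:Z - 1)%:~R * hgt m + hgt m.
  by rewrite intrB; ring.
have z2 : z <= 2.
  have : hgt m * z%:~R <= hgt m * 2 by lra.
  by rewrite ler_pM2l// -[2]/(2%:~R) ler_int.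
have g a : (3 * l + i%:Z - 1)%:~R * hgt m <= a <= (3 * l + i%:Z)%:~R * hgt m ->
    Rinf L (x, a) (x, a + hgt m).
  by move=> aI; apply: (@glue_Rinf R L L100 m k l i).
have [z00|z1|z22] : [\/ z = 0, z = 1 | z = 2].
- by move: z0 z2; clear; case: z => [[|[|[|z]]]|z] //= _ _;
    [exact: Or31|exact: Or32|exact: Or33].
- have -> : y' = y by move: zE; rewrite z00 mulr0; lra.
  exact: Rinf_refl.
- rewrite z1 mulr1 in zE.
  by have -> : y' = y + hgt m by [lra]; apply: g; apply/andP; split; lra.
- rewrite z22 -[2%:~R]/(2 : R) in zE.
  apply: (@Rinf_trans _ _ _ (x, y + hgt m)); first by apply: g; apply/andP; split; lra.
  have -> : y' = y + hgt m + hgt m by lra.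
  by apply: g; apply/andP; split; lra.
Qed.

(** Separation of points: at distance zero the time interval must be a point, so the two ends have
    to coincide. The estimates hold at every scale with errors of order [hgt n], which vanish in the
    limit; the cases are an abscissa on no grid, the line x = 0, and a line with gluings of a fixed
    scale. *)
Lemma dist_eq0 p q : dist (pihat p) (pihat q) = 0 -> Rinf L p q.
Proof.
move: p q => [x y] [x' y'] d0.
have xx' : x = x'.
  have := dist_ge_fst L100 (x, y) (x', y'); rewrite d0/= normr_le0 subr_eq0.
  by move/eqP.
subst x'.
have d8 n : dist (pihat (x, y)) (pihat (x, y')) < wid n / 8 by rewrite d0 divr_gt0.
have [[n0 [N0 xE]]|notgrid] := pselect (exists n N, x = wid n * N%:~R :> R); last first.
  suff : y' - y = 0 by move/eqP; rewrite subr_eq0 => /eqP ->; exact: Rinf_refl.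
  apply: (@eq_of_dist_hgt 2 _ 0) => // n; rewrite add0n.
  have /andP[N1 N2] := row_itv x (wp n%:Z); move: N1 N2; set N := row _ _ => N1 N2.
  have {}N1 : N%:~R * wid n < x.
    rewrite lt_neqAle N1 andbT; apply/eqP => E; apply: notgrid.
    by exists n%:Z, N; rewrite mulrC.
  (* The open window of radius r around x meets no line of the grid of scale n, so no gluing of
     scale at most n constrains the test function. *)
  pose r := Num.min (x - N%:~R * wid n) ((N + 1)%:~R * wid n - x).
  have r0 : 0 < r by rewrite lt_min !subr_gt0 N1.
  pose yp := height n (x, y).
  pose Th t := Num.max 0 (1 - `|t - yp| / hgt n).
  have h0 := hp n%:Z.
  have Th01 t : 0 <= Th t <= 1.
    rewrite le_max lexx/= ge_max ler01/=.
    by have := divr_ge0 (normr_ge0 (t - yp)) (ltW h0); lra.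
  have := @bump R L L100 n%:Z x r^-1 Th (x, y) (x, y'); rewrite invr_gt0.
  move=> /(_ r0 Th01); rewrite d0 mulr0 normr_le0 subr_eq0 /bumpf/=.
  rewrite subrr normr0 mulr0 subr0 max_r// !mul1r => H.
  have /eqP : Th yp == Th (height n (x, y')).
    apply: H.
    - move=> t t'; apply: le_trans (max0_lip _ _) _.
      have -> : 1 - `|t - yp| / hgt n - (1 - `|t' - yp| / hgt n) =
        (`|t' - yp| - `|t - yp|) / hgt n by ring.
      rewrite normrM [`|_^-1|]gtr0_norm ?invr_gt0// ler_pM2r ?invr_gt0//.
      apply: le_trans (ler_dist_dist _ _) _.
      by have -> : t' - yp - (t - yp) = t' - t by [ring]; rewrite distrC.
    - move=> m k l i u v mn [i13 uE _ ->]/=.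
      rewrite mulrC ltr_pdivrMr// mul1r => ur; exfalso.
      have [z zE] := @wid_int R m n%:Z mn.
      move: uE; rewrite zE -mulrA -intrM; set Z := z * _ => uE.
      move: ur; rewrite lt_min uE => /andP[].
      have [ZN|NZ] := leP Z N.
        have : wid n * Z%:~R <= N%:~R * wid n :> R.
          by rewrite mulrC ler_pM2r// ler_int.
        by move=> ? +; have := ler_norm (x - wid n * Z%:~R); rewrite distrC; lra.
      have : (N + 1)%:~R * wid n <= wid n * Z%:~R :> R.
        by rewrite [leRHS]mulrC ler_pM2r// ler_int; move: NZ; clear; lia.
      by move=> ? _; have := ler_norm (wid n * Z%:~R - x); lra.
  rewrite {1}/Th subrr normr0 mul0r subr0 max_r// => T1.
  have : `|height n (x, y') - yp| <= 0.
    move: T1; rewrite /Th /Num.max; case: ltP => _ T1; last by lra.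
    have : `|height n (x, y') - yp| / hgt n <= 0 by lra.
    by rewrite ler_pdivrMr// mul0r.
  have := height_near0 L100 n%:Z (x, y); have := height_near0 L100 n%:Z (x, y').
  rewrite -/yp/= normr_le0 subr_eq0 => H1 H2 /eqP E.
  move: H1 H2; rewrite E !ler_norml; lra.
have nG n : n0 <= n -> exists2 N : int, x = wid n * N%:~R & 
    forall N' : int, `|x - wid n * N'%:~R| <= wid n / 2 -> N' = N.
  move=> nn; have [z zE] := @wid_int R n0 n nn.
  exists (z * N0); first by rewrite xE zE -mulrA intrM.
  move=> N'; rewrite xE zE -mulrA -mulrBr -intrM -intrB normrM gtr0_norm//.
  rewrite ler_pM2l// -intr_norm => H.
  have : `|z * N0 - N'|%:~R < 1 :> R by lra.
  by rewrite ltrz1; lia.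
have [x0|xn0] := eqVneq x 0.
  suff : y' - y = 0 by move/eqP; rewrite subr_eq0 => /eqP ->; exact: Rinf_refl.
  apply: (@eq_of_dist_hgt 6 _ `|n0|%N) => // k.
  have [|N xN NU] := nG (`|n0| + k)%N%:Z; first by lia.
  have [N' [/NU -> ]] := near_dist L100 (`|n0| + k)%N%:Z (x, y).
  case=> [[_ /(_ (x, y') (d8 _))[_]]//|[m [k' [i [_ i13 NE _]]]]].
  have := @adic_neq0 R m k' i i13; rewrite -NE -xN x0 normr0.
  by have := wp m; lra.
have N00 : N0 != 0.
  by apply: contraNneq xn0 => N00; rewrite xE N00 mulr0.
have [m [k [i [mn i13 xE']]]] := @adic_form R N0 n0 N00.
rewrite -xE in xE'; have hm := hp m.
(* The 18 is 3 * 6, the plain estimate seen through the collapse; the glued estimate gives 10. *)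
have near j : (exists z : int, `|y' - y - hgt m * z%:~R| <= 6 * hgt (`|n0| + j)%N%:Z) /\
    `|collapse i (hgt m) y' - collapse i (hgt m) y| <= 18 * hgt (`|n0| + j)%N%:Z.
  have hj := hp (`|n0| + j)%N%:Z.
  have [|N xN NU] := nG (`|n0| + j)%N%:Z; first by lia.
  have [N' [/NU -> ]] := near_dist L100 (`|n0| + j)%N%:Z (x, y).
  case=> [[_ /(_ (x, y') (d8 _))[_ H]]|[m' [k' [i' [_ i13' NE]]]]].
    split; first by exists 0; rewrite mulr0 subr0.
    by have := collapse_lip i y' y hm; move: H; rewrite /near_plain/=; lra.
  move=> /(_ (x, y') (d8 _))[_ [zz cc]].
  have [mm _ ii] : [/\ m' = m, k' = k & i' = i].
    by apply: (@adic_uniq R) => //; rewrite -NE -xN xE'.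
  by subst m' i'; split => //=; move: cc; rewrite /=; lra.
have [z zE] := distz_ex (hgt m) (y' - y).
apply: (@collapse_eq_Rinf m k i x y y' z i13 xE').
  apply/eqP; rewrite eq_sym -subr_eq0; apply/eqP.
  by apply: (@eq_of_dist_hgt 18 _ `|n0|%N) => // j; have [] := near j.
apply/eqP; rewrite -subr_eq0; apply/eqP.
apply: (@eq_of_dist_hgt 6 _ `|n0|%N) => // j; rewrite -zE.
by have [[z' z'E] _] := near j; apply: le_trans z'E; exact: distz_le.
Qed.

Definition row_glued n x (e e' : int) :=
  forall y, row (hgt n) y = e -> Rinf L (x, y) (x, y + (e' - e)%:~R * hgt n).

(** The shape of the route taken by a walk: at most [radius] rows from b to e, one free jump on the
    line x, at most [radius] rows to the row of y. The jump concerns a whole row at once because the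
    random heights fill a row. *)
Definition reachable n x (b : int) y := exists e e' : int,
  [/\ `|b - e| <= radius%:Z, row_glued n x e e' & `|e' - row (hgt n) y| <= radius%:Z].

Lemma row_glued_refl n x e : row_glued n x e e.
Proof. by move=> y _; rewrite subrr mul0r addr0; exact: Rinf_refl. Qed.

Lemma row_close (c : int) n y y' : `|y' - y| <= c%:~R * hgt n ->
  `|row (hgt n) y - row (hgt n) y'| <= c + 1.
Proof.
wlog yy' : y y' / y <= y'.
  move=> H; case: (leP y y') => [/H//|/ltW/H {}H].
  by rewrite distrC => /H; rewrite distrC.
rewrite ger0_norm ?subr_ge0// => H.
have [r0 r1] := rowB_lt (hp n) yy'; rewrite distrC ger0_norm//.
have : (row (hgt n) y' - row (hgt n) y)%:~R * hgt n < (c + 1)%:~R * hgt n.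
  by apply: lt_le_trans r1 _; rewrite intrD mulrDl mul1r; lra.
rewrite ltr_pM2r// ltr_int; exact: ltW.
Qed.

Lemma reachable_close (c : int) n x y y' : c <= 199 -> `|y' - y| <= c%:~R * hgt n ->
  exists b, reachable n x b y /\ reachable n x b y'.
Proof.
move=> c999 /row_close H; exists (row (hgt n) y); split.
  exists (row (hgt n) y), (row (hgt n) y); rewrite subrr normr0.
  by split; [|exact: row_glued_refl|].
exists (row (hgt n) y'), (row (hgt n) y').
rewrite subrr normr0; split; [|exact: row_glued_refl|by []].
by apply: le_trans H _; move: c999 radius_ge; clear; lia.
Qed.

Lemma row_gluedD n m k l (i : nat) (H r : int) : (1 <= i <= 3)%N ->
  hgt m = hgt n * H%:~R -> 0 <= r - (3 * l + i%:Z - 1) * H < H ->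
  let x := wid m * (4 * k + i%:Z)%:~R in
  row_glued n x r (r + H) /\ row_glued n x (r + H) r.
Proof.
move=> i13 mE rH x; have h0 := hp n.
have G y : row (hgt n) y = r -> Rinf L (x, y) (x, y + H%:~R * hgt n).
  move=> yr; have /andP[y1 y2] := row_itv y h0; rewrite yr in y1 y2.
  rewrite mulrC -mE; apply: (@glue_Rinf R L L100 m k l i); split => //=.
  rewrite mE [_ * H%:~R]mulrC !mulrA -!intrM; apply/andP; split.
    by apply: le_trans y1; rewrite ler_pM2r// ler_int; lia.
  by apply/ltW/(lt_le_trans y2); rewrite ler_pM2r// ler_int; lia.
split=> y yr.
  by have -> : r + H - r = H by [lia]; exact: G.
have -> : r - (r + H) = - H by lia.
apply: Rinf_sym; have := G (y - H%:~R * hgt n); rewrite subrK intrN mulNr; apply.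
by rewrite -mulNr -intrN rowDz// yr; lia.
Qed.

(** If the ratio H of row heights is at most 20, the collapse estimate alone keeps the heights
    within 10 + 2 * 3 * 20 = 130 rows. Otherwise they are within 4 rows, or both within 10/3 rows of
    one glued pair, and rounding to integer rows leads to [row_route]. *)
Lemma reachable_glued n m k (i : nat) y y' : m <= n -> (1 <= i <= 3)%N ->
  let x := wid m * (4 * k + i%:Z)%:~R in
  y <= y' -> (exists z : int, `|y' - y - hgt m * z%:~R| <= 6 * hgt n) ->
  `|collapse i (hgt m) y' - collapse i (hgt m) y| <= 10 * hgt n ->
  exists b, reachable n x b y /\ reachable n x b y'.
Proof.
move=> mn i13 x yy' [z zE] C; have h0 := hp n; have hm := hp m.
have [H H0 mE] := hgt_int L100 (R := R) mn.
have mE' : hgt m = hgt n * H%:Z%:~R by rewrite mE.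
have [H60|H60] := leqP H 20.
  apply: (@reachable_close 130); first by lia.
  have C1 := collapse_near i y hm; have C2 := collapse_near i y' hm.
  have : hgt m <= hgt n * 20 by rewrite mE ler_pM2l// ler_nat.
  move: C C1 C2; rewrite !ler_norml; lra.
have H60r : hgt n * 20 <= hgt m by rewrite mE ler_pM2l// ler_nat ltnW.
have [||D|[l [l1 l2]]] := @collapse_close i (hgt m) y y' (10 * hgt n) hm yy'.
- by move: C; rewrite ler_norml => /andP[].
- lra.
- apply: (@reachable_close 4); first by lia.
  by rewrite ger0_norm ?subr_ge0//; lra.
have /andP[a b] := row_itv y h0; have /andP[a' b'] := row_itv y' h0.
have RG t := @row_gluedD n m k l i H%:Z t i13 mE'.
move: a b a' b'; rewrite /reachable -/x; move: (row (hgt n) y) (row (hgt n) y') => r r'.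
move=> a b a' b'.
have [B BE] : exists B, B = (3 * l + i%:Z - 1) * H%:Z by eexists.
have {}RG t : 0 <= t - B < H%:Z -> row_glued n x t (t + H%:Z) /\ row_glued n x (t + H%:Z) t.
  by rewrite BE; exact: RG.
have BR : (3 * l + i%:Z - 1)%:~R * hgt m = B%:~R * hgt n by rewrite mE' BE intrM; ring.
have BR2 : (3 * l + i%:Z + 1)%:~R * hgt m = (B + 2 * H%:Z)%:~R * hgt n.
  by rewrite mE' BE !(intrD, intrM, intrB); ring.
have ih (s t : int) : s%:~R * hgt n < t%:~R * hgt n -> s < t by rewrite ltr_pM2r// ltr_int.
have zz : exists2 zH, zH = z * H%:Z & (zH%:~R * hgt n = hgt m * z%:~R).
  by exists (z * H%:Z) => //; rewrite mE' intrM; ring.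
case: zz => zH zHE zHR; rewrite -zHR in zE.
have rB : B - 5 <= r.
  have : B - 5 < r + 1; last by clear; lia.
  by apply: ih; rewrite intrB mulrBl; lra.
have rB' : r' <= B + 2 * H%:Z + 4.
  have : r' < B + 2 * H%:Z + 5; last by clear; lia.
  by apply: ih; rewrite [X in _ < X * _]intrD mulrDl; lra.
have rr' : `|r' - r - zH| <= 7.
  have s1 : r' - r - zH < 8.
    apply: ih; rewrite !intrB !mulrBl; rewrite intrD mulrDl mul1r in b.
    by move: zE; rewrite ler_norml; lra.
  have s2 : - 8 < r' - r - zH.
    apply: ih; rewrite !intrB !mulrBl; rewrite intrD mulrDl mul1r in b'.
    by move: zE; rewrite ler_norml; lra.
  by move: s1 s2; clear; lia.
have rler : r <= r'.
  by have : r < r' + 1; [apply: ih; lra|clear; lia].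
have HZ : 20 < H%:Z by [].
rewrite zHE in rr'.
have [b0 [e1 [e1' [e2 [e2' [[c1 c2 c3] [c4 c5 c6]]]]]]] :=
  row_route HZ rB rler rB' rr'.
have route e e' : jump_route B H%:Z e e' -> row_glued n x e e'.
  by case=> [->|eB ->|eB ->];
    [exact: row_glued_refl|exact: (RG _ eB).1|exact: (RG _ eB).2].
exists b0; split; first by exists e1, e1'; split => //; exact: route.
by exists e2, e2'; split => //; exact: route.
Qed.

(** The line and the row b serve both points: they are the common start of the two halves of the
    pencil. *)
Lemma near_rows n p q : dist (pihat p) (pihat q) < wid n / 8 ->
  exists N b : int, let x := wid n * N%:~R in
  [/\ `|p.1 - x| <= wid n, `|q.1 - x| <= wid n,
      reachable n x b p.2 & reachable n x b q.2].
Proof.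
move=> d8; have w0 := wp n.
have [N [pN H]] := near_dist L100 n p; exists N.
have pN' : `|p.1 - wid n * N%:~R| <= wid n by lra.
case: H => [[_ /(_ q d8)[qN np]]|[m [k [i [mn i13 NE /(_ q d8)[qN [zz cc]]]]]]].
  have [|b [bp bq]] := @reachable_close 6 n (wid n * N%:~R) p.2 q.2 _ np; first by lia.
  by exists b.
suff [b [bp bq]] : exists b, reachable n (wid n * N%:~R) b p.2 /\
    reachable n (wid n * N%:~R) b q.2 by exists b.
rewrite NE; case: (leP p.2 q.2) => [pq|/ltW qp]; first exact: reachable_glued.
have [||b [bq bp]] := @reachable_glued n m k i q.2 p.2 mn i13 qp.
- case: zz => z zE; exists (- z).
  have -> : p.2 - q.2 - hgt m * (- z)%:~R = - (q.2 - p.2 - hgt m * z%:~R).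
    by rewrite intrN; ring.
  by rewrite normrN.
- by rewrite distrC.
by exists b.
Qed.

End Near.

(** * Integration and the measure of balls *)

Section IntegralMonotone.
Import HBNNSimple.
Context {d} {T : measurableType d} {R : realType}.
Variable mu : {measure set T -> \bar R}.
Local Open Scope ereal_scope.

(* Measurability is not required: the integral of a nonnegative function is a
   supremum over the simple functions below it. *)
Lemma le_integral_any (D : set T) (f g : T -> \bar R) :
  (forall x, D x -> 0 <= f x) -> (forall x, D x -> f x <= g x) ->
  \int[mu]_(x in D) f x <= \int[mu]_(x in D) g x.
Proof.
move=> f0 fg; have g0 x : D x -> 0 <= g x by move=> Dx; exact: le_trans (f0 _ Dx) (fg _ Dx).
rewrite !ge0_integralE//; apply: ereal_sup_le => _ [h /= hf <-].
exists h => //= x; apply: le_trans (hf x) _.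
by rewrite !patchE; case: ifPn => // /[!inE] /fg.
Qed.

End IntegralMonotone.

Section LebesgueLine.
Context {R : realType}.
Local Notation leb := (@lebesgue_measure R).
Local Open Scope ereal_scope.

(** [lebesgue_measure] is given on all sets by an outer measure, so monotonicity holds without
    measurability, as is needed for sections of preimages of balls. *)
Lemma le_leb (A B : set R) : A `<=` B -> leb A <= leb B.
Proof. by move=> AB; rewrite /lebesgue_measure /lebesgue_stieltjes_measure /measure_extension; exact: le_mu_ext. Qed.

Lemma leb2_le (A B : set (R * R)) : A `<=` B -> leb2 A <= leb2 B.
Proof.
move=> AB; rewrite /leb2 /product_measure1; apply: le_integral_any => x _ //=.
by apply: le_leb => y; rewrite /xsection/= !inE; exact: AB.
Qed.

Local Notation RM := (measurableTypeR R).

Definition affine (s : bool) (a : R) : RM -> RM :=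
  fun t => (a + (if s then t else - t))%R.

Lemma measurable_affine s a : measurable_fun setT (affine s a).
Proof.
have H : measurable_fun [set: R] (fun t : R => (a + (if s then t else - t))%R).
  by case: s; [exact: measurable_funD|exact: measurable_funB].
exact: H.
Qed.

HB.instance Definition _ s a :=
  isMeasurableFun.Build _ _ RM RM (affine s a) (measurable_affine s a).

Lemma pushforward_affine s a (A : set RM) : measurable A ->
  pushforward leb (affine s a) A = leb A.
Proof.
move=> mA; apply/esym/lebesgue_measure_unique => //= _ [[u v]] _ <-.
rewrite /pushforward /affine; case: s.
  have -> : ((fun t : RM => (a + t)%R) @^-1` `]u, v]) = `](u - a)%R, (v - a)%R]%classic.
    by apply/seteqP; split => t /=; rewrite !in_itv/= => /andP[? ?]; apply/andP; split; lra.
  rewrite !lebesgue_measure_itv/= !lte_fin ltrD2r.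
  by case: ifP => // _; rewrite -!EFinB; congr (_%:E); lra.
have -> : ((fun t : RM => (a - t)%R) @^-1` `]u, v]) = `[(a - v)%R, (a - u)%R[%classic.
  by apply/seteqP; split => t /=; rewrite !in_itv/= => /andP[? ?]; apply/andP; split; lra.
rewrite !lebesgue_measure_itv/= !lte_fin ltrD2l ltrN2.
by case: ifP => // _; rewrite -!EFinB; congr (_%:E); lra.
Qed.

Lemma integral_affine s a (f : RM -> \bar R) : measurable_fun setT f ->
  (forall x, 0 <= f x) -> \int[leb]_t f (affine s a t) = \int[leb]_x f x.
Proof.
move=> mf f0.
have := @ge0_integral_pushforward _ _ RM RM R
  (affine s a) (measurable_affine s a) leb setT f measurableT mf (fun x _ => f0 x).
rewrite preimage_setT => /esym; rewrite /comp => ->.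
apply: eq_measure_integral => A mA _; exact: pushforward_affine.
Qed.

(* Bounds the part of [mu_Gamma] carried by one segment of unit speed. *)
Lemma segment_measure d (W : measurableType d) (nu : probability W R)
  (Y : W -> RM) (s : bool) (a c : R) (U : set RM) (S A : set (RM * RM)) : (0 <= c)%R ->
  measurable_fun setT Y ->
  (forall B : set RM, measurable B -> nu (Y @^-1` B) <= c%:E * leb B) ->
  measurable A -> measurable S ->
  (forall t w, U t -> A (affine s a t, Y w) -> S (affine s a t, Y w)) ->
  measurable U ->
  (leb \x nu) (U `*` setT `&` [set z | A (affine s a z.1, Y z.2)]) <=
    c%:E * leb2 (A `&` S).
Proof.
move=> c0 mY lawY mA mS AS mU.
have mAS : measurable (A `&` S) by exact: measurableI.
rewrite /leb2 /product_measure1.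
pose F x := leb (xsection (A `&` S) x).
have mF : measurable_fun setT F by exact: measurable_fun_xsection.
apply: (@le_trans _ _ (\int[leb]_t (c%:E * F (affine s a t)))).
  apply: le_integral_any => t _ //=.
  apply: le_trans (lawY (xsection (A `&` S) (affine s a t)) _); last first.
    exact: measurable_xsection.
  apply: le_measure; rewrite ?inE.
  - apply: measurable_xsection; apply: measurableI; first exact: measurableX.
    rewrite -[X in measurable X]setTI.
    have : measurable_fun setT (fun z : RM * W => (affine s a z.1, Y z.2)).
      by apply: measurable_fun_pair => /=;
        [apply: measurableT_comp => //; exact: measurable_affine|exact: measurableT_comp].
    by apply.
  - rewrite -[X in measurable X]setTI; apply: mY => //; exact: measurable_xsection.
  - move=> w; rewrite /xsection/= !inE => -[[Ut _] Aw]; split => //; exact: AS.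
rewrite ge0_integralZl//; last first.
  by apply: measurableT_comp => //; exact: measurable_affine.
by rewrite integral_affine.
Qed.

End LebesgueLine.

(** * The measure of balls and the Riesz density *)

Section Balls.
Context {R : realType} {L : nat}.
Hypothesis L100 : (100 <= L)%N.
Implicit Types (m n : int) (x y : R) (p q : pt R) (P : Xinf R L).
Local Notation hgt := (@hgt R L).
Local Notation pihat := (@pihat R L).
Local Notation leb := (@lebesgue_measure R).
Local Notation RM := (measurableTypeR R).
Let hp := @hgt_gt0 R L L100.
Let wp := @wid_gt0 R.

(* Opaque, so that the numeral is never computed with in unary. *)
Fact ball_const_sig : {c : R | 0 < c & 1080 <= c}.
Proof. by exists 1080%:R; [rewrite ltr0n|exact: lexx]. Qed.

Definition ball_const : R := s2val ball_const_sig.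

Lemma ball_const_gt0 : 0 < ball_const. Proof. exact: (s2valP ball_const_sig). Qed.

Lemma ball_const_ge : 1080 <= ball_const. Proof. exact: (s2valP' ball_const_sig). Qed.

Lemma leb_itvcc (a b : R) : a <= b -> leb `[a, b] = (b - a)%:E.
Proof.
move=> ab; rewrite lebesgue_measure_itv/= lte_fin.
by case: ltP => // ba; congr (_%:E); lra.
Qed.

Lemma finite_cover (F : nat -> set RM) (c : R) (N : nat) :
  (forall j, measurable (F j)) -> (forall j, (leb (F j) <= c%:E)%E) ->
  exists G : set RM, [/\ measurable G, forall j, (j < N)%N -> F j `<=` G &
    (leb G <= (N%:R * c)%:E)%E].
Proof.
move=> mF Fc; elim: N => [|N [G [mG FG Gc]]].
  by exists set0; split => //; rewrite measure0 mul0r.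
exists (G `|` F N); split; first exact: measurableU.
  move=> j; rewrite ltnS leq_eqVlt => /predU1P[-> y Fy|/FG jG y /jG]; first by right.
  by left.
apply: le_trans (measureU2 leb mG (mF N)) _.
by rewrite -natr1 mulrDl mul1r EFinD; exact: leeD Gc (Fc N).
Qed.

Lemma leb2_rect (I J : set RM) (a b : R) : measurable I -> measurable J ->
  (leb I <= a%:E)%E -> (leb J <= b%:E)%E -> (leb2 (I `*` J) <= (a * b)%:E)%E.
Proof.
move=> mI mJ Ia Jb; rewrite /leb2 product_measure1E// EFinM.
by apply: lee_pmul.
Qed.

(** By [near_dist] the ball lies over a strip of width 2 [wid n], inside 45 windows of height 12
    [hgt n], one for each z with |z| <= 22; and 2 * 45 * 12 = 1080. The bound on z is 10 + 6 + 6 in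
    units of [hgt m]: the collapse estimate, the two displacements by the collapse, and the error in
    z. *)
Lemma ball_measure n p (r : R) : r <= wid n / 8 ->
  (muinf (ball_inf (pihat p) r%:E) <= (ball_const * (wid n * hgt n))%:E)%E.
Proof.
move=> r8; have w0 := wp n; have h0 := hp n.
have inball q : (ball_inf (pihat p) r%:E) (pihat q) -> dist (pihat p) (pihat q) < wid n / 8.
  by rewrite /ball_inf/= dinfE// lte_fin => /lt_le_trans; apply.
have [N [_ H]] := near_dist L100 n p.
pose I : set RM := `[wid n * N%:~R - wid n, wid n * N%:~R + wid n]%classic.
have mI : measurable I by exact: measurable_itv.
have Ic : (leb I <= (2 * wid n)%:E)%E.
  by rewrite leb_itvcc ?lee_fin; lra.
have inI q : `|q.1 - wid n * N%:~R| <= wid n -> I q.1.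
  by rewrite /I/= in_itv/= ler_norml; lra.
suff [J [mJ Jc JP]] : exists J : set RM, [/\ measurable J, (leb J <= (45 * (12 * hgt n))%:E)%E &
    forall q, dist (pihat p) (pihat q) < wid n / 8 -> I q.1 /\ J q.2].
  apply: (@le_trans _ _ (leb2 (I `*` J))).
    by rewrite /muinf; apply: leb2_le => q /inball /JP[].
  apply: le_trans (leb2_rect mI mJ Ic Jc) _.
  have W0 : 0 < wid n * hgt n by rewrite mulr_gt0.
  rewrite lee_fin; apply: le_trans (_ : 1080 * (wid n * hgt n) <= _); first by lra.
  by rewrite ler_pM2r// ball_const_ge.
pose F (h : R) (j : nat) : set RM :=
  `[p.2 + h * (j%:R - 22) - 6 * hgt n, p.2 + h * (j%:R - 22) + 6 * hgt n]%classic.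
case: H => [[_ H]|[m [k [i [mn i13 NE H]]]]].
  (* With spacing 0 the 45 windows coincide; the number is kept so that both cases share one
     bound. *)
  have [J [mJ JP Jc]] := @finite_cover (F 0) (12 * hgt n) 45
    (fun j => measurable_itv _) ltac:(move=> j; rewrite leb_itvcc ?lee_fin; lra).
  exists J; split => // q /H[q1 q2]; split; first exact: inI.
  apply: (JP 0%N) => //; rewrite /F/= in_itv/= mul0r addr0.
  by move: q2; rewrite /near_plain ler_norml; lra.
have hm := hp m.
have [J [mJ JP Jc]] := @finite_cover (F (hgt m)) (12 * hgt n) 45
  (fun j => measurable_itv _) ltac:(move=> j; rewrite leb_itvcc ?lee_fin; lra).
exists J; split => // q /H[q1 [[z zE] C]]; split; first exact: inI.
have C1 := collapse_near i q.2 hm; have C2 := collapse_near i p.2 hm.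
have hmn : hgt n <= hgt m by apply: le_hgt.
have zb : `|hgt m * z%:~R| <= hgt m * 22.
  move: C C1 C2 zE; rewrite !ler_norml => /andP[? ?] /andP[? ?] /andP[? ?] /andP[? ?].
  by apply/andP; split; lra.
have {}zb : `|z| <= 22.
  move: zb; rewrite normrM gtr0_norm// ler_pM2l// -intr_norm.
  by rewrite -[22 : R]/(22%:~R) ler_int.
have [j zj j45] : exists2 j : nat, z = j%:Z - 22 & (j < 45)%N.
  by exists (absz (z + 22)%R); move: zb; clear; lia.
apply: (JP j) => //; rewrite /F/= in_itv/=.
have -> : j%:R - 22 = z%:~R :> R by rewrite zj intrB.
by move: zE; rewrite ler_norml; lra.
Qed.

Lemma scale_ex (d : R) : 0 < d -> exists n : int, wid n / 32 <= d < wid n / 8.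
Proof.
move=> d0; have e0 : 0 < 8 * d by rewrite mulr_gt0.
have [k1 k1P] := wid_small e0.
have [k2 k2P] : exists k : nat, wid k%:Z < (8 * d)^-1 by apply: wid_small; rewrite invr_gt0.
have ex : exists j : nat, 8 * d < wid (k1%:Z - j%:Z).
  exists (k1 + k2)%N; have -> : k1%:Z - (k1 + k2)%N%:Z = - k2%:Z by lia.
  by rewrite widN -[ltLHS]invrK ltf_pV2// posrE ?invr_gt0.
case: (ex_minnP ex) => -[|j] j1 j2; first by rewrite subr0 in j1; lra.
exists (k1%:Z - j.+1%:Z).
have : wid (k1%:Z - j%:Z) <= 8 * d.
  by rewrite leNgt; apply/negP => /j2; rewrite ltnn.
have -> : wid (k1%:Z - j%:Z) = wid (k1%:Z - j.+1%:Z) / 4 :> R.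
  by rewrite -wid1 -widD; congr wid; lia.
by move=> H; apply/andP; split; lra.
Qed.

Lemma riesz_dens_ge0 P A : (0 <= riesz_dens P A)%E.
Proof.
rewrite /riesz_dens; apply: mule_ge0; first exact: dinf_ge0.
have : (0 <= muinf (ball_inf P (dinf P A)))%E.
  by rewrite /muinf /leb2; exact: measure_ge0.
case: (muinf _) => [u||]//; rewrite inver lee_fin => u0.
by case: ifP => // _; rewrite lee_fin invr_ge0.
Qed.

Lemma riesz_restr_ge0 P r A : (0 <= riesz_restr P r A)%E.
Proof. by rewrite /riesz_restr /leb2; apply: integral_ge0 => z _; exact: riesz_dens_ge0. Qed.

(** The numerator is at least wid n / 32, and [ball_measure] bounds the denominator. A ball of
    measure zero gives density +oo. *)
Lemma riesz_lower n P (z : pt R) :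
  wid n / 32 <= dist P (pihat z) < wid n / 8 ->
  (((ball_const * 32)^-1 / hgt n)%:E <= riesz_dens P (pihat z))%E.
Proof.
move=> /andP[d1 d2]; have w0 := wp n; have h0 := hp n.
rewrite /riesz_dens dinfE//; set d := dist _ _ in d1 d2 *.
have d0 : 0 < d by apply: lt_le_trans d1; rewrite divr_gt0.
have [p pE] := pihat_surj P; have bc0 := ball_const_gt0.
have : (muinf (ball_inf P d%:E) <= (ball_const * (wid n * hgt n))%:E)%E.
  by rewrite pE; apply: ball_measure; exact: ltW.
have : (0 <= muinf (ball_inf P d%:E))%E.
  by rewrite /muinf /leb2; exact: measure_ge0.
case: (muinf _) => [u||]//; rewrite lee_fin => u0 uc.
rewrite inver; case: eqP => [_|/eqP un0]; first by rewrite gt0_muley ?lte_fin// leey.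
have {un0} u0 : 0 < u by rewrite lt_neqAle eq_sym un0.
rewrite -EFinM lee_fin ler_pdivlMr//.
apply: le_trans (_ : (ball_const * 32)^-1 / hgt n * (ball_const * (wid n * hgt n)) <= _).
  apply: ler_wpM2l; last by move: uc; rewrite lee_fin.
  by apply/ltW; rewrite divr_gt0// invr_gt0 mulr_gt0.
have -> : (ball_const * 32)^-1 / hgt n * (ball_const * (wid n * hgt n)) = wid n / 32.
  by field; rewrite !lt0r_neq0.
by [].
Qed.

(** Stages have K segments each; by the truncated predecessor, stages 0 and 1 both have scale n. *)
Definition walk_scale n (K k : nat) : int := n + (k %/ K).-1%:Z.

(** From stage 1 on, the terms grow at least 300-fold per stage, so the last stage dominates; the
    factor 3 leaves room for the two stages of scale n. *)
Lemma sum_hgt_inv n (K s : nat) : (0 < K)%N ->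
  \sum_(j < s.+1 * K) (hgt (walk_scale n K j))^-1 <=
    3 * K%:R * (hgt (n + s.-1%:Z))^-1.
Proof.
move=> K0.
have block (t : nat) : \sum_(t * K <= j < t.+1 * K) (hgt (walk_scale n K j))^-1 =
    K%:R * (hgt (n + t.-1%:Z))^-1.
  rewrite mulSn -[X in index_iota X _]add0n big_addn addnK.
  rewrite big_nat (eq_bigr (fun _ => (hgt (n + t.-1%:Z))^-1)); last first.
    move=> j /andP[_ jK]; rewrite /walk_scale divnDr ?dvdn_mull// divn_small// add0n.
    by rewrite mulnK.
  by rewrite -big_nat big_const_nat subn0 iter_addr_0 mulr_natl.
have step (t : nat) : (hgt (n + t%:Z))^-1 <= 300^-1 * (hgt (n + t.+1%:Z))^-1.
  have E : hgt (n + t%:Z) = mv R L * hgt (n + t.+1%:Z).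
    by rewrite hgtS//; congr (_ * hgt _); lia.
  have E2 : (hgt (n + t.+1%:Z))^-1 = mv R L * (hgt (n + t%:Z))^-1.
    by rewrite E invfM mulrA divff ?mul1r// lt0r_neq0// mv_gt0.
  have u0 : 0 < (hgt (n + t%:Z))^-1 by rewrite invr_gt0.
  rewrite E2; have M300 := @mv_ge300 R L L100; set u := (hgt _)^-1 in u0 *.
  by have := ler_wpM2r (ltW u0) M300; lra.
have K0r : 0 < K%:R :> R by rewrite ltr0n.
have G0 t : 0 < K%:R * (hgt (n + t%:Z))^-1 by rewrite mulr_gt0// invr_gt0.
rewrite -(big_mkord xpredT (fun j => (hgt (walk_scale n K j))^-1)).
suff H : \sum_(0 <= j < s.+1 * K) (hgt (walk_scale n K j))^-1 <=
    (if s is 0 then 1 else 3) * (K%:R * (hgt (n + s.-1%:Z))^-1).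
  apply: le_trans H _; rewrite -mulrA; case: s => [|s] //.
  by have := G0 0%N; rewrite /=; lra.
elim: s => [|s IH].
  by have := block 0%N; rewrite mul0n => ->; rewrite mul1r.
rewrite (@big_cat_nat _ _ _ (s.+1 * K)) ?leq_mul//= block/=.
apply: le_trans (lerD IH (lexx _)) _.
case: s {IH} => [|s] /=; first by have := G0 0%N; lra.
have := ler_wpM2l (ltW K0r) (step s); have := G0 s.+1; lra.
Qed.

Lemma sum_hgt_inv_le n (K N : nat) (T : int) : (0 < K)%N ->
  \sum_(j < N | walk_scale n K j <= T) (hgt (walk_scale n K j))^-1 <=
    3 * K%:R * (hgt T)^-1.
Proof.
move=> K0; have K0r : 0 < K%:R :> R by rewrite ltr0n.
have [Tn|nT] := ltP T n.
  rewrite big_pred0 ?mulr_ge0// ?invr_ge0 ?ltW//.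
  by move=> j; apply/negbTE; rewrite -ltNge /walk_scale; lia.
have [s Ts] : exists s : nat, T = n + s%:Z by exists (absz (T - n)%R); lia.
have := sum_hgt_inv n s.+1 K0; rewrite /= -Ts; apply: le_trans.
rewrite -(big_mkord (fun j => walk_scale n K j <= T) (fun j => (hgt (walk_scale n K j))^-1)).
rewrite -(big_mkord xpredT (fun j => (hgt (walk_scale n K j))^-1)).
have inv0 j : 0 <= (hgt (walk_scale n K j))^-1 by rewrite invr_ge0 ltW.
have lim j : walk_scale n K j <= T -> (j < s.+2 * K)%N.
  by rewrite /walk_scale Ts lerD2l => H; rewrite -ltn_divLR//; lia.
have [NS|SN] := leqP N (s.+2 * K).
  rewrite [leRHS](@big_cat_nat _ _ _ N)//=.
  rewrite -[leLHS]addr0; apply: lerD; last exact: sumr_ge0.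
  by rewrite [leLHS]big_mkcond/=; apply: ler_sum => j _; case: ifP.
rewrite (@big_cat_nat _ _ _ (s.+2 * K))//=; last exact: ltnW.
rewrite [X in _ + X]big_nat_cond [X in _ + X]big_pred0; last first.
  move=> j; apply/negbTE/negP => /andP[/andP[j1 _] /lim]; lia.
by rewrite addr0 [leLHS]big_mkcond/=; apply: ler_sum => j _; case: ifP.
Qed.

(* [wid (- a) = 4 ^ a] bounds, in units of the scale of a segment, its distance
   to the end point of the curve; at most [2 * K] segments have the same scale. *)
Definition riesz_const (K a : nat) : R := 3 * K%:R * (ball_const * 32) * mv R L ^+ (a + 3).

(** A pointwise comparison of densities: a box containing z reaches at least as far as d(P, z),
    which bounds its scale from above; the sum of the inverse heights up to that scale is dominated
    by its last term, which [riesz_lower] compares with the Riesz density. *)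
Lemma riesz_sum n (K a N : nat) P (rho : R) (S : nat -> set (RM * RM)) (A : set (Xinf R L)) :
  (0 < K)%N -> Xmeasurable A -> (forall k, measurable (S k)) ->
  (forall k z, S k z -> dist P (pihat z) <= wid (- a%:Z) * wid (walk_scale n K k)) ->
  wid (- a%:Z) * wid n < rho ->
  (\sum_(k < N) ((hgt (walk_scale n K k))^-1)%:E * leb2 (pihat @^-1` A `&` S k)
     <= (riesz_const K a)%:E * riesz_restr P rho%:E A)%E.
Proof.
move=> K0 mA mS SP rhoP.
have mv0 := @mv_gt0 R L L100.
have [p pE] := pihat_surj P.
have C0 : 0 < riesz_const K a.
  by rewrite /riesz_const !mulr_gt0// ?ltr0n// ?exprn_gt0// ball_const_gt0.
pose A' : set (RM * RM) := pihat @^-1` A.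
have mA' : measurable A' by exact: mA.
(* The vertical line through a representative of P is null; off it d(P, z) is positive, so z has a
   scale. *)
pose l : set (RM * RM) := [set p.1] `*` setT.
have ml : measurable l by apply: measurableX => //; exact: measurable_set1.
have l0 : leb2 l = 0.
  by rewrite /leb2 product_measure1E//= ?lebesgue_measure_set1 ?mul0e//; exact: measurable_set1.
pose E k := A' `&` S k `\` l.
have mE k : measurable (E k) by apply: measurableD => //; exact: measurableI.
have E1 k : (leb2 (A' `&` S k) <= leb2 (E k))%E.
  have mAS : measurable (A' `&` S k) by exact: measurableI.
  rewrite -[leRHS]adde0 -l0; apply: (@le_trans _ _ (leb2 (E k `|` l))).
    by apply: leb2_le => z zAS; have [zl|zl] := pselect (l z); [right|left].
  by rewrite /leb2; apply: measureU2.
have dens0 z : (0 <= riesz_dens P (pihat z))%E by exact: riesz_dens_ge0.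
pose g z : \bar R := (\sum_(k < N) ((hgt (walk_scale n K k))^-1)%:E * (\1_(E k) z)%:E)%E.
have g0 z : (0 <= g z)%E.
  by apply: sume_ge0 => k _; rewrite mule_ge0// lee_fin// invr_ge0 ltW.
have gE : (\sum_(k < N) ((hgt (walk_scale n K k))^-1)%:E * leb2 (E k) =
    \int[@leb2 R]_(z in setT) g z)%E.
  rewrite /g /leb2 ge0_integral_sum//=.
  - apply: eq_bigr => k _; rewrite ge0_integralZl//=.
    + by rewrite integral_indic// setIT.
    + by apply/measurable_EFinP; exact: measurable_indic.
    + by rewrite lee_fin invr_ge0 ltW.
  - move=> k; apply: emeasurable_funM => //.
    by apply/measurable_EFinP; exact: measurable_indic.
  - by move=> k z _; rewrite mule_ge0// lee_fin// invr_ge0 ltW.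
apply: (@le_trans _ _ (\sum_(k < N) ((hgt (walk_scale n K k))^-1)%:E * leb2 (E k))%E).
  by apply: lee_sum => k _; apply: lee_wpmul2l (E1 k); rewrite lee_fin invr_ge0 ltW.
rewrite gE muleC -lee_pdivrMr//.
rewrite muleC /riesz_restr /leb2 -ge0_integralZl//=; last 2 first.
- apply: emeasurable_sum => k; apply: emeasurable_funM => //.
  by apply/measurable_EFinP; exact: measurable_indic.
- by rewrite lee_fin invr_ge0 ltW.
rewrite [leRHS]integral_mkcond; apply: le_integral_any => z _ /=.
  by rewrite mule_ge0// lee_fin invr_ge0 ltW.
have [Ez|nE] := pselect (exists k : 'I_N, E k z); last first.
  have -> : g z = 0%E.
    rewrite /g big1// => k _; rewrite indicE memNset ?mule0//.
    by move=> Ekz; apply: nE; exists k.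
  by rewrite mule0 patchE; case: ifP => // _; exact: dens0.
have [k0 [[A'z Skz] nlz]] := Ez.
have zin : (pihat @^-1` (A `&` ball_inf P rho%:E)) z.
  split => //=; rewrite /ball_inf/= dinfE// lte_fin.
  apply: le_lt_trans (SP _ _ Skz) _; apply: le_lt_trans rhoP.
  by rewrite ler_pM2l// le_wid// /walk_scale lerDl.
rewrite patchE ifT ?inE//.
have d0 : 0 < dist P (pihat z).
  rewrite pE; apply: lt_le_trans (dist_ge_fst L100 p z); rewrite normr_gt0 subr_eq0.
  by apply/negP => /eqP e; apply: nlz; split.
have [nd ndP] := scale_ex d0.
apply: (@le_trans _ _ (((ball_const * 32)^-1 / hgt nd)%:E)); last exact: riesz_lower.
(* From wid nd / 32 <= 4^a wid (scale), the scale of a box containing z is at most nd + a + 2. *)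
pose T : int := nd + (a + 3)%N%:Z.
have gT : (g z <= (\sum_(k < N | walk_scale n K k <= T) (hgt (walk_scale n K k))^-1)%:E)%E.
  rewrite /g -sumEFin [leRHS]big_mkcond/=; apply: lee_sum => k _.
  case: ifPn => [_|kT].
    rewrite indicE; case: (_ \in _); rewrite ?mule1 ?mule0//.
    by rewrite lee_fin invr_ge0 ltW.
  rewrite indicE memNset ?mule0// => -[[_ Sk] _].
  move/negP: kT; apply; rewrite leNgt; apply/negP => Tk.
  have := SP _ _ Sk; have /andP[+ _] := ndP => H1 H2.
  have : wid nd / 32 <= wid (- a%:Z) * wid (walk_scale n K k) :> R by exact: le_trans H2.
  rewrite -widD => H3.
  have : wid (- a%:Z + walk_scale n K k) <= wid (nd + 3) :> R.
    by apply: le_wid; rewrite /T in Tk; lia.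
  have -> : wid (nd + 3) = wid nd / 64 :> R.
    by rewrite widD (wid_nat 3) ; congr (_ * _); field.
  by have := wp nd; lra.
apply: (@le_trans _ _ ((riesz_const K a)^-1%:E * (3 * K%:R * (hgt T)^-1)%:E)%E).
  apply: lee_wpmul2l; first by rewrite lee_fin invr_ge0 ltW.
  by apply: le_trans gT _; rewrite lee_fin; exact: sum_hgt_inv_le.
have hT : hgt nd = mv R L ^+ (a + 3) * hgt T.
  by rewrite /T hgtD// hgt_nat mulrCA -exprMn divff ?expr1n ?mulr1// lt0r_neq0.
rewrite -EFinM lee_fin hT /riesz_const.
rewrite le_eqVlt; apply/orP; left; apply/eqP.
have bc0 := ball_const_gt0.
by field; rewrite !lt0r_neq0// ?ltr0n// exprn_gt0.
Qed.

End Balls.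

(** * Curves obtained from a walk *)

Definition rows {R : realType} (h : R) (c d : int) : set (measurableTypeR R) :=
  `[c%:~R * h, d%:~R * h[%classic.

(** * Laws of heights under piecewise translations *)

Section PiecewiseTranslation.
Context {R : realType}.
Local Notation leb := (@lebesgue_measure R).
Local Notation RM := (measurableTypeR R).
Variables (h : R) (f : RM -> RM).
Hypothesis h0 : 0 < h.
Hypothesis ft : forall y y', row h y = row h y' -> f y - y = f y' - y'.

Lemma rowset_itv (r : int) : [set y : RM | row h y = r] =
  `[r%:~R * h, (r + 1)%:~R * h[%classic.
Proof.
apply/seteqP; split => y /=; rewrite in_itv/=; last exact: row_def.
by move=> <-; exact: row_itv.
Qed.

Lemma measurable_rowset (r : int) : measurable [set y : RM | row h y = r].
Proof. by rewrite rowset_itv; exact: measurable_itv. Qed.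

Lemma preimage_row (r : int) (B : set RM) :
  f @^-1` B `&` [set y | row h y = r] =
  affine true (f (r%:~R * h) - r%:~R * h) @^-1` B `&` [set y | row h y = r].
Proof.
have rr : row h (r%:~R * h) = r.
  by apply: row_def => //; rewrite lexx/= ltr_pM2r// ltr_int ltzD1.
have E y : row h y = r -> f y = affine true (f (r%:~R * h) - r%:~R * h) y.
  by move=> yr; rewrite /affine -(@ft y) ?rr// subrK.
by apply/seteqP; split => y [] /[swap] /[dup] /= /E fE yr; rewrite /preimage/= fE.
Qed.

Lemma measurable_piecewise : measurable_fun setT f.
Proof.
move=> _ B mB; rewrite setTI.
have -> : f @^-1` B = \bigcup_(r in [set: int]) (f @^-1` B `&` [set y | row h y = r]).
  apply/seteqP; split => y /=; first by move=> By; exists (row h y).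
  by move=> [r _ []].
apply: countable_bigcupT_measurable => // r; rewrite preimage_row.
apply: measurableI; last exact: measurable_rowset.
rewrite -[X in measurable X]setTI; exact: measurable_affine.
Qed.

(** Each of the N rows is translated rigidly, so it contributes at most the measure of B. *)
Lemma law_piecewise (c : int) (N : nat) (B : set RM) : measurable B ->
  (leb (f @^-1` B `&` rows h c (c + N%:Z)) <= N%:R%:E * leb B)%E.
Proof.
move=> mB; have mf : measurable (f @^-1` B).
  by rewrite -[X in measurable X]setTI; exact: measurable_piecewise.
elim: N => [|N IH].
  by rewrite addr0 /rows set_itvco0 setI0 measure0 mul0e.
have E : f @^-1` B `&` rows h c (c + N.+1%:Z) `<=`
    (f @^-1` B `&` rows h c (c + N%:Z)) `|`
    (f @^-1` B `&` [set y | row h y = c + N%:Z]).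
  move=> y [By]; rewrite /rows/= in_itv/= => /andP[y1 y2].
  have [lt|ge] := ltP y ((c + N%:Z)%:~R * h); first by left; split => //=; rewrite /rows/= in_itv/= y1.
  right; split => //=; apply: row_def => //; rewrite ge/=.
  by have <- : c + N.+1%:Z = c + N%:Z + 1 by lia.
apply: le_trans (le_leb E) _.
apply: le_trans (measureU2 leb _ _) _.
- by apply: measurableI => //; exact: measurable_itv.
- by apply: measurableI => //; exact: measurable_rowset.
rewrite -natr1 EFinD ge0_muleDl ?lee_fin// mul1e; apply: leeD IH _.
rewrite preimage_row -[leRHS](pushforward_affine true (f ((c + N%:Z)%:~R * h) - (c + N%:Z)%:~R * h) mB).
by apply: le_leb => y [].
Qed.

End PiecewiseTranslation.

Section RowMeasure.
Context {R : realType}.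
Local Notation leb := (@lebesgue_measure R).
Local Notation RM := (measurableTypeR R).

Lemma row_probability (h : R) (b : int) : 0 < h ->
  exists nu : probability RM R, forall B : set RM, measurable B ->
    nu B = (h^-1%:E * leb (B `&` rows h b (b + 1)))%E.
Proof.
move=> h0; pose I : set RM := rows h b (b + 1).
have mI : measurable I by exact: measurable_itv.
have Ih : leb I = h%:E.
  rewrite /I /rows lebesgue_measure_itv/= lte_fin ltr_pM2r// ltr_int ltzD1 lexx.
  by rewrite -EFinB; congr (_%:E); rewrite intrD; ring.
pose nu0 := mrestr leb mI.
exists (mnormalize nu0 (dirac (0 : RM))) => B mB.
have nuT : nu0 setT = h%:E by rewrite /nu0 /mrestr setTI Ih.
change (((if (nu0 setT == 0) || (nu0 setT == +oo) then fun U => dirac (0%R : RM) U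
  else fun U => nu0 U * (fine (nu0 setT))^-1%:E) B = h^-1%:E * nu0 B)%E).
rewrite nuT.
by rewrite eqe gt_eqF//= muleC.
Qed.

(** Parameters outside the row are sent to its bottom, so that every parameter, and not only almost
    every one, gives a Lipschitz curve. *)
Definition clamp_row (h : R) (b : int) (w : RM) : RM :=
  if (b%:~R * h <= w) && (w < (b + 1)%:~R * h) then w else b%:~R * h.

Lemma row_clamp (h : R) (b : int) w : 0 < h -> row h (clamp_row h b w) = b.
Proof.
move=> h0; rewrite /clamp_row; case: ifP => H; apply: row_def => //.
by rewrite lexx/= ltr_pM2r// ltr_int ltzD1.
Qed.

Lemma measurable_clamp_row (h : R) (b : int) : measurable_fun setT (clamp_row h b).
Proof.
rewrite /clamp_row; apply: measurable_fun_ifT => //.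
apply: measurable_and; first exact: measurable_fun_ler.
exact: measurable_fun_ltr.
Qed.

End RowMeasure.

(* The curve moves at unit speed along the polygonal path [X] in the horizontal
   direction; at [X k.+1] its height jumps from [y] to the glued height [J k y].
   The box [S k] contains all the [k]-th segments that start in the row [b]. *)
Record walk (R : realType) (L : nat) (P : Xinf R L) (n b : int) (K a : nat) (x0 : R) := Walk {
  wX : nat -> R;
  wJ : nat -> R -> R;
  wS : nat -> set (measurableTypeR R * measurableTypeR R);
  wH : nat -> R -> R := fun k w => iteri k wJ w;
  w_start : wX 0 = x0;
  w_glue : forall k y, Rinf L (wX k.+1, y) (wX k.+1, wJ k y);
  w_trans : forall k y y', row (hgt L (walk_scale n K k)) y = row (hgt L (walk_scale n K k)) y' ->
    wJ k y - y = wJ k y' - y';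
  w_mult : forall k y, exists z : int, wJ k y = y + z%:~R * hgt L (walk_scale n K k);
  w_step : forall k, `|wX k.+1 - wX k| <= wid (- a%:Z) * wid (walk_scale n K k);
  w_move : wX 1 != wX 2;
  w_meas : forall k, measurable (wS k);
  w_loc : forall k w x, row (hgt L n) w = b ->
    Num.min (wX k) (wX k.+1) <= x <= Num.max (wX k) (wX k.+1) -> wS k (x, wH k w);
  w_near : forall k z, wS k z -> dist P (pihat L z) <= wid (- a%:Z) * wid (walk_scale n K k)
}.

Section Rows.
Context {R : realType} {L : nat}.
Hypothesis L100 : (100 <= L)%N.
Local Notation hgt := (@hgt R L).

Lemma row_coarse m n (y y' : R) : m <= n ->
  row (hgt n) y = row (hgt n) y' -> row (hgt m) y = row (hgt m) y'.
Proof.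
move=> mn E; have hn := @hgt_gt0 R L L100 n; have hm := @hgt_gt0 R L L100 m.
have [N N0 mE] := hgt_int L100 (R := R) mn.
have /andP[a b] := row_itv y hn; have /andP[a' b'] := row_itv y' hn.
have /andP[c d] := row_itv y hm; rewrite -E in a' b'.
move: a b a' b' c d; move: (row (hgt n) y) (row (hgt m) y) => r s a b a' b' c d.
have e1 : s%:~R * hgt m = (s * N%:Z)%:~R * hgt n by rewrite mE intrM; ring.
have e2 : (s + 1)%:~R * hgt m = ((s + 1) * N%:Z)%:~R * hgt n by rewrite mE intrM; ring.
symmetry; apply: row_def => //; rewrite e1 e2.
have h1 : s * N%:Z < r + 1 by rewrite -(ltr_int R) -(ltr_pM2r hn) -e1; lra.
have h2 : r < (s + 1) * N%:Z by rewrite -(ltr_int R) -(ltr_pM2r hn) -e2; lra.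
apply/andP; split.
  by apply: le_trans a'; rewrite ler_pM2r// ler_int -ltzD1.
by apply: lt_le_trans b' _; rewrite ler_pM2r// ler_int -ltzD1 ltrD2r.
Qed.

End Rows.

(** * The curve of a walk: duration, Lipschitz bound and law *)

Section Curve.
Context {R : realType} {L : nat}.
Hypothesis L100 : (100 <= L)%N.
Local Notation hgt := (@hgt R L).
Local Notation pihat := (@pihat R L).
Local Notation leb := (@lebesgue_measure R).
Local Notation RM := (measurableTypeR R).
Let hp := @hgt_gt0 R L L100.
Let wp := @wid_gt0 R.
Variables (P : Xinf R L) (n b : int) (K a : nat) (x0 : R) (W : walk P n b K a x0).
Hypothesis K0 : (0 < K)%N.
Local Notation X := (wX W).
Local Notation J := (wJ W).
Local Notation S := (wS W).
Local Notation H := (wH W).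
Local Notation m := (walk_scale n K).

Lemma le_walk_scale j k : (j <= k)%N -> m j <= m k.
Proof.
by move=> jk; rewrite /walk_scale lerD2l lez_nat; have := leq_div2r K jk; lia.
Qed.

Lemma walk_scale_ge k : n <= m k.
Proof. by rewrite /walk_scale lerDl. Qed.

(** Jumps of scale at most M translate rows of scale M rigidly, by multiples of [hgt M], hence onto
    rows of scale M. The second conclusion is what lets the induction compose jumps. *)
Lemma H_trans M k w w' : (forall j, (j < k)%N -> m j <= M) ->
  row (hgt M) w = row (hgt M) w' ->
  H k w - w = H k w' - w' /\ exists z : int, H k w = w + z%:~R * hgt M.
Proof.
elim: k => [|k IH] jM ww'.
  by rewrite /wH/= !subrr; split => //; exists 0; rewrite mul0r addr0.
have [|E [z zE]] := IH _ ww'; first by move=> j jk; apply: jM; apply: leqW.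
have kM : m k <= M by apply: jM.
have zE' : H k w' = w' + z%:~R * hgt M by have := E; rewrite zE; lra.
have rr : row (hgt M) (H k w) = row (hgt M) (H k w') by rewrite zE zE' !rowDz// ww'.
have := w_trans W (row_coarse L100 kM rr); rewrite /wH/= -/(wH W k w) -/(wH W k w') => EJ.
have [t tE] := w_mult W k (H k w); have [N _ NE] := hgt_int L100 (R := R) kM.
split; first by lra.
by exists (z + t * N%:Z); rewrite tE zE NE intrD intrM; ring.
Qed.

Lemma H_piecewise k w w' : row (hgt (m k)) w = row (hgt (m k)) w' ->
  H k w - w = H k w' - w'.
Proof. by move=> ww'; case: (@H_trans (m k) k w w') => // j /ltnW; exact: le_walk_scale. Qed.

Lemma measurable_H k : measurable_fun setT (H k : RM -> RM).
Proof. apply: (measurable_piecewise (hp (m k))); exact: H_piecewise. Qed.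

(** The row b is a union of N rows of scale [m k], with hgt n = N hgt (m k); each is translated, so
    the density is at most N / hgt n. *)
Lemma H_law (nu : probability RM R) k (B : set RM) :
  (forall B : set RM, measurable B ->
    nu B = ((hgt n)^-1%:E * leb (B `&` rows (hgt n) b (b + 1)))%E) ->
  measurable B ->
  (nu ((H k \o clamp_row (hgt n) b) @^-1` B) <= (hgt (m k))^-1%:E * leb B)%E.
Proof.
move=> nuE mB; have hn := hp n; have hk := hp (m k).
have mC : measurable_fun setT (H k \o clamp_row (hgt n) b).
  by apply: measurableT_comp; [exact: measurable_H|exact: measurable_clamp_row].
have mD : measurable ((H k \o clamp_row (hgt n) b) @^-1` B).
  by rewrite -[X in measurable X]setTI; exact: mC.
rewrite nuE//.
have [N N0 NE] := hgt_int L100 (R := R) (walk_scale_ge k).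
have E1 : b%:~R * hgt n = (b * N%:Z)%:~R * hgt (m k) by rewrite NE intrM; ring.
have E2 : (b + 1)%:~R * hgt n = (b * N%:Z + N%:Z)%:~R * hgt (m k).
  by rewrite NE !intrD intrM; ring.
have E : (H k \o clamp_row (hgt n) b) @^-1` B `&` rows (hgt n) b (b + 1) `<=`
    H k @^-1` B `&` rows (hgt (m k)) (b * N%:Z) (b * N%:Z + N%:Z).
  move=> w [/=]; rewrite /rows/= !in_itv/= -E1 -E2 /clamp_row => + wI.
  by rewrite wI.
apply: (@le_trans _ _ ((hgt n)^-1%:E * (N%:R%:E * leb B))%E).
  apply: lee_wpmul2l; first by rewrite lee_fin invr_ge0 ltW.
  apply: le_trans (le_leb E) _.
  exact: (law_piecewise hk (@H_piecewise k)).
rewrite muleA -EFinM; apply: lee_wpmul2r => //.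
rewrite lee_fin NE invfM -mulrA mulVf ?mulr1//.
by rewrite pnatr_eq0 -lt0n.
Qed.

Definition time k : R := \sum_(j < k) `|X j.+1 - X j|.

Lemma timeS k : time k.+1 = time k + `|X k.+1 - X k|.
Proof. by rewrite /time big_ord_recr. Qed.

Lemma le_time j k : (j <= k)%N -> time j <= time k.
Proof.
elim: k => [|k IH]; first by rewrite leqn0 => /eqP ->.
rewrite leq_eqVlt => /predU1P[->//|]; rewrite ltnS => /IH h.
by apply: le_trans h _; rewrite timeS lerDl.
Qed.

Lemma time_ge0 k : 0 <= time k.
Proof. by have := le_time (leq0n k); rewrite {1}/time big_ord0. Qed.

Lemma time_le k : time k <= 3 * K%:R * wid (- a%:Z) * wid n.
Proof.
have wa := wp (- a%:Z); have wn := wp n.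
have K0r : 0 < K%:R :> R by rewrite ltr0n.
apply: le_trans (_ : \sum_(j < k) wid (- a%:Z) * wid (m j) <= _).
  by apply: ler_sum => j _; exact: w_step.
rewrite -mulr_sumr.
suff : \sum_(j < k) wid (m j) <= 3 * K%:R * wid n :> R.
  by move/(ler_wpM2l (ltW wa)); lra.
have block (t : nat) : \sum_(t * K <= j < t.+1 * K) wid (m j) =
    K%:R * wid (n + t.-1%:Z) :> R.
  rewrite mulSn -[X in index_iota X _]add0n big_addn addnK.
  rewrite big_nat (eq_bigr (fun _ => wid (n + t.-1%:Z))); last first.
    move=> j /andP[_ jK]; rewrite /walk_scale divnDr ?dvdn_mull// divn_small// add0n.
    by rewrite mulnK.
  by rewrite -big_nat big_const_nat subn0 iter_addr_0 mulr_natl.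
(* Stages 0 and 1 cost K [wid n] each and later stages decrease by 4; subtracting the last width
   makes the induction close. *)
have H2 (t : nat) : \sum_(0 <= j < t.+2 * K) wid (m j) <=
    K%:R * (3 * wid n - wid (n + t%:Z)) :> R.
  elim: t => [|t IH].
    rewrite (@big_cat_nat _ _ _ (1 * K)) ?leq_mul//= -{1}(mul0n K) !block/= addr0.
    by have := mulr_gt0 K0r wn; lra.
  rewrite (@big_cat_nat _ _ _ (t.+2 * K)) ?leq_mul//= block/=.
  apply: le_trans (lerD IH (lexx _)) _.
  have -> : wid (n + t%:Z) = 4 * wid (n + t.+1%:Z) :> R.
    by rewrite [LHS]widS; congr (_ * wid _); lia.
  by have := mulr_gt0 K0r (wp (n + t.+1%:Z)); lra.
apply: le_trans (_ : \sum_(0 <= j < k.+2 * K) wid (m j) <= _).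
  rewrite (@big_cat_nat _ _ _ k)//=; last first.
    by rewrite (leq_trans _ (leq_pmulr _ K0))//; lia.
  rewrite big_mkord lerDl; apply: sumr_ge0 => j _; exact: ltW.
apply: le_trans (H2 k) _.
by have := mulr_gt0 K0r (wp (n + k%:Z)); lra.
Qed.

Definition total : R := sup (range time).

Lemma has_sup_time : has_sup (range time).
Proof.
split; first by exists (time 0), 0%N.
by exists (3 * K%:R * wid (- a%:Z) * wid n) => _ [k _ <-]; exact: time_le.
Qed.

Lemma time_le_total k : time k <= total.
Proof. by apply: ub_le_sup; [exact: has_sup_time.2|exists k]. Qed.

Lemma total_le : total <= 3 * K%:R * wid (- a%:Z) * wid n.
Proof. by apply: ge_sup; [exact: has_sup_time.1|move=> _ [k _ <-]; exact: time_le]. Qed.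

Lemma total_gt0 : 0 < total.
Proof.
apply: lt_le_trans (time_le_total 2); rewrite timeS.
apply: ltr_wpDl; first exact: time_ge0.
by rewrite normr_gt0 subr_eq0 eq_sym w_move.
Qed.

Lemma time_ex t : 0 <= t < total -> exists k, time k <= t < time k.+1.
Proof.
move=> /andP[t0 tT].
have [_ [k _ <-] tk] := sup_gt has_sup_time.1 tT.
have ex : exists k, t < time k by exists k.
case: (ex_minnP ex) => -[|j] j1 j2.
  by move: j1; rewrite /time big_ord0 ltNge t0.
exists j; rewrite j1 andbT leNgt; apply/negP => /j2.
by rewrite ltnn.
Qed.

Lemma time_uniq t j k : time j <= t < time j.+1 -> time k <= t < time k.+1 -> j = k.
Proof.
move=> /andP[a1 a2] /andP[b1 b2]; apply/eqP; rewrite eqn_leq; apply/andP; split.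
  by rewrite leqNgt; apply/negP => /le_time h; have := le_lt_trans (le_trans h a1) b2; rewrite ltxx.
by rewrite leqNgt; apply/negP => /le_time h; have := le_lt_trans (le_trans h b1) a2; rewrite ltxx.
Qed.

Definition direction k : bool := X k <= X k.+1.

Definition offset k : R := if direction k then X k - time k else X k + time k.

Definition position k t : R := affine (direction k) (offset k) t.

Lemma position_between k t : time k <= t < time k.+1 ->
  Num.min (X k) (X k.+1) <= position k t <= Num.max (X k) (X k.+1).
Proof.
rewrite timeS /position /affine /offset /direction ge_min le_max.
have [le|lt] := leP (X k) (X k.+1).
  rewrite ger0_norm ?subr_ge0// => /andP[? ?].
  by apply/andP; split; apply/orP; [left|right]; lra.
rewrite ltr0_norm ?subr_lt0// => /andP[? ?].
by apply/andP; split; apply/orP; [right|left]; lra.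
Qed.

Lemma position_dist k t t' : `|position k t - position k t'| = `|t - t'|.
Proof.
rewrite /position /affine; case: (direction k).
  by congr `|_|; lra.
by rewrite distrC; congr `|_|; lra.
Qed.

Lemma position_time k : position k (time k) = X k.
Proof. by rewrite /position /affine /offset; case: (direction k); lra. Qed.

Lemma position_timeS k : position k (time k.+1) = X k.+1.
Proof.
rewrite /position /affine /offset /direction timeS.
have [le|lt] := leP (X k) (X k.+1).
  by rewrite ger0_norm ?subr_ge0//; lra.
by rewrite ltr0_norm ?subr_lt0//; lra.
Qed.

(** Segments of length zero have an empty time interval, so k is unique when it exists. From [total]
    on the value is P, the limit of the nodes. *)
Definition curve (t w : R) : Xinf R L :=
  if total <= t then P else
  let k := xget 0%N [set k | time k <= t < time k.+1] in
  pihat (position k t, H k w).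

Lemma curve_seg k t w : time k <= t < time k.+1 -> curve t w = pihat (position k t, H k w).
Proof.
move=> tk; rewrite /curve ifF; last first.
  apply/negbTE; rewrite -ltNge; have /andP[_ h] := tk.
  exact: lt_le_trans h (time_le_total _).
case: xgetP => [j _ /= tj|/(_ k)//].
by rewrite (time_uniq tj tk).
Qed.

Lemma curve_end t w : total <= t -> curve t w = P.
Proof. by rewrite /curve => ->. Qed.

Definition node k w := pihat (X k, H k w).

Lemma node_step k w : pihat (X k.+1, H k w) = node k.+1 w.
Proof. by apply: pihat_eq; rewrite /node /wH/=; exact: w_glue. Qed.

Lemma dist_node j k w : (j <= k)%N -> dist (node j w) (node k w) <= time k - time j.
Proof.
elim: k => [|k IH]; first by rewrite leqn0 => /eqP ->; rewrite distxx// subrr.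
rewrite leq_eqVlt => /predU1P[->|]; first by rewrite distxx// subrr.
rewrite ltnS => /IH h; apply: le_trans (dist_triangle L100 (node k w) _ _) _.
rewrite timeS; have := dist_horizontal L100 (X k) (X k.+1) (H k w).
rewrite node_step -/(node k w) distrC; lra.
Qed.

Lemma dist_node_curve k t w : time k <= t < time k.+1 ->
  dist (node k w) (curve t w) <= t - time k /\
  dist (curve t w) (node k.+1 w) <= time k.+1 - t.
Proof.
move=> tk; rewrite (curve_seg _ tk) -node_step; have /andP[t1 t2] := tk; split.
  apply: le_trans (dist_horizontal L100 _ _ _) _.
  by rewrite -[X k]position_time position_dist distrC ger0_norm ?subr_ge0.
apply: le_trans (dist_horizontal L100 _ _ _) _.
rewrite -position_timeS position_dist distrC ger0_norm ?subr_ge0//; exact: ltW.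
Qed.

Lemma dist_curve_node k t j w : time k <= t < time k.+1 -> (k < j)%N ->
  dist (curve t w) (node j w) <= time j - t.
Proof.
move=> tk kj; have [_ h] := dist_node_curve w tk.
apply: le_trans (dist_triangle L100 (node k.+1 w) _ _) _.
have := dist_node w kj; lra.
Qed.

Lemma node_near w (e : R) : row (hgt n) w = b -> 0 < e ->
  exists k, forall j, (k <= j)%N -> dist P (node j w) < e.
Proof.
move=> wb e0; have C0 : 0 < wid (- a%:Z) * wid n :> R by rewrite mulr_gt0.
have [s sP] : exists s : nat, wid s%:Z < e / (wid (- a%:Z) * wid n).
  by apply: wid_small; rewrite divr_gt0.
exists (s.+1 * K)%N => j kj.
have Sj : S j (X j, H j w) by apply: w_loc => //; rewrite ge_min lexx/= le_max lexx.
apply: le_lt_trans (w_near Sj) _.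
rewrite ltr_pdivlMr// in sP; apply: le_lt_trans sP.
have -> : wid s%:Z * (wid (- a%:Z) * wid n) = wid (- a%:Z) * wid (n + s%:Z) :> R.
  by rewrite widD; ring.
rewrite ler_pM2l//; apply: le_wid; rewrite /walk_scale lerD2l lez_nat.
have : (s.+1 <= j %/ K)%N by rewrite leq_divRL.
by lia.
Qed.

Lemma dist_curve_end t w : row (hgt n) w = b -> 0 <= t <= total ->
  dist (curve t w) P <= total - t.
Proof.
move=> wb /andP[t0]; rewrite le_eqVlt => /predU1P[->|tT].
  by rewrite curve_end// distxx// subrr.
have [|k tk] := @time_ex t; first by rewrite t0.
apply/ler_addgt0Pr => e e0.
have [j jP] := node_near wb e0.
have h1 := dist_curve_node w tk (leq_maxr j k.+1).
have h2 := jP _ (leq_maxl j k.+1); have h3 := time_le_total (maxn j k.+1).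
apply: le_trans (dist_triangle L100 (node (maxn j k.+1) w) _ _) _.
by rewrite [X in _ + X](distC L100); lra.
Qed.

Lemma curve_lip s t w : row (hgt n) w = b -> 0 <= s <= t -> t <= total ->
  dist (curve s w) (curve t w) <= t - s.
Proof.
move=> wb /andP[s0 st]; rewrite le_eqVlt => /predU1P[tE|tT].
  rewrite tE [curve total w]curve_end//; apply: dist_curve_end => //.
  by rewrite s0/= -tE.
have [|k tk] := @time_ex t; first by rewrite tT (le_trans s0).
have [|j sj] := @time_ex s; first by rewrite s0 (le_lt_trans st).
have [jk|kj] := ltnP j k.
  have h1 := dist_curve_node w sj jk; have [h2 _] := dist_node_curve w tk.
  by apply: le_trans (dist_triangle L100 (node k w) _ _) _; lra.
have jk : j = k.
  apply/eqP; rewrite eqn_leq kj andbT leqNgt; apply/negP => lt.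
  have := le_time lt; have /andP[h1 _] := sj; have /andP[_ h2] := tk; lra.
rewrite (curve_seg _ tk) (curve_seg _ (_ : time k <= s < time k.+1)); last by rewrite -jk.
apply: le_trans (dist_horizontal L100 _ _ _) _.
by rewrite position_dist distrC ger0_norm// subr_ge0.
Qed.

Lemma dist_curve_start t w : row (hgt n) w = b -> 0 <= t <= total ->
  dist (pihat (x0, w)) (curve t w) <= t.
Proof.
move=> wb /andP[t0 tT].
have N0 : node 0 w = pihat (x0, w) by rewrite /node w_start.
have time0 : time 0 = 0 by rewrite /time big_ord0.
have seg k : time k <= t < time k.+1 -> dist (pihat (x0, w)) (curve t w) <= t.
  move=> tk; rewrite -N0; have [h _] := dist_node_curve w tk.
  have := dist_node w (leq0n k); rewrite time0.
  by have := dist_triangle L100 (node k w) (node 0 w) (curve t w); lra.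
move: tT; rewrite le_eqVlt => /predU1P[tT|tT]; last first.
  by have [|k tk] := @time_ex t; [rewrite t0|exact: seg tk].
rewrite curve_end ?tT//.
apply/ler_addgt0Pr => e e0; have [j jP] := node_near wb e0.
have h := jP _ (leqnn j); have := dist_node w (leq0n j); rewrite time0 N0.
have := dist_triangle L100 (node j w) (pihat (x0, w)) P.
by rewrite [dist (node j w) P](distC L100); have := time_le_total j; lra.
Qed.

Definition pos_time (s : bool) (t : R) : R := if s then t else - t.

(** With s = false the curve is run backwards, as needed for the half of the pencil that ends at its
    first point; reversing time flips the slope of the segment, hence [direction k == s]. *)
Definition piece (s : bool) (A : set (Xinf R L)) k : set (RM * RM) :=
  [set t | time k <= pos_time s t < time k.+1] `*` setT `&`
  [set z | (pihat @^-1` A) (affine (direction k == s) (offset k) z.1,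
     (H k \o clamp_row (hgt n) b) z.2)].

Lemma pieceE s A t w : 0 <= pos_time s t < total ->
  A (curve (pos_time s t) (clamp_row (hgt n) b w)) <-> exists k, piece s A k (t, w).
Proof.
move=> tI.
have affE k : affine (direction k == s) (offset k) t = position k (pos_time s t).
  rewrite /position /pos_time /affine; case: (direction k); case: (s) => //=.
  by rewrite opprK.
split=> [At|[k [[/= tk _]]]]; last by rewrite affE -(curve_seg _ tk).
have [k tk] := time_ex tI; exists k; split => //=.
by rewrite affE -(curve_seg _ tk).
Qed.

Lemma measurable_time_seg s k :
  measurable ([set t | time k <= pos_time s t < time k.+1] : set RM).
Proof.
have -> : [set t | time k <= pos_time s t < time k.+1] =
    affine s 0 @^-1` `[time k, time k.+1[%classic.
  by apply/seteqP; split => t /=; rewrite in_itv/= /affine /pos_time add0r.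
by rewrite -[X in measurable X]setTI; apply: measurable_affine => //; exact: measurable_itv.
Qed.

Lemma measurable_Hclamp k : measurable_fun setT (H k \o clamp_row (hgt n) b : RM -> RM).
Proof.
by apply: measurableT_comp; [exact: measurable_H|exact: measurable_clamp_row].
Qed.

Lemma measurable_piece s A k : Xmeasurable A -> measurable (piece s A k).
Proof.
move=> mA; apply: measurableI; first by apply: measurableX => //; exact: measurable_time_seg.
rewrite -[X in measurable X]setTI.
have : measurable_fun setT (fun z : RM * RM => (affine (direction k == s) (offset k) z.1,
    (H k \o clamp_row (hgt n) b) z.2)).
  apply: measurable_fun_pair => /=.
    by apply: measurableT_comp => //; exact: measurable_affine.
  by apply: (measurableT_comp (f := H k \o clamp_row (hgt n) b)) => //; exact: measurable_Hclamp.
by apply.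
Qed.

Lemma piece_measure (nu : probability RM R) s A k : Xmeasurable A ->
  (forall B : set RM, measurable B ->
    nu B = ((hgt n)^-1%:E * leb (B `&` rows (hgt n) b (b + 1)))%E) ->
  ((leb \x nu) (piece s A k) <= (hgt (m k))^-1%:E * leb2 (pihat @^-1` A `&` S k))%E.
Proof.
move=> mA nuE; apply: segment_measure.
- by rewrite invr_ge0 ltW.
- exact: measurable_Hclamp.
- by move=> B mB; exact: H_law.
- exact: mA.
- exact: w_meas.
- move=> t w /= tk _.
  have -> : affine (direction k == s) (offset k) t = position k (pos_time s t).
    rewrite /position /pos_time /affine; case: (direction k); case: (s) => //=.
    by rewrite opprK.
  by apply: w_loc; [exact: row_clamp|exact: position_between].
- exact: measurable_time_seg.
Qed.

Lemma pieces_measure (nu : probability RM R) s A (rho : R) : Xmeasurable A ->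
  (forall B : set RM, measurable B ->
    nu B = ((hgt n)^-1%:E * leb (B `&` rows (hgt n) b (b + 1)))%E) ->
  wid (- a%:Z) * wid n < rho ->
  ((leb \x nu) (\bigcup_k piece s A k) <=
     (@riesz_const R L K a)%:E * riesz_restr P rho%:E A)%E.
Proof.
move=> mA nuE rhoP.
have mU : measurable (\bigcup_k piece s A k).
  by apply: bigcupT_measurable => k; exact: measurable_piece.
apply: (@le_trans _ _ (\sum_(0 <= k <oo) (leb \x nu) (piece s A k))%E).
  by apply: measure_sigma_subadditive => //= k; exact: measurable_piece.
apply: lime_le; first by apply: is_cvg_nneseries => k _ _; exact: measure_ge0.
near=> N; rewrite big_mkord.
have := @riesz_sum R L L100 n K a N P rho S A K0 mA (w_meas W) (@w_near _ _ _ _ _ _ _ _ W) rhoP.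
apply: le_trans; apply: lee_sum => k _; exact: piece_measure.
Unshelve. all: by end_near.
Qed.

End Curve.

(** * Walks converging to a point *)

(** On a line of type i, row 3l + i - 1 may jump up and row 3l + i may jump down; the jump is taken
    only when it leads towards T. *)
Definition greedy (i : nat) (T r : int) : int :=
  if (r < T) && (((r - i%:Z + 1) %% 3)%Z == 0) then r + 1
  else if (T < r) && (((r - i%:Z) %% 3)%Z == 0) then r - 1 else r.

Lemma greedy_le i T r : `|greedy i T r - T| <= `|r - T|.
Proof.
rewrite /greedy; case: ifP => [/andP[lt _]|_]; first by lia.
by case: ifP => [/andP[lt _]|_]; lia.
Qed.

Lemma greedy_id i T : greedy i T T = T.
Proof. by rewrite /greedy ltxx. Qed.

Lemma greedy_sweep T r (q : int) : 0 <= q -> `|r - T| <= q + 1 ->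
  `|greedy 3 T (greedy 2 T (greedy 1 T r)) - T| <= q.
Proof.
move=> q0 rq; have [->|rT] := eqVneq r T; first by rewrite !greedy_id subrr normr0.
pose r3 := (r %% 3)%Z.
have r3_ge : 0 <= r3 by apply: modz_ge0.
have r3_lt : r3 < 3 by apply: ltz_pmod.
have rE : r = (r %/ 3)%Z * 3 + r3 := divz_eq r 3.
move: rE r3_ge r3_lt; move: (r %/ 3)%Z r3 => l t rE t0 t3.
have modE (z u : int) : 0 <= u < 3 -> ((z * 3 + u) %% 3)%Z = u.
  by move=> uI; rewrite modzMDl modz_small.
have up i : r < T -> ((r - i%:Z + 1) %% 3)%Z = 0 -> greedy i T r = r + 1.
  by move=> lt E; rewrite /greedy lt E eqxx.
have dn i : T < r -> ((r - i%:Z) %% 3)%Z = 0 -> greedy i T r = r - 1.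
  by move=> lt E; rewrite /greedy lt E eqxx [r < T]ltNge ltW.
have moved i : (greedy i T r == r) || (`|greedy i T r - T| <= q).
  rewrite /greedy; case: ifP => [/andP[lt _]|_]; first by apply/orP; right; lia.
  by case: ifP => [/andP[lt _]|_]; apply/orP; [right; lia|left].
have le3 i u : `|u - T| <= q -> `|greedy i T u - T| <= q.
  by move=> uq; apply: le_trans (greedy_le _ _ _) uq.
have /orP[/eqP e1|h1] := moved 1%N; last exact: le3 _ _ (le3 _ _ h1).
rewrite e1; have /orP[/eqP e2|h2] := moved 2%N; last exact: le3 _ _ h2.
rewrite e2; have /orP[/eqP e3|//] := moved 3%N.
exfalso; have [lt|lt] : r < T \/ T < r by lia.
  have [tE|[tE|tE]] : t = 0 \/ t = 1 \/ t = 2 by lia.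
  - have E : r - 1%:Z + 1 = l * 3 + 0 by lia.
    by have := up 1%N lt; rewrite E (modE l 0 isT) e1 => /(_ erefl); lia.
  - have E : r - 2%:Z + 1 = l * 3 + 0 by lia.
    by have := up 2%N lt; rewrite E (modE l 0 isT) e2 => /(_ erefl); lia.
  - have E : r - 3%:Z + 1 = l * 3 + 0 by lia.
    by have := up 3%N lt; rewrite E (modE l 0 isT) e3 => /(_ erefl); lia.
have [tE|[tE|tE]] : t = 0 \/ t = 1 \/ t = 2 by lia.
- have E : r - 3%:Z = (l - 1) * 3 + 0 by lia.
  by have := dn 3%N lt; rewrite E (modE (l - 1) 0 isT) e3 => /(_ erefl); lia.
- have E : r - 1%:Z = l * 3 + 0 by lia.
  by have := dn 1%N lt; rewrite E (modE l 0 isT) e1 => /(_ erefl); lia.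
- have E : r - 2%:Z = l * 3 + 0 by lia.
  by have := dn 2%N lt; rewrite E (modE l 0 isT) e2 => /(_ erefl); lia.
Qed.

Section GreedyGlue.
Context {R : realType} {L : nat}.
Hypothesis L100 : (100 <= L)%N.
Local Notation hgt := (@hgt R L).

Definition greedy_jump m (i : nat) (T : int) (y : R) : R :=
  y + (greedy i T (row (hgt m) y) - row (hgt m) y)%:~R * hgt m.

Lemma row_greedy_jump m i T y :
  row (hgt m) (greedy_jump m i T y) = greedy i T (row (hgt m) y).
Proof. by rewrite /greedy_jump rowDz ?hgt_gt0// addrC subrK. Qed.

Lemma greedy_jump_Rinf m (k : int) (i : nat) T y : (1 <= i <= 3)%N ->
  let x := wid m * (4 * k + i%:Z)%:~R in
  Rinf L (x, y) (x, greedy_jump m i T y).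
Proof.
move=> i13 x; have hm := @hgt_gt0 R L L100 m; rewrite /greedy_jump.
have G (l : int) z : row (hgt m) z = 3 * l + i%:Z - 1 -> Rinf L (x, z) (x, z + hgt m).
  move=> zl; have /andP[z1 z2] := row_itv z hm; rewrite zl in z1 z2.
  apply: (@glue_Rinf R L L100 m k l i); split => //=; rewrite z1/=.
  by rewrite subrK in z2; exact: ltW.
rewrite /greedy; case: ifP => [/andP[_ /eqP E]|_].
  rewrite [_ + 1 - _]addrAC subrr add0r mul1r; apply: (G ((row (hgt m) y - i%:Z + 1) %/ 3)%Z).
  have := divz_eq (row (hgt m) y - i%:Z + 1) 3; rewrite E addr0.
  by move: (row _ _) (_ %/ _)%Z => r q; lia.
case: ifP => [/andP[_ /eqP E]|_]; last by rewrite subrr mul0r addr0; exact: Rinf_refl.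
rewrite [_ - 1 - _]addrAC subrr add0r mulN1r.
apply: Rinf_sym; have := G ((row (hgt m) y - i%:Z) %/ 3)%Z (y - hgt m).
rewrite subrK; apply.
have -> : y - hgt m = y + (-1)%:~R * hgt m by rewrite mulN1r.
rewrite rowDz//; have := divz_eq (row (hgt m) y - i%:Z) 3; rewrite E addr0.
by move: (row _ _) (_ %/ _)%Z => r q; lia.
Qed.

End GreedyGlue.

Section ConcreteWalk.
Context {R : realType} {L : nat}.
Hypothesis L100 : (100 <= L)%N.
Local Notation hgt := (@hgt R L).
Local Notation pihat := (@pihat R L).
Local Notation RM := (measurableTypeR R).
Let hp := @hgt_gt0 R L L100.
Let wp := @wid_gt0 R.

(* A stage consists of [sweeps] passes through the three gluing lines of a column
   and one extra step.  Stage 0, at scale [n], leads from the row [b] to the row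
   [e], and its extra step is the jump from [e] to [e'] along the line [x = c];
   stage [s >= 1], at scale [n + s - 1], leads to the row of [y0], and its extra
   step does nothing. *)
Definition sweeps : nat := radius + 3 * L.
Definition stage_len : nat := (3 * sweeps).+1.
(** Worst case, stage 0: in units of [wid n], [dist_box] gives 1 + (M + 1) + 3 from the end point to
    the point of height e' [hgt n] on the line c, and 26 + (M + 1) + 3 from there to the box. It
    serves as the exponent in 4^reach, which exceeds it. *)
Definition reach : nat := 2 * sweeps + 35.
Local Notation M := sweeps.
Local Notation K := stage_len.

Variables (n N b e e' : int) (x0 y0 : R).
Let c : R := wid n * N%:~R.
Hypothesis x0c : `|x0 - c| <= wid n.
Hypothesis be : `|b - e| <= radius%:Z.
Hypothesis ee' : row_glued (L := L) n c e e'.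
Hypothesis e'y0 : `|e' - row (hgt n) y0| <= radius%:Z.

Let sc (s : nat) : int := n + s.-1%:Z.

(** From stage 1 on, the column of scale one coarser that contains x0; in stage 0, the column of the
    line x = c, where the coarse jump takes place. *)
Definition base (s : nat) : int :=
  if s is 0 then (N %/ 4)%Z else row (wid (sc s - 1)) x0.

Definition goal_row (s : nat) : int := if s is 0 then e else row (hgt (sc s)) y0.

(** The boxes of stage 0 are centred at row e, which may be far from y0 in the plane. *)
Definition goal_height (s : nat) : R := if s is 0 then e%:~R * hgt n else y0.

Definition coarse_jump (y : R) : R :=
  if row (hgt n) y == e then y + (e' - e)%:~R * hgt n else y.

(** In stages s >= 1 the extra step repeats the third line, where the last sweep ended, so its
    segment has length zero. *)
Definition grid_x (s j : nat) : R :=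
  if (j < 3 * M)%N then wid (sc s) * (4 * base s + (1 + j %% 3)%N%:Z)%:~R
  else if s is 0 then c else wid (sc s) * (4 * base s + 3%:Z)%:~R.

Definition grid_jump (s j : nat) (y : R) : R :=
  if (j < 3 * M)%N then greedy_jump (L := L) (sc s) (1 + j %% 3) (goal_row s) y
  else if s is 0 then coarse_jump y else y.

Definition gX (k : nat) : R := if k is k'.+1 then grid_x (k' %/ K) (k' %% K) else c.

Definition gJ (k : nat) : R -> R := grid_jump (k %/ K) (k %% K).

Definition gS (k : nat) : set (RM * RM) :=
  let s := (k %/ K)%N in
  `[x0 - 25 * wid (sc s), x0 + 25 * wid (sc s)]%classic `*`
  `[goal_height s - (M.+1)%:R * hgt (sc s), goal_height s + (M.+1)%:R * hgt (sc s)]%classic.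

Lemma divK (s j : nat) : (j < K)%N -> ((s * K + j) %/ K = s)%N.
Proof. by move=> jK; rewrite divnMDl// divn_small// addn0. Qed.

Lemma modK (s j : nat) : (j < K)%N -> ((s * K + j) %% K = j)%N.
Proof. by move=> jK; rewrite modnMDl modn_small. Qed.

Lemma base_near s (i : nat) : (i <= 3)%N ->
  `|wid (sc s) * (4 * base s + i%:Z)%:~R - x0| <= 5 * wid (sc s).
Proof.
move=> i3; have w0 := wp (sc s).
have i0 : 0 <= i%:R :> R by [].
have i3r : i%:R <= 3 :> R by rewrite (ler_nat R i 3).
case: s w0 => [|s] w0.
  have s0 : sc 0 = n by rewrite /sc addr0.
  rewrite s0 /= in w0 *.
  have := divz_eq N 4; have : 0 <= (N %% 4)%Z by apply: modz_ge0.
  have : (N %% 4)%Z < 4 by apply: ltz_pmod.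
  move: (N %/ 4)%Z (N %% 4)%Z => q r r4 r0 NE.
  have r3 : r%:~R <= 3 :> R by rewrite -[3]/(3%:~R) ler_int; move: r4; clear; lia.
  have r0' : 0 <= r%:~R :> R by rewrite ler0z.
  have : `|wid n * (4 * q + i%:Z)%:~R - c| <= 3 * wid n.
    rewrite /c NE -mulrBr normrM gtr0_norm// mulrC ler_pM2r//.
    rewrite intr4 intrD intrM ler_norml; lra.
  move: x0c; rewrite !ler_norml; lra.
have w4 : 0 < wid (sc s.+1 - 1) :> R := wp _.
have /andP[a1 a2] := row_itv x0 w4; rewrite /base.
move: a1 a2; set r := row _ _; rewrite [wid (sc s.+1 - 1)]widS subrK => a1 a2.
rewrite intrD in a2; rewrite intr4 ler_norml.
have : wid (sc s.+1) * i%:R <= wid (sc s.+1) * 3 :> R by rewrite ler_pM2l.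
have : 0 <= wid (sc s.+1) * i%:R :> R by rewrite mulr_ge0// ltW.
by move=> *; apply/andP; split; lra.
Qed.

Lemma gX_near k : `|gX k.+1 - x0| <= 5 * wid (walk_scale n K k).
Proof.
rewrite /gX /grid_x -/(sc (k %/ K)).
case: ifP => _; first by apply: base_near; rewrite add1n ltn_mod.
case E : (k %/ K)%N => [|s]; last by rewrite -E; apply: base_near.
rewrite /walk_scale E addr0 distrC; apply: le_trans x0c _.
by have := wp n; lra.
Qed.

(** The node may have been placed by the preceding stage, whose scale is at most one coarser: 20 = 4
    * 5. *)
Lemma gX_near0 k : `|gX k - x0| <= 20 * wid (walk_scale n K k).
Proof.
case: k => [|k].
  rewrite /walk_scale div0n addr0 distrC; apply: le_trans x0c _.
  by have := wp n; lra.
apply: le_trans (gX_near k) _.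
have : wid (walk_scale n K k) <= 4 * wid (walk_scale n K k.+1) :> R.
  rewrite -[4 * _]/(4 * wid _) /walk_scale.
  have kk : (k.+1 %/ K <= (k %/ K).+1)%N.
    apply: leq_trans (leq_div2r K (_ : (k.+1 <= k + K)%N)) _.
      by rewrite -addn1 leq_add2l.
    by rewrite divnDr ?dvdnn// divnn addn1.
  have -> : 4 * wid (n + (k.+1 %/ K).-1%:Z) = wid (n + (k.+1 %/ K).-1%:Z - 1) :> R.
    by rewrite [RHS]widS subrK.
  apply: le_wid; move: kk; move: (k.+1 %/ K)%N (k %/ K)%N; clear; lia.
lra.
Qed.

Lemma H_step s j w : (j < K)%N ->
  iteri (s * K + j).+1 gJ w = grid_jump s j (iteri (s * K + j) gJ w).
Proof. by move=> jK; rewrite /= {1}/gJ divK// modK. Qed.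

Section Stage.
Variables (s : nat) (w : R).
Let r j := row (hgt (sc s)) (iteri (s * K + j) gJ w).
Hypothesis start : `|r 0 - goal_row s| <= M%:Z.

Lemma r_step j : (j < 3 * M)%N -> r j.+1 = greedy (1 + j %% 3) (goal_row s) (r j).
Proof.
move=> jM; rewrite /r addnS H_step; last by rewrite ltnS ltnW.
by rewrite /grid_jump jM row_greedy_jump.
Qed.

Lemma stage_le j : (j <= 3 * M)%N -> `|r j - goal_row s| <= M%:Z.
Proof.
elim: j => [//|j IH] jM; rewrite r_step//; apply: le_trans (greedy_le _ _ _) _.
by apply: IH; exact: ltnW.
Qed.

Lemma stage_sweep q : (q <= M)%N -> `|r (3 * q) - goal_row s| <= M%:Z - q%:Z.
Proof.
elim: q => [_|q IH qM]; first by rewrite muln0 subr0.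
have -> : (3 * q.+1 = (3 * q).+3)%N by lia.
have [l1 l2 l3] : [/\ (3 * q < 3 * M)%N, ((3 * q).+1 < 3 * M)%N & ((3 * q).+2 < 3 * M)%N].
  by split; lia.
rewrite !r_step//.
have -> : ((3 * q) %% 3 = 0)%N by rewrite modnMr.
have -> : ((3 * q).+1 %% 3 = 1)%N by rewrite -addn1 mulnC modnMDl.
have -> : ((3 * q).+2 %% 3 = 2)%N by rewrite -addn2 mulnC modnMDl.
apply: greedy_sweep; first by move: qM; clear; lia.
by have := IH (ltnW qM); clear; lia.
Qed.

Lemma stage_end : r (3 * M) = goal_row s.
Proof.
have := stage_sweep (leqnn M); rewrite subrr normr_le0 subr_eq0.
by move/eqP.
Qed.

End Stage.

(** This fixes the number of sweeps. Stages 0 and 1 start within [radius] rows of their goals, by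
    the route b, e, e'. A later stage starts in the same row of the preceding scale as y0, hence
    within 3L + 1 rows of it. *)
Lemma stage_start s w : row (hgt n) w = b ->
  `|row (hgt (sc s)) (iteri (s * K + 0) gJ w) - goal_row s| <= M%:Z.
Proof.
move=> wb; have rM : radius%:Z <= M%:Z by rewrite /M; lia.
elim: s => [|s IH].
  by rewrite mul0n /sc addr0 /= wb; exact: le_trans be rM.
have E := stage_end IH.
have -> : (s.+1 * K + 0 = (s * K + 3 * M).+1)%N by rewrite addn0 mulSn /stage_len; lia.
rewrite H_step// /grid_jump ltnn; move: E; set y := iteri _ gJ w => E.
case: s {IH} @y E => [|s] y E.
  rewrite /coarse_jump; rewrite /= /sc addr0 in E *; rewrite E eqxx rowDz// E.
  by rewrite [e + _]addrC subrK; exact: le_trans e'y0 rM.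
rewrite /= in E *.
have scS : sc s.+2 = sc s.+1 + 1 by rewrite /sc /=; lia.
have /andP[a1 a2] := row_itv y (hp (sc s.+1)).
have /andP[b1 b2] := row_itv y0 (hp (sc s.+1)).
rewrite E in a1 a2; rewrite intrD mulrDl mul1r in a2 b2.
have D : `|y0 - y| <= (3 * L)%N%:Z%:~R * hgt (sc s.+2).
  have -> : (3 * L)%N%:Z%:~R * hgt (sc s.+2) = hgt (sc s.+1).
    by rewrite scS [RHS](hgtS L100).
  by rewrite ler_norml; lra.
apply: le_trans (row_close L100 D) _.
by have := radius_ge; rewrite /M; clear; lia.
Qed.

Lemma height_stage k w : row (hgt n) w = b ->
  `|iteri k gJ w - goal_height (k %/ K)| <= (M.+1)%:R * hgt (sc (k %/ K)).
Proof.
move=> wb; have E := divn_eq k K; have jK : (k %% K < K)%N by rewrite ltn_mod.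
have H := stage_le (stage_start (k %/ K) wb) jK; rewrite -E in H.
have h0 := hp (sc (k %/ K)).
have close (y z : R) : `|row (hgt (sc (k %/ K))) y - row (hgt (sc (k %/ K))) z| <= M%:Z ->
    `|y - z| <= (M.+1)%:R * hgt (sc (k %/ K)).
  have /andP[a1 a2] := row_itv y h0; have /andP[b1 b2] := row_itv z h0.
  rewrite intrD mulrDl mul1r in a2 b2.
  rewrite -(ler_int R) intr_norm intrB ler_norml => /andP[d1 d2].
  have := ler_wpM2r (ltW h0) d1; have := ler_wpM2r (ltW h0) d2.
  rewrite -[M%:Z%:~R]/(M%:R : R) -natr1 ler_norml => *; apply/andP; split; lra.
case: (k %/ K)%N H close h0 => [|s] H close h0; last exact: close.
rewrite /goal_height; apply: (close _ _) => //.
have -> : row (hgt (sc 0)) (e%:~R * hgt n) = e; last exact: H.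
rewrite /sc addr0; apply: row_def => //.
by rewrite lexx/= ltr_pM2r// ltr_int ltzD1.
Qed.

Lemma reach_ge (x : R) : x <= (2 * M + 35)%:R -> x <= wid (- reach%:Z).
Proof.
move=> h; apply: le_trans h _; rewrite widN wid_nat exprVn invrK -natrX ler_nat.
by rewrite ltnW// ltn_expl.
Qed.

Lemma reach_wid k (x : R) : x <= (2 * M + 35)%:R ->
  x * wid (walk_scale n K k) <= wid (- reach%:Z) * wid (walk_scale n K k).
Proof. by move=> h; rewrite ler_pM2r//; exact: reach_ge. Qed.

Lemma M35 : (2 * M + 35)%:R = 2 * M%:R + 35 :> R.
Proof. by rewrite natrD natrM. Qed.

Lemma gX_move : gX 1 != gX 2.
Proof.
have M2 : (200 <= M)%N by have := radius_ge; rewrite /sweeps; lia.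
have K1 : (1 < K)%N by rewrite /stage_len; lia.
have c0 : (0 < 3 * M)%N by lia.
have c1 : (1 < 3 * M)%N by lia.
rewrite /gX /grid_x div0n !mod0n (divn_small K1) (modn_small K1) c0 c1.
rewrite (inj_eq (mulfI (lt0r_neq0 (wp _)))) eqr_int /=.
by apply/eqP; lia.
Qed.

Lemma concrete_walk : walk (pihat (x0, y0)) n b K reach c.
Proof.
have w0 k := wp (walk_scale n K k); have M0 : 0 <= M%:R :> R by [].
apply: (@Walk R L (pihat (x0, y0)) n b K reach c gX gJ gS) => //.
- move=> k y; rewrite /gX /gJ /grid_x /grid_jump.
  case: ifP => _; first by apply: greedy_jump_Rinf => //; rewrite add1n ltnS ltn_mod.
  case: (k %/ K)%N => [|s]; last exact: Rinf_refl.
  rewrite /coarse_jump; case: eqP => [/ee'//|_]; exact: Rinf_refl.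
- move=> k y y'; rewrite /gJ /grid_jump.
  case: ifP => _ yy'.
    by rewrite /greedy_jump yy' ![_ + _ - _]addrAC !subrr.
  case E : (k %/ K)%N yy' => [|s] yy'; last by rewrite !subrr.
  rewrite /walk_scale E addr0 in yy'.
  rewrite /coarse_jump yy'; case: ifP => _; last by rewrite !subrr.
  by rewrite ![_ + _ - _]addrAC !subrr.
- move=> k y; rewrite /gJ /grid_jump; case: ifP => _; first by eexists; reflexivity.
  case E : (k %/ K)%N => [|s]; last by exists 0; rewrite mul0r addr0.
  rewrite /coarse_jump /walk_scale E addr0.
  by case: ifP => _; [eexists; reflexivity|exists 0; rewrite mul0r addr0].
- move=> k; have := gX_near k; have := gX_near0 k.
  have h : 25 * wid (walk_scale n K k) <= wid (- reach%:Z) * wid (walk_scale n K k) :> R.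
    by apply: reach_wid; rewrite M35; lra.
  have := ler_distD x0 (gX k.+1) (gX k); rewrite [`|x0 - gX k|]distrC.
  lra.
- exact: gX_move.
- by move=> k; apply: measurableX; exact: measurable_itv.
- move=> k w x wb /andP[x1 x2]; split => /=; rewrite in_itv/=.
    have := gX_near k; have := gX_near0 k; have := w0 k.
    rewrite /walk_scale -/(sc (k %/ K)) !ler_norml => ? /andP[? ?] /andP[? ?].
    move: x1 x2; rewrite ge_min le_max => /orP[?|?] /orP[?|?]; apply/andP; split; lra.
  have := height_stage k wb; rewrite /wH ler_norml => /andP[? ?].
  by apply/andP; split; lra.
- move=> k [x y] [/=]; rewrite !in_itv/= => xI yI.
  have X1 : `|x0 - x| <= 25 * wid (sc (k %/ K)) by rewrite ler_norml; lra.
  have Y1 : `|goal_height (k %/ K) - y| <= M.+1%:R * hgt (sc (k %/ K)).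
    by rewrite ler_norml; lra.
  case E : (k %/ K)%N X1 Y1 => [|s] X1 Y1; last first.
    apply: le_trans (dist_box L100 X1 Y1) _.
    rewrite -E; apply: (@reach_wid k); rewrite M35 -natr1; lra.
  have scn : sc 0 = n by rewrite /sc addr0.
  rewrite scn /= in X1 Y1.
  (* The distance is estimated through the point of the line x = c at the bottom of row e, which is
     glued to the bottom of row e', a row close to y0. *)
  have he : row (hgt n) (e%:~R * hgt n) = e.
    by apply: row_def => //; rewrite lexx/= ltr_pM2r// ltr_int ltzD1.
  have glued := pihat_eq (ee' he).
  have ee : e%:~R * hgt n + (e' - e)%:~R * hgt n = e'%:~R * hgt n.
    by rewrite intrB; ring.
  rewrite ee in glued.
  have Y2 : `|y0 - e'%:~R * hgt n| <= (M.+1)%:R * hgt n.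
    have /andP[a1 a2] := row_itv y0 (hp n).
    have := e'y0; rewrite -(ler_int R) intr_norm intrB ler_norml => /andP[d1 d2].
    have rM : radius%:Z%:~R <= M%:R :> R by rewrite (ler_nat R radius M) leq_addr.
    have h0 := hp n; rewrite intrD mulrDl mul1r in a2.
    have := ler_wpM2r (ltW h0) d1; have := ler_wpM2r (ltW h0) d2.
    have := ler_wpM2r (ltW h0) rM; rewrite -natr1 ler_norml; lra.
  have X2 : `|x0 - c| <= 1 * wid n by rewrite mul1r.
  have X3 : `|c - x| <= 26 * wid n.
    by have := ler_distD x0 c x; rewrite [`|c - x0|]distrC; lra.
  have D1 := dist_box L100 X2 Y2; have D2 := dist_box L100 X3 Y1.
  apply: le_trans (dist_triangle L100 (pihat (c, e'%:~R * hgt n)) _ _) _.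
  rewrite -{2}glued; apply: le_trans (lerD D1 D2) _.
  have <- : wid (walk_scale n K k) = wid n :> R by rewrite /walk_scale E addr0.
  by rewrite -mulrDl; apply: reach_wid; rewrite M35 -natr1; lra.
Qed.

End ConcreteWalk.

(** * The pencil of curves *)

Section Pencil.
Context {R : realType} {L : nat}.
Hypothesis L100 : (100 <= L)%N.
Local Notation hgt := (@hgt R L).
Local Notation pihat := (@pihat R L).
Local Notation leb := (@lebesgue_measure R).
Local Notation RM := (measurableTypeR R).
Variables (P Q : Xinf R L) (n b : int) (K a : nat) (x0 : R).
Variables (WP : walk P n b K a x0) (WQ : walk Q n b K a x0).
Hypothesis K0 : (0 < K)%N.
Local Notation TP := (total WP).
Local Notation TQ := (total WQ).

(** Both curves with parameter w start at the same point of the line x0, so they join at time 0. *)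
Definition pencil (t : R) (w : RM) : Xinf R L :=
  if t < 0 then curve WP (- t) (clamp_row (hgt n) b w)
  else curve WQ t (clamp_row (hgt n) b w).

Let TP0 : 0 < TP := total_gt0 L100 WP K0.
Let TQ0 : 0 < TQ := total_gt0 L100 WQ K0.

Lemma pencil_ends w : pencil (- TP) w = P /\ pencil TQ w = Q.
Proof.
rewrite /pencil oppr_lt0 TP0 opprK [TQ < 0]ltNge (ltW TQ0)/=.
by rewrite !curve_end.
Qed.

Lemma pencil_lip s t w : - TP <= s <= TQ -> - TP <= t <= TQ ->
  dist (pencil s w) (pencil t w) <= `|s - t|.
Proof.
wlog st : s t / s <= t.
  move=> H sI tI; case: (leP s t) => [st|/ltW ts]; first exact: H.
  by rewrite (distC L100) distrC; exact: H.
move=> /andP[s1 s2] /andP[t1 t2].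
have wb := @row_clamp R (hgt n) b w (hgt_gt0 L100 n).
rewrite distrC ger0_norm ?subr_ge0// /pencil.
have [s0|s0] := ltP s 0; have [t0|t0] := ltP t 0.
- rewrite (distC L100).
  have := @curve_lip R L L100 P n b K a x0 WP K0 (- t) (- s) (clamp_row (hgt n) b w) wb.
  by move=> h; apply: le_trans (h _ _) _; [apply/andP; split; lra|lra|lra].
- have h1 := @dist_curve_start R L L100 P n b K a x0 WP K0 (- s) _ wb.
  have h2 := @dist_curve_start R L L100 Q n b K a x0 WQ K0 t _ wb.
  have {}h1 := h1 ltac:(apply/andP; split; lra).
  have {}h2 := h2 ltac:(apply/andP; split; lra).
  apply: le_trans (dist_triangle L100 (pihat (x0, clamp_row (hgt n) b w)) _ _) _.
  by rewrite [X in X + _ <= _](distC L100); lra.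
- by exfalso; lra.
- by apply: curve_lip => //; rewrite s0.
Qed.

Let part (A : set (Xinf R L)) : set (RM * RM) :=
  `[- TP, TQ]%classic `*` setT `&` [set z | A (pencil z.1 z.2)].

Let negt : set (RM * RM) := [set t : RM | t < 0] `*` setT.

Let atom (t : R) (w : Xinf R L) (A : set (Xinf R L)) : set (RM * RM) :=
  [set z | z.1 = t /\ A w].

(** At time 0 the pencil already follows the second curve, so [negt] removes that instant from the
    reversed pieces. The two end times lie in no piece, as these are half-open and end before
    [total]; they give the null atoms. *)
Lemma pencil_partE A : part A =
  ((\bigcup_k piece WP false A k) `&` negt) `|` (\bigcup_k piece WQ true A k) `|`
  (atom (- TP) P A `|` atom TQ Q A).
Proof.
apply/seteqP; split => [[t w]|[t w]].
  move=> [[/=]]; rewrite in_itv/= => /andP[t1 t2] _; rewrite /pencil.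
  have [t0|t0] := ltP t 0.
    have [tE|tT] := eqVneq t (- TP).
      by rewrite tE opprK curve_end// => PA; right; left.
    have tI : 0 <= pos_time false t < TP.
      rewrite /pos_time; move: tT; rewrite neq_lt => /orP[?|?]; apply/andP; split; lra.
    move=> At; have [k kP] := (pieceE L100 K0 A w tI).1 At.
    by left; left; split; [exists k|].
  have [tE|tT] := eqVneq t TQ.
    by rewrite tE curve_end// => QA; right; right.
  have tI : 0 <= pos_time true t < TQ by rewrite /pos_time t0 lt_neqAle tT.
  move=> At; have [k kP] := (pieceE L100 K0 A w tI).1 At.
  by left; right; exists k.
have range (s : bool) (V : Xinf R L) (W : walk V n b K a x0) k :
    piece W s A k (t, w) -> 0 <= pos_time s t < total W.
  move=> [[/= /andP[k1 k2] _] _]; rewrite (le_trans (time_ge0 W k) k1)/=.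
  exact: lt_le_trans k2 (time_le_total L100 W K0 _).
move=> [[[[k _ kP] [/= t0 _]]|[k _ kP]]|[[/= -> PA]|[/= -> QA]]].
- have tI := range _ _ _ _ kP; have := (pieceE L100 K0 A w tI).2 (ex_intro _ k kP).
  move: tI; rewrite /pos_time => /andP[t1 t2] At; split; last by rewrite /= /pencil t0.
  by split => //=; rewrite in_itv/=; move: TP0 TQ0 => ? ?; apply/andP; split; lra.
- have tI := range _ _ _ _ kP; have := (pieceE L100 K0 A w tI).2 (ex_intro _ k kP).
  move: tI; rewrite /pos_time => /andP[t1 t2] At; split.
    by split => //=; rewrite in_itv/=; move: TP0 TQ0 => ? ?; apply/andP; split; lra.
  by rewrite /= /pencil ltNge t1.
- split; last by rewrite /= (pencil_ends w).1.
  by split => //=; rewrite in_itv/=; move: TP0 TQ0 => ? ?; apply/andP; split; lra.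
- split; last by rewrite /= (pencil_ends w).2.
  by split => //=; rewrite in_itv/=; move: TP0 TQ0 => ? ?; apply/andP; split; lra.
Qed.

Lemma atom_rect t w A : atom t w A `<=` [set t] `*` setT.
Proof. by move=> z [zt _]; split. Qed.

Lemma measurable_atom t w A : measurable (atom t w A).
Proof.
have [Aw|nAw] := pselect (A w).
  have -> : atom t w A = [set t] `*` setT by apply/seteqP; split => [z []|z []].
  by apply: measurableX => //; exact: measurable_set1.
by have -> : atom t w A = set0 by apply/seteqP; split => [z []|z []].
Qed.

Lemma measurable_part A : Xmeasurable A -> measurable (part A).
Proof.
move=> mA; rewrite pencil_partE; apply: measurableU; last first.
  by apply: measurableU; exact: measurable_atom.
apply: measurableU; last by apply: bigcupT_measurable => k; exact: measurable_piece.
apply: measurableI; first by apply: bigcupT_measurable => k; exact: measurable_piece.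
apply: measurableX => //.
have -> : [set t : RM | t < 0] = `]-oo, 0[%classic.
  by apply/seteqP; split => t /=; rewrite in_itv.
exact: measurable_itv.
Qed.

Lemma pencil_measurable : curves_measurable (- TP) TQ pencil.
Proof. by move=> A mA; exact: measurable_part. Qed.

Lemma pencil_measure (nu : probability RM R) A (rho : R) : Xmeasurable A ->
  (forall B : set RM, measurable B ->
    nu B = ((hgt n)^-1%:E * leb (B `&` rows (hgt n) b (b + 1)))%E) ->
  wid (- a%:Z) * wid n < rho ->
  (mu_Gamma nu (- TP) TQ pencil A <=
     (@riesz_const R L K a)%:E * (riesz_restr P rho%:E A + riesz_restr Q rho%:E A))%E.
Proof.
move=> mA nuE rhoP; rewrite /mu_Gamma -/(part A).
have mP k : measurable (piece WP false A k) by exact: measurable_piece.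
have mQ k : measurable (piece WQ true A k) by exact: measurable_piece.
have mUP : measurable (\bigcup_k piece WP false A k) by exact: bigcupT_measurable.
have mUQ : measurable (\bigcup_k piece WQ true A k) by exact: bigcupT_measurable.
have mL t : measurable ([set t] `*` setT : set (RM * RM)).
  by apply: measurableX => //; exact: measurable_set1.
have L0 t : ((leb \x nu) ([set t] `*` setT) = 0)%E.
  by rewrite product_measure1E//= ?lebesgue_measure_set1 ?mul0e//; exact: measurable_set1.
have MU (E F : set (RM * RM)) : measurable E -> measurable F ->
    ((leb \x nu) (E `|` F) <= (leb \x nu) E + (leb \x nu) F)%E.
  by move=> mE mF; exact: measureU2.
pose U : set (RM * RM) := (\bigcup_k piece WP false A k) `|` (\bigcup_k piece WQ true A k).
pose V : set (RM * RM) := ([set - TP] `*` setT) `|` ([set TQ] `*` setT).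
have mU : measurable U by exact: measurableU.
have mV : measurable V by exact: measurableU.
have sub : part A `<=` U `|` V.
  rewrite pencil_partE => z [[[zP _]|zQ]|[zP|zQ]].
  - by left; left.
  - by left; right.
  - by right; left; exact: atom_rect zP.
  - by right; right; exact: atom_rect zQ.
apply: (@le_trans _ _ ((leb \x nu) (U `|` V))%E).
  by apply: le_measure; rewrite ?inE//; [exact: measurable_part|exact: measurableU].
apply: le_trans (MU _ _ mU mV) _.
have V0 : ((leb \x nu) V <= 0)%E.
  by apply: le_trans (MU _ _ (mL _) (mL _)) _; rewrite !L0 adde0.
rewrite ge0_muleDr ?riesz_restr_ge0// -[leRHS]adde0; apply: leeD V0.
apply: le_trans (MU _ _ mUP mUQ) _.
by apply: leeD; exact: pieces_measure.
Qed.

End Pencil.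

(** * Choice of the constant and conclusion *)

Unset Implicit Arguments.

Theorem mainTheorem16 (R : realType) (L : nat) : (100 <= L)%N ->
  exists C : R, forall p q : Xinf R L,
    exists (d : measure_display) (Omega : measurableType d)
           (nu : probability Omega R) (a b : R) (Gamma : R -> Omega -> Xinf R L),
      [/\ a <= b /\ curves_measurable a b Gamma,
          {ae nu, forall w, Gamma a w = p /\ Gamma b w = q},
          (forall w s t, a <= s <= b -> a <= t <= b ->
             (dinf (Gamma s w) (Gamma t w) <= (C * `|s - t|)%:E)%E),
          ((b - a)%:E <= C%:E * dinf p q)%E &
          (forall A : set (Xinf R L), Xmeasurable A ->
             (mu_Gamma nu a b Gamma A <=
                C%:E * (riesz_restr p (C%:E * dinf p q) A
                        + riesz_restr q (C%:E * dinf p q) A))%E)].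
Proof.
move=> L100; pose K := @stage_len L; pose a := @reach L.
have K0 : (0 < K)%N by [].
have wa : 0 < wid (- a%:Z) :> R by exact: wid_gt0.
have K0r : 0 <= K%:R :> R by [].
have rc0 : 0 <= @riesz_const R L K a.
  have mv0 := @mv_gt0 R L L100; have bc0 := @ball_const_gt0 R.
  by rewrite /riesz_const !mulr_ge0// ?exprn_ge0// ltW.
(* Since wid n <= 32 d(P, Q), the two durations, each at most 3 K 4^a wid n, give 192 = 2 * 3 * 32,
   and 33 > 32 makes the radius strictly larger than the reach of the boxes. The 1 gives C >= 1, as
   unit speed requires. *)
pose C : R := 1 + @riesz_const R L K a + 192 * K%:R * wid (- a%:Z) + 33 * wid (- a%:Z).
have KW : 0 <= K%:R * wid (- a%:Z) :> R by rewrite mulr_ge0// ltW.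
have C1 : 1 <= C by rewrite /C; lra.
have C0 : 0 <= C by lra.
exists C => P Q.
have rhs0 A r : (0 <= riesz_restr P r A + riesz_restr Q r A)%E.
  by rewrite adde_ge0// riesz_restr_ge0.
have := dist_ge0 L100 P Q; rewrite le_eqVlt => /predU1P[D0|D0].
  (* At distance zero the curve is constant on a one-point interval, and its associated measure
     vanishes. *)
  have PQ : P = Q.
    move: D0; have [p ->] := pihat_surj P; have [q ->] := pihat_surj Q => D0.
    by apply/pihat_eq/(dist_eq0 L100).
  have [nu _] := @row_probability R 1 0 ltr01.
  have mG A : Xmeasurable A -> measurable (`[0, 0]%classic `*` setT `&`
      [set z | A P] : set (measurableTypeR R * measurableTypeR R)).
    move=> mA; have [PA|nPA] := pselect (A P).
      have -> : [set z : measurableTypeR R * measurableTypeR R | A P] = setT.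
        by apply/seteqP; split.
      by rewrite setIT; apply: measurableX => //; exact: measurable_itv.
    have -> : [set z : measurableTypeR R * measurableTypeR R | A P] = set0.
      by apply/seteqP; split.
    by rewrite setI0.
  exists _, (measurableTypeR R), nu, 0, 0, (fun _ _ => P); split.
  - by split => // A /mG.
  - by apply: aeW => w; rewrite -PQ.
  - by move=> w s t _ _; rewrite dinfE// distxx// lee_fin mulr_ge0.
  - by rewrite subrr mule_ge0// ?lee_fin// dinf_ge0.
  - move=> A mA; apply: (@le_trans _ _ 0%E); last by rewrite mule_ge0// lee_fin.
    have <- : ((@lebesgue_measure R \x nu) (`[0%R, 0%R]%classic `*` setT))%E = 0%E.
      rewrite set_itv1.
      by rewrite product_measure1E//= ?lebesgue_measure_set1 ?mul0e//; exact: measurable_set1.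
    apply: le_measure; rewrite ?inE; [exact: mG| |by move=> z []].
    by apply: measurableX => //; exact: measurable_itv.
have [n /andP[n1 n2]] := @scale_ex R L L100 _ D0.
have [p pE] := pihat_surj P; have [q qE] := pihat_surj Q.
have [N [b [pN qN [e [e' [be ee' e'p]]] [f [f' [bf ff' f'q]]]]]] :
  exists N b : int, let x := wid n * N%:~R in
    [/\ `|p.1 - x| <= wid n, `|q.1 - x| <= wid n,
      @reachable R L n x b p.2 & @reachable R L n x b q.2].
  by apply: near_rows => //; rewrite -pE -qE.
have WP := concrete_walk L100 pN be ee' e'p.
have WQ := concrete_walk L100 qN bf ff' f'q.
rewrite -surjective_pairing -pE in WP; rewrite -surjective_pairing -qE in WQ.
have hn := @hgt_gt0 R L L100 n.
have [nu nuE] := @row_probability R (hgt L n) b hn.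
have wn := @wid_gt0 R n.
have TP0 := total_gt0 L100 WP K0; have TQ0 := total_gt0 L100 WQ K0.
have TPle := total_le L100 WP K0; have TQle := total_le L100 WQ K0.
have wD : wid n <= 32 * dist P Q by lra.
have wwD : wid (- a%:Z) * wid n <= wid (- a%:Z) * (32 * dist P Q) by rewrite ler_pM2l.
have CD : (C%:E * dinf P Q = (C * dist P Q)%:E)%E by rewrite dinfE// EFinM.
have rD : 0 <= @riesz_const R L K a * dist P Q by rewrite mulr_ge0// ltW.
have kD : 0 <= K%:R * wid (- a%:Z) * dist P Q by rewrite mulr_ge0// ltW.
have aD : 0 < wid (- a%:Z) * dist P Q by rewrite mulr_gt0.
exists _, (measurableTypeR R), nu, (- total WP), (total WQ), (pencil WP WQ); split.
- split; first by lra.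
  exact: pencil_measurable.
- by apply: aeW => w; exact: pencil_ends.
- move=> w s t sI tI; rewrite dinfE// lee_fin.
  apply: le_trans (pencil_lip L100 K0 w sI tI) _.
  by rewrite ler_peMl.
- rewrite CD lee_fin opprK.
  have : K%:R * (wid (- a%:Z) * wid n) <= K%:R * (wid (- a%:Z) * (32 * dist P Q)) :> R.
    exact: ler_wpM2l.
  by rewrite /C; move: TPle TQle; rewrite -/K -/a; lra.
- move=> A mA; rewrite CD.
  have CDlt : wid (- a%:Z) * wid n < C * dist P Q by rewrite /C; move: wwD; lra.
  have := @pencil_measure R L L100 P Q n b K a _ WP WQ K0 nu A _ mA nuE CDlt.
  move=> /le_trans; apply.
  apply: lee_wpmul2r => //; rewrite lee_fin /C; lra.
Qed.
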